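(* Suppose Assumptions 1, 2 and 3 (listed in the context) hold. Then, as $n\to\infty$, $$\sqrt{nb^{1/2}}\left\{\tilde J(c)-J(c)-B(c)b+o(b)\right\}\overset{d}{\longrightarrow}N\left(0,V(c)\right),$$ where $o(b)$ denotes some non-random sequence $r_n$ with $r_n/b_n\to0$, $$B(c)=\frac{1}{\delta^{1/2}}\left[\frac{c}{\pi}\left\{\frac{\left(f_+^{(1)}(c)\right)^2}{f_+(c)}-\frac{\left(f_-^{(1)}(c)\right)^2}{f_-(c)}\right\}-\left\{\left(1-\frac{4}{3\pi}\right)\left(f_+^{(1)}(c)-f_-^{(1)}(c)\right)+\frac{c}{2}\left(f_+^{(2)}(c)-f_-^{(2)}(c)\right)\right\}\right],$$ $$V(c)=\lambda(\delta)\left\{\frac{f_+(c)+f_-(c)}{\sqrt{\pi}\,c^{1/2}}\right\},\qquad \lambda(\delta)=\frac{(1+\delta^{3/2})(1+\delta)^{1/2}-2\sqrt2\,\delta}{(1+\delta)^{1/2}(1-\delta^{1/2})^2}.$$ If in addition $nb^{5/2}\to0$ as $n\to\infty$, then $$\sqrt{nb^{1/2}}\left\{\tilde J(c)-J(c)\right\}\overset{d}{\longrightarrow}N\left(0,V(c)\right).$$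
   Context: $\mathbb R_+=[0,\infty)$; $c>0$ is a fixed known (interior) point; $\delta\in(0,1)$ is a fixed constant. Incomplete gamma functions: for $a,z>0$, $\gamma(a,z)=\int_0^z t^{a-1}e^{-t}dt$ and $\Gamma(a,z)=\int_z^\infty t^{a-1}e^{-t}dt$. Truncated gamma kernels: for $x\ge0$, $b>0$, $$K^-_{G(x,b;c)}(u)=\frac{u^{x/b}e^{-u/b}}{b^{x/b+1}\gamma(x/b+1,c/b)}\mathbf 1(0\le u<c),\qquad K^+_{G(x,b;c)}(u)=\frac{u^{x/b}e^{-u/b}}{b^{x/b+1}\Gamma(x/b+1,c/b)}\mathbf 1(u\ge c).$$ Given observations $X_1,\dots,X_n$ put $\hat f_{\pm,b}(c)=\frac1n\sum_{i=1}^nK^{\pm}_{G(c,b;c)}(X_i)$, and let $\hat f_{\pm,b/\delta}(c)$ be the same estimator with $b$ replaced by $b/\delta$. The bias-corrected estimators are $$\tilde f_\pm(c)=\left\{\hat f_{\pm,b}(c)\right\}^{1/(1-\delta^{1/2})}\left\{\hat f_{\pm,b/\delta}(c)\right\}^{-\delta^{1/2}/(1-\delta^{1/2})},$$ and $\tilde J(c)=\tilde f_+(c)-\tilde f_-(c)$. For a density $f$, $f_-(c)=\lim_{x\uparrow c}f(x)$, $f_+(c)=\lim_{x\downarrow c}f(x)$, $J(c)=f_+(c)-f_-(c)$, and $f_-^{(j)}(c)=\lim_{x\uparrow c}d^jf(x)/dx^j$, $f_+^{(j)}(c)=\lim_{x\downarrow c}d^jf(x)/dx^j$ for $j=1,2$.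 Assumption 1: $X_1,\dots,X_n$ is a random (i.i.d.) sample from a univariate distribution with a probability density function $f$ having support on $\mathbb R_+$. Assumption 2: the second derivative $f^{(2)}$ is Hölder-continuous of order $\varsigma\in(0,1]$ on $\mathbb R_+\setminus\{c\}$, i.e. there is $L\in(0,\infty)$ such that $|f^{(2)}(s)-f^{(2)}(t)|\le L|s-t|^\varsigma$ for all $s,t\in[0,c)$ and $|f^{(2)}(s')-f^{(2)}(t')|\le L|s'-t'|^\varsigma$ for all $s',t'\in[c,\infty)$ (at $c$, $f^{(2)}$ being understood as the right limit); moreover $f_\pm(c)>0$ and $|f_\pm^{(2)}(c)|<\infty$. Assumption 3: the smoothing parameter $b=b_n>0$ is non-random and satisfies $b+(nb)^{-1}\to0$ as $n\to\infty$. *)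

(* Defs.v *)
From HB Require Import structures.
From mathcomp Require Import all_boot all_order all_algebra.
From mathcomp Require Import finmap.
From mathcomp Require Import all_classical all_reals all_analysis.

Set Implicit Arguments.
Unset Strict Implicit.
Unset Printing Implicit Defensive.

Import Order.TTheory GRing.Theory Num.Theory.
Import numFieldNormedType.Exports.

Local Open Scope classical_set_scope.
Local Open Scope ring_scope.

Section probability_notions.
Context {d : measure_display} {T : measurableType d} {R : realType}.
Variable P : probability T R.

Definition mutually_independent (X : nat -> {RV P >-> R}) : Prop :=
  forall (J : {fset nat}) (A : nat -> set R),
    (forall i, i \in J -> measurable (A i)) ->
    P (\bigcap_(i in [set` J]) (X i @^-1` A i)) =
      (\prod_(i <- J) P (X i @^-1` A i))%E.

Definition has_density (X : {RV P >-> R}) (f : R -> R) : Prop :=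
  [/\ measurable_fun setT f, (forall x, 0 <= f x) &
      forall A : set R, measurable A ->
        distribution P X A = (\int[lebesgue_measure]_(x in A) (f x)%:E)%E].

(* [f] is a version of the density that vanishes on ]-oo, 0[; it may also
   vanish on parts of [0, +oo[. Identical distribution is expressed by the
   common density. *)
Definition iid_sample (X : nat -> {RV P >-> R}) (f : R -> R) : Prop :=
  [/\ mutually_independent X, (forall i, has_density (X i) f) &
      forall x, x < 0 -> f x = 0].

(* Convergence of the distribution functions of the random variables [Y n] to
   that of [nu] at every continuity point of the latter. *)
Definition cvg_in_distribution (Y : nat -> T -> R) (nu : probability (measurableTypeR R) R) :
  Prop :=
  (forall n, measurable_fun setT (Y n)) /\
  forall x : R, {for x, continuous (fun y : R => nu `]-oo, y]%classic)} ->
    P (Y n @^-1` `]-oo, x]%classic) @[n --> \oo] --> nu `]-oo, x]%classic.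

End probability_notions.

Section one_sided_limits.
Context {R : realType}.
Implicit Types (f : R -> R) (c x : R).

Definition left_derivn f (j : nat) c : R := lim (derive1n j f x @[x --> c^'-]).
Definition right_derivn f (j : nat) c : R := lim (derive1n j f x @[x --> c^'+]).

(* The second derivative of [f] on [0, +oo[, with the right limits as its
   values at the left endpoints of [0, c[ and [c, +oo[. *)
Definition second_deriv f c x : R :=
  if (x == 0) || (x == c) then right_derivn f 2 x else derive1n 2 f x.

Definition twice_derivable_off f c : Prop :=
  forall x, 0 < x -> x != c -> derivable f x 1 /\ derivable (derive1 f) x 1.

Definition holder_on (A : set R) (L s : R) (g : R -> R) : Prop :=
  forall x y, A x -> A y -> `|g x - g y| <= L * `|x - y| `^ s.

Definition smooth_off f c : Prop :=
  [/\ twice_derivable_off f c,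
      (exists s L : R, [/\ 0 < s, s <= 1, 0 < L,
         holder_on `[0, c[ L s (second_deriv f c) &
         holder_on `[c, +oo[ L s (second_deriv f c)]),
      (cvg (f x @[x --> c^'-]) /\ cvg (f x @[x --> c^'+])),
      (0 < left_derivn f 0 c /\ 0 < right_derivn f 0 c) &
      (cvg (derive1n 2 f x @[x --> c^'-]) /\ cvg (derive1n 2 f x @[x --> c^'+]))].

End one_sided_limits.

Section truncated_gamma_kernel.
Context {R : realType}.
Implicit Types a z x b c u delta : R.

Definition lower_gamma a z : R :=
  \int[lebesgue_measure]_(t in `]0, z]) (t `^ (a - 1) * expR (- t)).

Definition upper_gamma a z : R :=
  \int[lebesgue_measure]_(t in `[z, +oo[) (t `^ (a - 1) * expR (- t)).

Definition kernel_minus x b c u : R :=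
  u `^ (x / b) * expR (- u / b) /
    (b `^ (x / b + 1) * lower_gamma (x / b + 1) (c / b)) * \1_`[0, c[ u.

Definition kernel_plus x b c u : R :=
  u `^ (x / b) * expR (- u / b) /
    (b `^ (x / b + 1) * upper_gamma (x / b + 1) (c / b)) * \1_`[c, +oo[ u.

(* The estimators are functions of the data [xs 0], ..., [xs n.-1]. *)
Definition fhat_minus b c (n : nat) (xs : nat -> R) : R :=
  n%:R^-1 * \sum_(i < n) kernel_minus c b c (xs i).

Definition fhat_plus b c (n : nat) (xs : nat -> R) : R :=
  n%:R^-1 * \sum_(i < n) kernel_plus c b c (xs i).

(* The negative power of a vanishing estimate is read as 0, following [powR];
   both factors then vanish. *)
Definition bias_corrected delta (g_b g_bdelta : R) : R :=
  g_b `^ (1 / (1 - Num.sqrt delta)) *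
  g_bdelta `^ (- Num.sqrt delta / (1 - Num.sqrt delta)).

Definition ftilde_minus delta b c n xs : R :=
  bias_corrected delta (fhat_minus b c n xs) (fhat_minus (b / delta) c n xs).

Definition ftilde_plus delta b c n xs : R :=
  bias_corrected delta (fhat_plus b c n xs) (fhat_plus (b / delta) c n xs).

Definition Jtilde delta b c n xs : R :=
  ftilde_plus delta b c n xs - ftilde_minus delta b c n xs.

End truncated_gamma_kernel.

Section asymptotic_constants.
Context {R : realType}.
Variables (f : R -> R) (c delta : R).

Definition jump : R := right_derivn f 0 c - left_derivn f 0 c.

Definition bias_coef : R :=
  (Num.sqrt delta)^-1 *
  (c / pi * ((right_derivn f 1 c) ^+ 2 / right_derivn f 0 c -
             (left_derivn f 1 c) ^+ 2 / left_derivn f 0 c) -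
   ((1 - 4 / (3 * pi)) * (right_derivn f 1 c - left_derivn f 1 c) +
    c / 2 * (right_derivn f 2 c - left_derivn f 2 c))).

Definition lambda_coef : R :=
  ((1 + delta `^ (3 / 2)) * Num.sqrt (1 + delta) - 2 * Num.sqrt 2 * delta) /
  (Num.sqrt (1 + delta) * (1 - Num.sqrt delta) ^+ 2).

Definition var_coef : R :=
  lambda_coef *
  ((right_derivn f 0 c + left_derivn f 0 c) / (Num.sqrt pi * Num.sqrt c)).

End asymptotic_constants.

(* Main.v *)
(* Substituting u = c + s sqrt(b c) y, with s = 1 for the kernel on the right of c and s = -1 for the
   one on the left, turns the kernel with smoothing parameter b into a half-line weight
   exp(-a h(s y / sqrt a)), where a = c / b and h(v) = v - ln(1 + v). Laplace's method compares this
   weight with exp(-y^2/2) (1 + s y^3 / (3 sqrt a)). Together with the one-sided Taylor formula of f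
   it expands the mean of each estimator in powers of sqrt b up to o(b). The exponents of the bias
   correction cancel the term in sqrt b and leave the coefficient of b.

   The product of two kernels with parameters b and b' is a multiple of the kernel with parameter
   b b' / (b + b'), so the same expansion gives the variances. By strict differentiability of
   (A, B) |-> A^p B^q at (f(c), f(c)), the centered estimator is close in probability to a sum of
   independent bounded terms. Lindeberg's replacement argument, tested on C^2 spline steps and based
   on the stability of Gaussian laws under convolution, gives the limit law of that sum. *)

From HB Require Import structures.
Require Import Defs.
From mathcomp Require Import all_boot all_order all_algebra.
From mathcomp Require Import finmap.
From mathcomp Require Import all_classical all_reals all_analysis.
From mathcomp Require Import measurable_realfun.
From mathcomp Require Import ring lra.

Set Implicit Arguments.
Unset Strict Implicit.
Unset Printing Implicit Defensive.

Import Order.TTheory GRing.Theory Num.Theory.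
Import numFieldNormedType.Exports.

Local Open Scope classical_set_scope.
Local Open Scope ring_scope.

(** * Densities, affine changes of variables and half-line integrals *)

(** The mode of the kernel at [x = c] is the truncation point itself, so half of a Gaussian bump
    survives on each side. Its nonzero first moment creates the bias of order [sqrt b], and the
    cubic term of Laplace's expansion enters at order [b] through the ratio of the moments of order
    1 and 0; this is the origin of [1 - 4 / (3 pi)]. The Hölder bound on the second derivative gives
    a Taylor remainder [L y^(2 + r)] valid on the whole side of [c], hence of polynomial growth, so
    the kernel means need no splitting into a neighbourhood of [c] and a tail. Products of powers of
    estimates are hard to average; the centring is therefore the same correction applied to the two
    kernel means, a non-random sequence, and the allowed [o(b)] absorbs its distance from the stated
    bias. Both sides and both bandwidths are treated at once, by a sign [s] and a bandwidth
    argument. The summands of the linearized statistic are bounded by a sequence tending to 0, so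
    the third absolute moments in the replacement argument are at most that bound times the second
    moment. *)

Lemma integral_density {d} {T : measurableType d} {R : realType}
    (mu : {sigma_finite_measure set T -> \bar R}) (nu : {finite_measure set T -> \bar R})
    (f : T -> R) (g : T -> \bar R) :
  measurable_fun setT f -> (forall x, 0 <= f x) ->
  (forall A, measurable A -> nu A = (\int[mu]_(x in A) (f x)%:E)%E) ->
  measurable_fun setT g -> (forall x, 0 <= g x)%E ->
  (\int[nu]_x g x = \int[mu]_x (g x * (f x)%:E))%E.
Proof.
move=> mf f0 nuE mg g0.
have mfE : measurable_fun setT (EFin \o f) by exact/measurable_EFinP.
have numu : nu `<< mu.
  apply/null_content_dominatesP => A mA muA0.
  by rewrite nuE// null_set_integral//; exact: measurable_funTS.
(* The Radon-Nikodym derivative of [nu] and the function [f] have the same integral over every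
   measurable set, so they agree almost everywhere and one may replace the other. *)
rewrite -(Radon_Nikodym_SigmaFinite.change_of_variables numu)//.
have intRN := Radon_Nikodym_SigmaFinite.f_integrable numu.
apply: ae_eq_integral => //.
- by apply: emeasurable_funM => //; exact: measurable_int intRN.
- by apply: emeasurable_funM.
- apply: ae_eqe_mul2l; apply: integral_ae_eq => //= E _ mE.
  by rewrite -Radon_Nikodym_SigmaFinite.f_integral// nuE.
Qed.

Definition image_measure {d d'} {T : measurableType d} {U : measurableType d'}
    {R : realType} (mu : {measure set T -> \bar R}) (phi : T -> U)
    (mphi : measurable_fun setT phi) : {measure set U -> \bar R} :=
  measure_function_pushforward__canonical__measure_function_Measure mu mphi.

Section affine_change_of_variables.
Context {R : realType}.
Variables c s : R.
Hypothesis s0 : s != 0.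
Local Notation mu := (@lebesgue_measure R).

Let phi (y : R) : R := c + s * y.

Lemma measurable_affine : measurable_fun setT phi.
Proof. by apply: measurable_funD => //; exact: measurable_funM. Qed.

Let phiP := measurable_affine.

(** Uniqueness of Lebesgue measure: the scaled image measure gives every interval []a, b]] its
    length. A negative slope makes the preimage closed on the left instead, with the same length. *)
Lemma lebesgue_measure_affine (A : set R) : measurable A ->
  mu A = (`|s|%:E * mu (phi @^-1` A))%E.
Proof.
move=> mA.
pose r : {nonneg R} := NngNum (normr_ge0 s).
pose nu : {measure set (measurableTypeR R) -> \bar R} :=
  mscale r (@image_measure _ _ (measurableTypeR R) (measurableTypeR R) R mu _ phiP).
rewrite (@lebesgue_measure_unique R nu)//.
move=> X [[a b]] /= _ <-; rewrite /nu /mscale/= /pushforward/=.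
have [s_gt0|s_lt0|] := ltgtP s 0; last by move/eqP; rewrite (negbTE s0).
- have -> : phi @^-1` `]a, b] = `[(b - c) / s, (a - c) / s[%classic.
    apply/seteqP; split=> x /=; rewrite !in_itv/= /phi.
      rewrite ler_ndivrMr// ltr_ndivlMr// => /andP[h1 h2]; apply/andP; split; lra.
    rewrite ler_ndivrMr// ltr_ndivlMr// => /andP[h1 h2]; apply/andP; split; lra.
  rewrite !lebesgue_measure_itv/= !lte_fin ltr_nM2r ?invr_lt0// ltrD2r.
  case: ifPn => _; last by rewrite mule0.
  rewrite -!EFinB -EFinM; congr EFin; rewrite ltr0_norm//; field.
  by rewrite s0.
- have -> : phi @^-1` `]a, b] = `](a - c) / s, (b - c) / s]%classic.
    apply/seteqP; split=> x /=; rewrite !in_itv/= /phi.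
      rewrite ler_pdivlMr// ltr_pdivrMr// => /andP[h1 h2]; apply/andP; split; lra.
    rewrite ler_pdivlMr// ltr_pdivrMr// => /andP[h1 h2]; apply/andP; split; lra.
  rewrite !lebesgue_measure_itv/= !lte_fin ltr_pM2r ?invr_gt0// ltrD2r.
  case: ifPn => _; last by rewrite mule0.
  rewrite -!EFinB -EFinM; congr EFin; rewrite gtr0_norm//; field.
  by rewrite s0.
Qed.

Lemma ge0_integral_affine (g : R -> \bar R) : measurable_fun setT g ->
  (forall x, 0 <= g x)%E ->
  (\int[mu]_x g x = `|s|%:E * \int[mu]_y g (c + s * y)%R)%E.
Proof.
move=> mg g0.
pose r : {nonneg R} := NngNum (normr_ge0 s).
pose nu : {measure set (measurableTypeR R) -> \bar R} :=
  mscale r (@image_measure _ _ (measurableTypeR R) (measurableTypeR R) R mu _ phiP).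
rewrite (@eq_measure_integral _ _ _ _ nu); last first.
  by move=> A mA _; exact: lebesgue_measure_affine.
rewrite /nu ge0_integral_mscale//=.
congr (_ * _)%E.
have := @ge0_integral_pushforward _ _ (measurableTypeR R) (measurableTypeR R) R phi phiP mu setT g measurableT mg
  (fun y _ => g0 y).
by rewrite preimage_setT.
Qed.

Lemma Rintegral_affine (g : R -> R) : measurable_fun setT g ->
  (forall x, 0 <= g x) ->
  \int[mu]_x g x = `|s| * \int[mu]_y g (c + s * y).
Proof.
move=> mg g0; rewrite /Rintegral ge0_integral_affine//; last exact/measurable_EFinP.
set I := (\int[_]_(_ in _) _)%E.
have : (0 <= I)%E by apply: integral_ge0 => x _; rewrite lee_fin.
case: I => [x _||]//=.
(* In the infinite case both real integrals are [fine] of [+oo], that is 0. *)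
by rewrite mulr0 gt0_muley// lte_fin normr_gt0.
Qed.

End affine_change_of_variables.

Section real_valued_integrable.
Context {d} {T : measurableType d} {R : realType} (mu : {measure set T -> \bar R}).
Variable D : set T.
Hypothesis mD : measurable D.
Implicit Types f g : T -> R.

Lemma integrable_scale (k : R) f : mu.-integrable D (EFin \o f) ->
  mu.-integrable D (EFin \o (fun x => k * f x)).
Proof.
move=> hf; have := @integrableZl _ _ _ mu D mD k (EFin \o f) hf.
by apply: eq_integrable => // x _ /=; rewrite EFinM.
Qed.

Lemma integrable_add f g : mu.-integrable D (EFin \o f) -> mu.-integrable D (EFin \o g) ->
  mu.-integrable D (EFin \o (fun x => f x + g x)).
Proof.
move=> hf hg; have := @integrableD _ _ _ mu D mD _ _ hf hg.
by apply: eq_integrable => // x _ /=; rewrite EFinD.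
Qed.

Lemma integrable_sub f g : mu.-integrable D (EFin \o f) -> mu.-integrable D (EFin \o g) ->
  mu.-integrable D (EFin \o (fun x => f x - g x)).
Proof.
move=> hf hg; have := @integrableB _ _ _ mu D mD _ _ hf hg.
by apply: eq_integrable => // x _ /=; rewrite EFinB.
Qed.

Lemma integrable_le f g : measurable_fun D f -> (forall x, D x -> `|f x| <= g x) ->
  mu.-integrable D (EFin \o g) -> mu.-integrable D (EFin \o f).
Proof.
move=> mf fg; apply: le_integrable => //; first exact/measurable_EFinP.
by move=> x Dx /=; rewrite lee_fin (le_trans (fg x Dx))// ler_norm.
Qed.

Lemma Rintegral_near f g h : mu.-integrable D (EFin \o f) -> mu.-integrable D (EFin \o g) ->
  mu.-integrable D (EFin \o h) -> (forall x, D x -> `|f x - g x| <= h x) ->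
  `|\int[mu]_(x in D) f x - \int[mu]_(x in D) g x| <= \int[mu]_(x in D) h x.
Proof.
move=> hf hg hh fgh; rewrite -RintegralB//.
apply: le_trans (le_normr_Rintegral mD _) _; first exact: integrable_sub.
apply: le_Rintegral => //.
have := @integrable_norm _ _ _ mu D _ (integrable_sub hf hg).
exact.
Qed.

End real_valued_integrable.

Section derivation_rules.
Context {R : realType}.
Implicit Types (f g : R -> R) (x : R).

Lemma is_derive_add f g x df dg : is_derive x 1 f df -> is_derive x 1 g dg ->
  is_derive x 1 (fun y => f y + g y) (df + dg).
Proof. by move=> ? ?; exact: is_deriveD. Qed.

Lemma is_derive_opp f x df : is_derive x 1 f df -> is_derive x 1 (fun y => - f y) (- df).
Proof. by move=> ?; exact: is_deriveN. Qed.

Lemma is_derive_sub f g x df dg : is_derive x 1 f df -> is_derive x 1 g dg ->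
  is_derive x 1 (fun y => f y - g y) (df - dg).
Proof. by move=> ? ?; exact: is_deriveB. Qed.

Lemma is_derive_mul f g x df dg : is_derive x 1 f df -> is_derive x 1 g dg ->
  is_derive x 1 (fun y => f y * g y) (df * g x + f x * dg).
Proof.
move=> h1 h2; have := is_deriveM h1 h2.
by rewrite /GRing.scale/= addrC (mulrC (g x)).
Qed.

Lemma is_derive_scale f x (k df : R) : is_derive x 1 f df ->
  is_derive x 1 (fun y => k * f y) (k * df).
Proof. by move=> ?; exact: is_deriveZ. Qed.

Lemma is_derive_comp f g x (df dg : R) : is_derive (g x) 1 f df -> is_derive x 1 g dg ->
  is_derive x 1 (fun y => f (g y)) (df * dg).
Proof. by move=> ? ?; apply: is_derive1_comp. Qed.

Lemma is_derive_pow n x : is_derive x 1 (fun y => y ^+ n) (n%:R * x ^+ n.-1).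
Proof.
have := @is_deriveX R R id n x 1 1 (is_derive_id _ _).
by rewrite /GRing.scale/= mulr1 exprfctE.
Qed.

Lemma is_derive_derive1 f x df : is_derive x 1 f df -> derive1 f x = df.
Proof. by move=> ?; rewrite derive1E derive_val. Qed.

Lemma is_derive_cont f x df : is_derive x 1 f df -> {for x, continuous f}.
Proof. by move=> h; apply/differentiable_continuous/derivable1_diffP. Qed.

End derivation_rules.

Section half_line.
Context {R : realType}.
Local Notation mu := (@lebesgue_measure R).
Local Notation HL := (`[0, +oo[%classic : set R).

Lemma pow_le_expR (k : nat) (t : R) : 0 < t ->
  exists2 C, 0 < C & forall x, 0 <= x -> x ^+ k <= C * expR (t * x).
Proof.
move=> t0; case: k => [|k].
  by exists 1 => // x x0; rewrite expr0 mul1r -expR0 ler_expR mulr_ge0// ltW.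
exists (k.+1`!%:R / t ^+ k.+1); first by rewrite divr_gt0 ?exprn_gt0// ltr0n fact_gt0.
move=> x x0; have := @expR_ge1Dxn R (t * x) k (mulr_ge0 (ltW t0) x0).
set F := _%:R; set E := expR _ => h.
have {}h : (t * x) ^+ k.+1 / F <= E by apply: le_trans h; rewrite lerDr.
rewrite ler_pdivrMr ?ltr0n ?fact_gt0// exprMn in h.
by rewrite mulrAC ler_pdivlMr ?exprn_gt0// mulrC [F * _]mulrC.
Qed.

Lemma cvg_expRNM (t : R) : 0 < t -> expR (- (t * x)) @[x --> +oo] --> 0.
Proof.
move=> t0; apply: (cvg_comp (fun x => t * x) (fun x => expR (- x))); last exact: cvgr_expR.
by apply: gt0_cvgMry => //; exact: cvg_id.
Qed.

Lemma is_derive_expRNM (t x : R) :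
  is_derive x 1 (fun x => expR (- (t * x))) (- t * expR (- (t * x))).
Proof.
rewrite mulrC; apply: (is_derive_comp (f := expR)).
apply: is_derive_opp; rewrite -[X in is_derive _ _ _ X]mulr1.
exact: is_derive_scale.
Qed.

Lemma integral_HL_expRNM (t : R) : 0 < t ->
  (\int[mu]_(x in HL) (expR (- (t * x)))%:E = (t^-1)%:E)%E.
Proof.
move=> t0.
rewrite (@ge0_continuous_FTC2y R _ (fun x => - t^-1 * expR (- (t * x))) 0 0).
- by rewrite mulr0 oppr0 expR0 mulr1 EFinN oppeK add0e.
- by move=> x _; exact: expR_ge0.
- apply: continuous_subspaceT => x; exact: is_derive_cont (is_derive_expRNM t x).
- by rewrite -[X in _ --> X](mulr0 (- t^-1)); apply: cvgMr => //; exact: cvg_expRNM.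
- by move=> x _; case: (is_derive_scale (- t^-1) (is_derive_expRNM t x)).
- apply: cvg_at_right_filter.
  exact: is_derive_cont (is_derive_scale (- t^-1) (is_derive_expRNM t 0)).
- move=> x _; rewrite (is_derive_derive1 (is_derive_scale (- t^-1) (is_derive_expRNM t x))).
  by rewrite mulrA mulrNN mulVf ?mul1r// gt_eqF.
Qed.

Lemma measurable_expRNM (t : R) : measurable_fun setT (fun x : R => expR (- (t * x))).
Proof.
by apply: measurableT_comp => //; apply: measurableT_comp => //.
Qed.

Lemma integrable_HL_le (f : R -> R) (C t : R) : 0 < t -> measurable_fun HL f ->
  (forall x, 0 <= x -> `|f x| <= C * expR (- (t * x))) ->
  mu.-integrable HL (EFin \o f).
Proof.
move=> t0 mf fC.
have ie : mu.-integrable HL (EFin \o (fun x : R => C * expR (- (t * x)))).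
  have -> : EFin \o (fun x : R => C * expR (- (t * x))) =
            (fun x => C%:E * (EFin \o (fun x : R => expR (- (t * x)))) x)%E.
    by apply/funext => x /=; rewrite EFinM.
  apply: integrableZl => //; apply/integrableP; split.
    by apply/measurable_EFinP; apply: measurable_funTS; exact: measurable_expRNM.
  under eq_integral => x _ do rewrite /= ger0_norm ?expR_ge0//.
  by rewrite integral_HL_expRNM// ltry.
apply: le_integrable ie => //; first exact/measurable_EFinP.
move=> x /=; rewrite in_itv/= andbT => x0; rewrite lee_fin.
apply: le_trans (fC _ x0) _; exact: ler_norm.
Qed.

Lemma Rintegral_HL_expRNM (C t : R) : 0 < t ->
  \int[mu]_(x in HL) (C * expR (- (t * x))) = C / t.
Proof.
move=> t0; rewrite RintegralZl//.
  by rewrite /Rintegral integral_HL_expRNM.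
apply: (@integrable_HL_le _ 1 t) => //; last by move=> x x0; rewrite mul1r ger0_norm// expR_ge0.
by apply: measurable_funTS; exact: measurable_expRNM.
Qed.

(** The improper fundamental theorem is available for nonnegative integrands. Adding [C exp(-t x)],
    whose integral is explicit, makes the integrand nonnegative; its contribution [C / t] cancels at
    the end. *)
Lemma HL_FTC (f F : R -> R) (C t : R) : 0 < t ->
  (forall x, 0 <= x -> `|f x| <= C * expR (- (t * x))) ->
  (forall x : R, is_derive x 1 F (f x)) -> continuous f ->
  F x @[x --> +oo] --> 0 ->
  \int[mu]_(x in HL) f x = - F 0.
Proof.
move=> t0 fC dF cf F0.
have mf : measurable_fun HL f by apply: measurable_funTS; exact: continuous_measurable_fun.
have intf := integrable_HL_le t0 mf fC.
have C0 : 0 <= C.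
  by have := le_trans (normr_ge0 _) (fC 0 (lexx _)); rewrite mulr0 oppr0 expR0 mulr1.
have mD : measurable_fun HL (fun x : R => C * expR (- (t * x))).
  by apply: measurable_funTS; apply: measurable_funM => //; exact: measurable_expRNM.
have intD : mu.-integrable HL (EFin \o (fun x : R => C * expR (- (t * x)))).
  by apply: (@integrable_HL_le _ C t) => // x x0; rewrite ger0_norm// mulr_ge0// expR_ge0.
have dD (x : R) : is_derive x 1 (fun x => C / t * expR (- (t * x))) (- (C * expR (- (t * x)))).
  have := is_derive_scale (C / t) (is_derive_expRNM t x).
  by rewrite mulrA mulrN divfK ?gt_eqF// mulNr.
have dG (x : R) : is_derive x 1 (fun x => F x - C / t * expR (- (t * x)))
    (f x + C * expR (- (t * x))).
  by have := is_derive_sub (dF x) (dD x); rewrite opprK.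
have := @Rintegral_ge0_continuous_FTC2y R (fun x => f x + C * expR (- (t * x)))
  (fun x => F x - C / t * expR (- (t * x))) 0 0.
rewrite RintegralD// Rintegral_HL_expRNM// mulr0 oppr0 expR0 mulr1 => h.
have {}h : \int[mu]_(x in HL) f x + C / t = 0 - (F 0 - C / t).
  apply: h.
  - by move=> x /fC; rewrite ler_norml => /andP[+ _]; rewrite -subr_ge0 opprK.
  - apply: continuous_subspaceT => x; apply: cvgD; first exact: cf.
    apply: cvgMr; exact: is_derive_cont (is_derive_expRNM t x).
  - rewrite -[X in _ --> X]subr0 -[X in _ - X](mulr0 (C / t)).
    by apply: cvgB => //; apply: cvgMr; exact: cvg_expRNM.
  - by move=> x _; case: (dG x).
  - apply: cvg_at_right_filter.
    have -> : F 0 - C / t = F 0 - C / t * expR (- (t * 0)).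
      by rewrite mulr0 oppr0 expR0 mulr1.
    exact: is_derive_cont (dG 0).
  - by move=> x _; rewrite (is_derive_derive1 (dG x)).
by move: h; lra.
Qed.

End half_line.

(** * Sums of independent variables *)

Section independence.
Context {d : measure_display} {T : measurableType d} {R : realType}.
Variable P : probability T R.

Lemma measurable_preimage {d'} {U : measurableType d'} (f : T -> U) (A : set U) :
  measurable_fun setT f -> measurable A -> measurable (f @^-1` A).
Proof. by move=> mf mA; rewrite -[_ @^-1` _]setTI; exact: mf. Qed.

(** Both sides are finite measures in [C], and rectangles form an intersection-stable generating
    class, so agreement on rectangles suffices. *)
Lemma indep_pair_event (U V : T -> R) (E : set T) :
  measurable_fun setT U -> measurable_fun setT V -> measurable E ->
  (forall A B, measurable A -> measurable B ->
    P (U @^-1` A `&` V @^-1` B `&` E) = (P (U @^-1` A `&` V @^-1` B) * P E)%E) ->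
  forall C : set (R * R), measurable C ->
    P ((fun w => (U w, V w)) @^-1` C `&` E) =
    (P ((fun w => (U w, V w)) @^-1` C) * P E)%E.
Proof.
move=> mU mV mE h C mC.
have mUV : measurable_fun setT (fun w => (U w, V w)) by exact: measurable_fun_pair.
have PE0 : 0 <= fine (P E) by exact: fine_ge0.
pose r : {nonneg R} := NngNum PE0.
pose m1 : {measure set (R * R) -> \bar R} := image_measure (mrestr P mE) mUV.
pose m2 : {measure set (R * R) -> \bar R} := mscale r (image_measure P mUV).
have rE : (r%:num%:E)%E = P E by rewrite fineK// fin_num_measure.
suff -> : P ((fun w => (U w, V w)) @^-1` C `&` E) = m2 C by rewrite /m2/= /mscale/= rE muleC.
have -> : P ((fun w => (U w, V w)) @^-1` C `&` E) = m1 C by [].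
apply: (@measure_unique _ R _ [set A `*` B | A in measurable & B in measurable]
  (fun=> setT)).
- exact: measurable_prod_measurableType.
- move=> _ _ [A mA [B mB <-]] [A' mA' [B' mB' <-]].
  exists (A `&` A'); first exact: measurableI.
  by exists (B `&` B'); [exact: measurableI|rewrite setXI].
- by move=> _; exists setT => //; exists setT => //; rewrite setXTT.
- by rewrite bigcup_const.
- move=> _ [A mA [B mB <-]]; rewrite /m2/= /mscale/= rE muleC.
  exact: h.
- by move=> _; rewrite /m1 /= /pushforward /mrestr ltey_eq fin_num_measure//; apply: measurableI => //; exact: (measurable_preimage mUV).
- exact: mC.
Qed.

Variable X : nat -> {RV P >-> R}.
Hypothesis indepX : mutually_independent X.
Variable psi : R -> R.
Hypothesis mpsi : measurable_fun setT psi.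

Definition partial_sum (k : nat) (w : T) : R := \sum_(i < k) psi (X i w).

Lemma partial_sumS k w : partial_sum k.+1 w = partial_sum k w + psi (X k w).
Proof. by rewrite /partial_sum big_ord_recr. Qed.

Lemma measurable_partial_sum k : measurable_fun setT (partial_sum k).
Proof. by apply: measurable_sum => i; exact: measurableT_comp. Qed.

Let cyl (J : {fset nat}) (A : nat -> set R) := \bigcap_(i in [set` J]) (X i @^-1` A i).

Let mcyl J A : (forall i, measurable (A i)) -> measurable (cyl J A).
Proof.
move=> mA; by rewrite /cyl; apply: bigcap_measurableType => i _; exact: measurable_preimage.
Qed.

(** Mutual independence speaks of events of single variables only. Induction on [k] extends it to
    partial sums; carrying an arbitrary cylinder over later indices makes the induction close, since
    the variable [X k] leaves the cylinder and enters the sum. *)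
Lemma partial_sum_indep k (J : {fset nat}) (A : nat -> set R) (B : set R) :
  (forall i, i \in J -> (k <= i)%N) -> (forall i, measurable (A i)) -> measurable B ->
  P (partial_sum k @^-1` B `&` \bigcap_(i in [set` J]) (X i @^-1` A i)) =
  (P (partial_sum k @^-1` B) * \prod_(i <- J) P (X i @^-1` A i))%E.
Proof.
rewrite -/(cyl J A).
have cylE J' A' : (forall i, measurable (A' i)) ->
    P (cyl J' A') = (\prod_(i <- J') P (X i @^-1` A' i))%E.
  by move=> mA'; rewrite /cyl indepX.
elim: k J A B => [|k IH] J A B kJ mA mB.
  have -> : partial_sum 0 = cst 0 by apply/funext => w; rewrite /partial_sum big_ord0.
  rewrite preimage_cst; case: ifPn => _.
    by rewrite setTI probability_setT mul1e cylE.
  by rewrite set0I measure0 mul0e.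
pose F (x : R * R) := x.1 + psi x.2.
have mF : measurable_fun setT F.
  by apply: measurable_funD => //; exact: measurableT_comp.
have mS := measurable_partial_sum k.
have mC : measurable (F @^-1` B) by rewrite -[_ @^-1` _]setTI; exact: mF.
have -> : partial_sum k.+1 @^-1` B =
    (fun w => (partial_sum k w, X k w)) @^-1` (F @^-1` B).
  by apply/seteqP; split=> w /=; rewrite /F partial_sumS.
rewrite indep_pair_event ?cylE//; first exact: mcyl.
move=> C D mC' mD.
(* The event on [X k] is absorbed into the cylinder by adding the index [k], which turns the claim
   into the induction hypothesis. *)
have key J' : (forall i, i \in J' -> (k.+1 <= i)%N) ->
    P (partial_sum k @^-1` C `&` X k @^-1` D `&` cyl J' A) =
    (P (partial_sum k @^-1` C) * (P (X k @^-1` D) * \prod_(i <- J') P (X i @^-1` A i)))%E.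
  move=> kJ'.
  pose A' i := if i == k then D else A i.
  have kN : k \notin J' by apply/negP => /kJ'; rewrite ltnn.
  have A'E i : i \in J' -> A' i = A i.
    by move=> iJ; rewrite /A'; case: eqP => // ik; rewrite ik (negbTE kN) in iJ.
  have -> : P (partial_sum k @^-1` C `&` X k @^-1` D `&` cyl J' A) =
      P (partial_sum k @^-1` C `&` cyl (k |` J')%fset A').
    congr (P _); rewrite -setIA; congr (_ `&` _); apply/seteqP; split=> w.
      move=> [h1 h2] i /=; rewrite !inE => /orP[/eqP->|iJ]; first by rewrite /A' eqxx.
      by rewrite A'E//; exact: h2.
    move=> h; split; first by have := h k; rewrite /= /A' eqxx; apply; rewrite !inE eqxx.
    by move=> i /= iJ; rewrite -A'E//; apply: h; rewrite /= !inE iJ orbT.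
  rewrite IH//; last 2 first.
  - by move=> i; rewrite !inE => /orP[/eqP->//|/kJ' /ltnW].
  - by move=> i; rewrite /A'; case: ifP.
  congr (_ * _)%E; rewrite big_fsetU1//= {1}/A' eqxx; congr (_ * _)%E.
  by rewrite big_seq [RHS]big_seq; apply: eq_bigr => i iJ; rewrite A'E.
rewrite key// muleA; congr (_ * _)%E.
(* The empty cylinder gives the probability of the rectangle alone. *)
have := key fset0; rewrite /cyl set_fset0 bigcap_set0 setIT => ->; last by move=> i; rewrite inE.
by rewrite big_seq_fset0 mule1.
Qed.

(** The joint law of the partial sum and the next variable is a product measure, so Tonelli's
    theorem separates the two. *)
Lemma expectation_partial_sumS k (g : R -> R) :
  measurable_fun setT g -> (forall x, 0 <= g x) ->
  (\int[P]_w (g (partial_sum k.+1 w))%:E =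
   \int[P]_w \int[P]_v (g (partial_sum k w + psi (X k v)))%:E)%E.
Proof.
move=> mg g0.
have mS := measurable_partial_sum k.
pose S : {RV P >-> R} := HB.pack (partial_sum k) (isMeasurableFun.Build _ _ _ _ _ mS).
have mSX : measurable_fun setT (fun w => (S w, X k w)) by exact: measurable_fun_pair.
pose F (x : R * R) : \bar R := (g (x.1 + psi x.2))%:E.
have mF : measurable_fun setT F.
  apply/measurable_EFinP; apply: measurableT_comp => //.
  by apply: measurable_funD => //; exact: measurableT_comp.
have F0 x : (0 <= F x)%E by rewrite lee_fin.
have mFx x : measurable_fun setT (fun y => F (x, y)).
  by apply: measurableT_comp mF _; exact: measurable_pair1.
have -> : (\int[P]_w (g (partial_sum k.+1 w))%:E = \int[P]_w F (S w, X k w))%E.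
  by apply: eq_integral => w _; rewrite partial_sumS.
have := @ge0_integral_pushforward _ _ _ _ R _ mSX P setT F measurableT mF (fun y _ => F0 y).
rewrite preimage_setT => <-.
rewrite (@eq_measure_integral _ _ _ _ (distribution P S \x distribution P (X k))%E); last first.
  move=> A mA _; apply/esym.
  apply: (@product_measure_unique _ _ _ _ R _ _ (image_measure P mSX)) => //.
  move=> B C mB mC.
  have := @partial_sum_indep k [fset k]%fset (fun=> C) B.
  rewrite set_fset1 bigcap_set1 big_seq_fset1; apply => //.
  by move=> i; rewrite inE => /eqP ->.
rewrite fubini_tonelli1// ge0_integral_distribution//.
- apply: eq_integral => w _ /=; rewrite /fubini_F ge0_integral_distribution//.
- exact: measurable_fun_fubini_tonelli_F.
- by move=> y; apply: integral_ge0 => z _.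
Qed.

End independence.

(** * Gaussian laws *)

Section gaussian_half_moments.
Context {R : realType}.
Local Notation mu := (@lebesgue_measure R).
Local Notation HL := (`[0, +oo[%classic : set R).
Implicit Types x : R.

Definition gauss_weight x : R := expR (- (x ^+ 2 / 2)).

Lemma normal_pdf01 x : normal_pdf 0 1 x = (Num.sqrt (2 * pi))^-1 * gauss_weight x.
Proof.
rewrite normal_pdfE ?oner_eq0// /normal_peak /normal_fun /gauss_weight subr0 expr1n mul1r.
by rewrite mulNr [in RHS]mulr_natl.
Qed.

Lemma gauss_weight_ge0 x : 0 <= gauss_weight x. Proof. exact: expR_ge0. Qed.

Lemma is_derive_gauss_weight x : is_derive x 1 gauss_weight (- (x * gauss_weight x)).
Proof.
rewrite -mulNr mulrC; apply: (is_derive_comp (f := expR)).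
apply: is_derive_opp.
have := @is_derive_mul R (fun y => y ^+ 2) (cst 2^-1) x _ _ (is_derive_pow 2 x) (is_derive_cst _ _ _).
by rewrite /= expr1 mulr0 addr0 mulrAC divff ?mul1r// pnatr_eq0.
Qed.

Lemma pow_gauss_le (k : nat) : exists2 C, 0 < C &
  forall x, 0 <= x -> x ^+ k * gauss_weight x <= C * expR (- (2^-1 * x)).
Proof.
have h2 : (0 : R) < 2^-1 by rewrite invr_gt0.
have [C C0 hC] := @pow_le_expR R k _ h2.
exists (C * expR 2^-1); first by rewrite mulr_gt0// expR_gt0.
move=> x x0; rewrite -mulrA -expRD.
apply: le_trans (ler_wpM2r (gauss_weight_ge0 _) (hC x x0)) _.
rewrite -mulrA ler_pM2l// /gauss_weight -expRD ler_expR.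
have := sqr_ge0 (x - 1); rewrite sqrrB1 => ?; lra.
Qed.

Lemma integrable_pow_gauss k :
  mu.-integrable HL (EFin \o (fun x => x ^+ k * gauss_weight x)).
Proof.
have [C C0 hC] := pow_gauss_le k.
apply: (@integrable_HL_le _ _ C 2^-1); first by rewrite invr_gt0.
  apply: measurable_funTS; apply: continuous_measurable_fun => x.
  exact: is_derive_cont (is_derive_mul (is_derive_pow k x) (is_derive_gauss_weight x)).
move=> x x0; rewrite ger0_norm; first exact: hC.
by rewrite mulr_ge0 ?exprn_ge0// gauss_weight_ge0.
Qed.

Definition half_moment (k : nat) : R := \int[mu]_(x in HL) (x ^+ k * gauss_weight x).

(** Integration by parts: the integrand is the derivative of [x^k exp(-x^2/2)], which vanishes at
    infinity and equals 1 at the origin exactly when [k = 0]. For [k = 0] the meaningless index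
    [k.-1] has coefficient 0. *)
Lemma half_moment_rec k :
  k%:R * half_moment k.-1 - half_moment k.+1 = - (k == 0%N)%:R.
Proof.
pose f x := k%:R * (x ^+ k.-1 * gauss_weight x) - x ^+ k.+1 * gauss_weight x.
have [C1 C10 h1] := pow_gauss_le k.-1.
have [C2 C20 h2] := pow_gauss_le k.+1.
have [C3 C30 h3] := pow_gauss_le k.
have dF x : is_derive x 1 (fun x => x ^+ k * gauss_weight x) (f x).
  have := is_derive_mul (is_derive_pow k x) (is_derive_gauss_weight x).
  by rewrite /f exprS mulrN !mulrA (mulrC x).
have cont j : continuous (fun x => x ^+ j * gauss_weight x).
  move=> x; exact: is_derive_cont (is_derive_mul (is_derive_pow j x) (is_derive_gauss_weight x)).
have cf : continuous f.
  move=> x; apply: cvgB; last exact: cont.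
  by apply: cvgMr; exact: cont.
have h12 : (0 : R) < 2^-1 by rewrite invr_gt0.
have := @HL_FTC R f _ (k%:R * C1 + C2) 2^-1 h12 _ dF cf.
rewrite /f RintegralB//; last 2 first.
- by apply: integrable_scale => //; exact: integrable_pow_gauss.
- exact: integrable_pow_gauss.
rewrite RintegralZl//; last exact: integrable_pow_gauss.
rewrite -!/(half_moment _) => ->.
- by rewrite /gauss_weight !expr0n/= mul0r oppr0 expR0 mulr1.
- move=> x x0; rewrite mulrDl; apply: le_trans (ler_normB _ _) _.
  rewrite !ger0_norm ?mulr_ge0 ?exprn_ge0 ?gauss_weight_ge0//.
  by rewrite -mulrA lerD ?h2// ler_wpM2l// h1.
- apply/cvgr0Pnorm_le => e e0.
  have /cvgr0Pnorm_le/(_ (e / C3)) := @cvg_expRNM R _ h12.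
  rewrite divr_gt0// => /(_ isT); apply: filter_app; near=> x => h.
  have x0 : 0 <= x by near: x; apply: nbhs_pinfty_ge; rewrite num_real.
  rewrite ger0_norm ?mulr_ge0 ?exprn_ge0 ?gauss_weight_ge0//.
  apply: le_trans (h3 x x0) _; rewrite mulrC -ler_pdivlMr//.
  by apply: le_trans h; exact: ler_norm.
Unshelve. all: by end_near.
Qed.

(** By symmetry the half-line carries half of the total mass of the standard normal density. *)
Lemma half_moment0 : half_moment 0 = Num.sqrt (pi / 2).
Proof.
have sp : 0 < Num.sqrt (2 * pi) :> R by rewrite sqrtr_gt0 mulr_gt0// pi_gt0.
have h : half_moment 0 = Num.sqrt (2 * pi) * 2^-1.
  have := @integral_normal_pdf R 0 1.
  rewrite ge0_symfun_integralT; last 3 first.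
  - by move=> x; exact: normal_pdf_ge0.
  - by apply: continuous_normal_pdf; rewrite oner_eq0.
  - by move=> x /=; rewrite !normal_pdf01 /gauss_weight sqrrN.
  rewrite -set_itvcy.
  under eq_integral do rewrite normal_pdf01 EFinM.
  rewrite integralZl//; last first.
    have := integrable_pow_gauss 0.
    by apply: eq_integrable => // x _ /=; rewrite expr0 mul1r.
  rewrite /half_moment /Rintegral.
  have -> : (\int[mu]_(x in HL) (x ^+ 0 * gauss_weight x)%:E =
             \int[mu]_(x in HL) (gauss_weight x)%:E)%E.
    by apply: eq_integral => x _; rewrite expr0 mul1r.
  have fin : (\int[mu]_(x in HL) (gauss_weight x)%:E)%E \is a fin_num.
    apply: integrable_fin_num => //; have := integrable_pow_gauss 0.
    by apply: eq_integrable => // x _ /=; rewrite expr0 mul1r.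
  rewrite -(fineK fin) -!EFinM => -[] h /=.
  set I := fine _ in h *.
  have -> : I = Num.sqrt (2 * pi) * 2^-1 * (2 * ((Num.sqrt (2 * pi))^-1 * I)).
    by field; rewrite gt_eqF.
  by rewrite h mulr1.
rewrite h; have -> : (2 * pi : R) = 2 ^+ 2 * (pi / 2) by field.
by rewrite sqrtrM ?sqr_ge0// sqrtr_sqr ger0_norm// mulrAC divff ?mul1r// pnatr_eq0.
Qed.

Lemma half_moment1 : half_moment 1 = 1.
Proof. by have := half_moment_rec 0; rewrite mul0r sub0r eqxx => /oppr_inj. Qed.

Lemma half_momentSS k : half_moment k.+2 = k.+1%:R * half_moment k.
Proof. by have /eqP := half_moment_rec k.+1; rewrite oppr0 subr_eq0 => /eqP. Qed.

End gaussian_half_moments.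

(** * Scaling and convolution of Gaussian laws *)

Section gaussian_integrals.
Context {R : realType}.
Local Notation mu := (@lebesgue_measure R).
Local Notation N := (@normal_prob R 0 1).
Local Open Scope ereal_scope.

Lemma integral_normal_prob (m s : R) (g : R -> \bar R) :
  measurable_fun setT g -> (forall x, 0 <= g x) ->
  \int[normal_prob m s]_x g x = \int[mu]_x (g x * (normal_pdf m s x)%:E).
Proof.
move=> mg g0.
apply: (@integral_density _ (measurableTypeR R) R mu (normal_prob m s)) => //.
- exact: measurable_normal_pdf.
- by move=> x; exact: normal_pdf_ge0.
Qed.

Lemma normal_pdf_scale (s y : R) : (0 < s)%R ->
  (s * normal_pdf 0 s (s * y) = normal_pdf 0 1 y)%R.
Proof.
move=> s0; have sn0 : s != 0%R by rewrite gt_eqF.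
rewrite !normal_pdfE ?oner_eq0// /normal_peak /normal_fun !subr0 expr1n mul1r.
rewrite -mulrnAr sqrtrM ?sqr_ge0// sqrtr_sqr gtr0_norm// invfM mulrA mulrA divff// mul1r.
congr (_ * expR _)%R; rewrite exprMn -mulr_natr -[in RHS]mulr_natr.
by field.
Qed.

Lemma integral_normal_scale (s : R) (g : R -> \bar R) : (0 < s)%R ->
  measurable_fun setT g -> (forall x, 0 <= g x) ->
  \int[normal_prob 0 s]_x g x = \int[N]_y g (s * y)%R.
Proof.
move=> s0 mg g0; have sn0 : s != 0%R by rewrite gt_eqF.
have mgs : measurable_fun setT (fun y => g (s * y)%R).
  by apply: measurableT_comp => //; exact: measurable_funM.
rewrite [LHS](integral_normal_prob 0 s mg g0).
rewrite [RHS](integral_normal_prob 0 1 mgs (fun y => g0 (s * y)%R)).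
rewrite (@ge0_integral_affine R 0 s sn0); last 2 first.
- apply: emeasurable_funM => //; apply/measurable_EFinP; exact: measurable_normal_pdf.
- by move=> x; rewrite mule_ge0// lee_fin normal_pdf_ge0.
rewrite gtr0_norm// -ge0_integralZl//; last 3 first.
- apply: emeasurable_funM.
    by apply: measurableT_comp => //; exact: measurable_affine.
  apply/measurable_EFinP; apply: measurableT_comp; first exact: measurable_normal_pdf.
  exact: measurable_affine.
- by move=> x _; rewrite mule_ge0// lee_fin normal_pdf_ge0.
- by rewrite lee_fin ltW.
apply: eq_integral => y _; rewrite add0r -(normal_pdf_scale y s0).
by rewrite EFinM muleCA.
Qed.

(** Completion of the square in [z]. The second factor on the right is itself a normal density in
    [z], so integrating [z] out leaves only the first. *)
Lemma normal_pdf_conv (a b w z : R) : (0 < a)%R -> (0 < b)%R ->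
  (normal_pdf 0 a (w - b * z) * normal_pdf 0 1 z =
   normal_pdf 0 (Num.sqrt (a ^+ 2 + b ^+ 2)) w *
   normal_pdf (b * w / (a ^+ 2 + b ^+ 2)) (a / Num.sqrt (a ^+ 2 + b ^+ 2)) z)%R.
Proof.
move=> a0 b0; set q := (a ^+ 2 + b ^+ 2)%R.
have q0 : (0 < q)%R by rewrite addr_gt0// exprn_gt0.
have sq0 : (0 < Num.sqrt q)%R by rewrite sqrtr_gt0.
have s2 : (Num.sqrt q ^+ 2 = q)%R by rewrite sqr_sqrtr// ltW.
rewrite !normal_pdfE ?oner_eq0 ?gt_eqF ?divr_gt0//.
rewrite /normal_peak /normal_fun !subr0 expr_div_n s2 expr1n mul1r.
rewrite mulrACA [RHS]mulrACA -!expRD -!invfM -!sqrtrM ?mulrn_wge0 ?mulr_ge0 ?sqr_ge0 ?pi_ge0 ?ltW ?invr_ge0//.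
congr (_^-1 * expR _)%R.
  congr (Num.sqrt _); field.
  by rewrite gt_eqF.
rewrite /q; field.
by rewrite !gt_eqF ?exprn_gt0.
Qed.

(** Substituting [w = a y + b z] in the inner integral moves [g] onto [w]; after exchanging the
    integrals the density in [z] integrates to 1. *)
Lemma gaussian_convolution (a b : R) (g : R -> R) : (0 < a)%R -> (0 < b)%R ->
  measurable_fun setT g -> (forall x, (0 <= g x)%R) ->
  \int[N]_z \int[N]_y (g (a * y + b * z)%R)%:E =
  \int[N]_w (g (Num.sqrt (a ^+ 2 + b ^+ 2) * w)%R)%:E.
Proof.
move=> a0 b0 mg g0; set t := Num.sqrt _.
have t0 : (0 < t)%R by rewrite sqrtr_gt0 addr_gt0// exprn_gt0.
pose K (x : R * R) : \bar R := (g x.2 * (normal_pdf 0 a (x.2 - b * x.1) * normal_pdf 0 1 x.1))%:E.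
have mK : measurable_fun setT K.
  apply/measurable_EFinP; apply: measurable_funM; first exact: measurableT_comp.
  apply: measurable_funM.
    apply: measurableT_comp; first exact: measurable_normal_pdf.
    by apply: measurable_funB => //; exact: measurable_funM.
  by apply: measurableT_comp => //; exact: measurable_normal_pdf.
have K0 x : 0 <= K x by rewrite lee_fin !mulr_ge0// normal_pdf_ge0.
have inner z : \int[N]_y (g (a * y + b * z)%R)%:E =
    \int[mu]_w (g w * normal_pdf 0 a (w - b * z))%:E.
  have mgz : measurable_fun setT (fun u : R => (g (u + b * z)%R)%:E).
    by apply/measurable_EFinP; apply: measurableT_comp => //; exact: measurable_funD.
  have g0z (u : R) : 0 <= (g (u + b * z)%R)%:E by rewrite lee_fin.
  rewrite -[LHS](integral_normal_scale a0 mgz g0z).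
  rewrite [LHS](integral_normal_prob 0 a mgz g0z).
  rewrite (@ge0_integral_affine R (- (b * z)) 1 (oner_neq0 _)); last 2 first.
  - apply: emeasurable_funM => //; apply/measurable_EFinP; exact: measurable_normal_pdf.
  - by move=> x; rewrite mule_ge0// lee_fin// normal_pdf_ge0.
  rewrite normr1 mul1e; apply: eq_integral => w _.
  by rewrite EFinM mul1r addrAC addNr add0r addrC.
under eq_integral do rewrite inner.
have mI : measurable_fun setT (fun z => \int[mu]_w (g w * normal_pdf 0 a (w - b * z))%:E).
  have := @measurable_fun_fubini_tonelli_F _ _ (measurableTypeR R) (measurableTypeR R) R mu
    (fun x => (g x.2 * normal_pdf 0 a (x.2 - b * x.1))%:E).
  apply => //.
  - apply/measurable_EFinP; apply: measurable_funM; first exact: measurableT_comp.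
    apply: measurableT_comp; first exact: measurable_normal_pdf.
    by apply: measurable_funB => //; exact: measurable_funM.
  - by move=> x; rewrite lee_fin mulr_ge0// normal_pdf_ge0.
rewrite [LHS](integral_normal_prob 0 1 mI); last first.
  by move=> z; apply: integral_ge0 => w _; rewrite lee_fin mulr_ge0// normal_pdf_ge0.
transitivity (\int[mu]_z \int[mu]_w K (z, w)).
  apply: eq_integral => z _; rewrite -ge0_integralZr//.
  - by apply: eq_integral => w _; rewrite /K -EFinM mulrA.
  - apply/measurable_EFinP; apply: measurable_funM => //.
    apply: measurableT_comp; first exact: measurable_normal_pdf.
    exact: measurable_funB.
  - by move=> w _; rewrite lee_fin mulr_ge0// normal_pdf_ge0.
  - by rewrite lee_fin normal_pdf_ge0.
rewrite (@fubini_tonelli _ _ (measurableTypeR R) (measurableTypeR R) R mu mu)//.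
transitivity (\int[normal_prob 0 t]_w (g w)%:E); last first.
  have mgE : measurable_fun setT (EFin \o g) by exact/measurable_EFinP.
  by rewrite [LHS](integral_normal_scale t0 mgE).
rewrite [RHS](@integral_normal_prob 0 t (EFin \o g))//; last exact/measurable_EFinP.
apply: eq_integral => w _; rewrite /K/=.
under eq_integral do rewrite normal_pdf_conv// mulrA EFinM.
rewrite ge0_integralZl//.
- by rewrite integral_normal_pdf mule1 EFinM.
- by apply/measurable_EFinP; exact: measurable_normal_pdf.
- by move=> z _; rewrite lee_fin normal_pdf_ge0.
- by rewrite lee_fin mulr_ge0// normal_pdf_ge0.
Qed.

End gaussian_integrals.

Section gaussian_moments.
Context {R : realType}.
Local Notation mu := (@lebesgue_measure R).
Local Notation N := (@normal_prob R 0 1).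
Local Open Scope ereal_scope.

Lemma integral_normal_norm_pow k :
  \int[N]_y (`|y| ^+ k)%:E = (2 / Num.sqrt (2 * pi) * half_moment k)%:E.
Proof.
have mg : measurable_fun setT (fun y : R => (`|y| ^+ k)%:E).
  by apply/measurable_EFinP; apply: measurable_funX.
rewrite [LHS](integral_normal_prob 0 1 mg); last first.
  by move=> y; rewrite lee_fin exprn_ge0.
transitivity (\int[mu]_y (`|y| ^+ k * normal_pdf 0 1 y)%:E) => //.
rewrite ge0_symfun_integralT; last 3 first.
- by move=> y; rewrite mulr_ge0 ?exprn_ge0// normal_pdf_ge0.
- move=> y; apply: cvgM.
    apply: (@continuous_comp R R R (fun y => `|y|%R) (fun y => y ^+ k)%R y).
      exact: norm_continuous.
    exact: exprn_continuous.
  by apply: continuous_normal_pdf; rewrite oner_eq0.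
- by move=> y /=; rewrite normrN !normal_pdf01 /gauss_weight sqrrN.
rewrite -set_itvcy.
have -> : \int[mu]_(x in `[0%R, +oo[) (`|x| ^+ k * normal_pdf 0 1 x)%:E =
    \int[mu]_(x in `[0%R, +oo[) ((Num.sqrt (2 * pi))^-1%:E * (x ^+ k * gauss_weight x)%:E).
  apply: eq_integral => x; rewrite inE/= in_itv/= andbT => x0.
  by rewrite ger0_norm// normal_pdf01 -EFinM mulrCA.
rewrite integralZl//; last exact: integrable_pow_gauss.
have fin : \int[mu]_(x in `[0%R, +oo[) (x ^+ k * gauss_weight x)%:E \is a fin_num.
  by apply: integrable_fin_num => //; exact: integrable_pow_gauss.
by rewrite -(fineK fin) -!EFinM -[fine _]/(half_moment k) mulrA.
Qed.

Lemma normal_integrable_pow k : N.-integrable setT (EFin \o (fun y : R => (y ^+ k)%R)).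
Proof.
apply/integrableP; split; first by apply/measurable_EFinP.
under eq_integral do rewrite /= normrX.
by rewrite integral_normal_norm_pow ltry.
Qed.

Lemma normal_integrable_norm_pow k :
  N.-integrable setT (EFin \o (fun y : R => (`|y| ^+ k)%R)).
Proof.
have := integrable_norm (normal_integrable_pow k).
by apply: eq_integrable => // y _ /=; rewrite normrX.
Qed.

Lemma normal_symmetric (g : R -> \bar R) : measurable_fun setT g -> (forall x, 0 <= g x) ->
  \int[N]_y g (- y)%R = \int[N]_y g y.
Proof.
move=> mg g0.
have mgN : measurable_fun setT (fun y : R => g (- y)%R) by exact: measurableT_comp.
have n0 : (-1 : R)%R != 0%R by rewrite oppr_eq0 oner_eq0.
rewrite [LHS](integral_normal_prob 0 1 mgN)// [RHS](integral_normal_prob 0 1 mg)//.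
rewrite [RHS](@ge0_integral_affine R 0 (-1) n0); last 2 first.
- apply: emeasurable_funM => //; apply/measurable_EFinP; exact: measurable_normal_pdf.
- by move=> x; rewrite mule_ge0// lee_fin normal_pdf_ge0.
rewrite normrN1 mul1e; apply: eq_integral => y _.
by rewrite add0r mulN1r !normal_pdf01 /gauss_weight sqrrN.
Qed.

(** The positive and negative parts have the same integral by symmetry, and it is finite, so their
    difference is a genuine 0. *)
Lemma normal_mean : (\int[N]_y y = 0)%R.
Proof.
rewrite /Rintegral integralE.
have mid : measurable_fun setT (fun y : R => y%:E) by exact/measurable_EFinP.
have -> : \int[N]_x (fun y : R => y%:E)^\- x = \int[N]_x (fun y : R => y%:E)^\+ x.
  rewrite -(@normal_symmetric (fun x => (fun y : R => y%:E)^\+ x)).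
  - by apply: eq_integral => x _; rewrite funenegE funeposE EFinN.
  - exact: measurable_funepos.
  - by move=> x; rewrite funepos_ge0.
rewrite subee//.
have := integrable_funepos measurableT (normal_integrable_pow 1).
exact: integrable_fin_num.
Qed.

Lemma normal_second_moment : (\int[N]_y (y ^+ 2) = 1)%R.
Proof.
rewrite /Rintegral.
have -> : \int[N]_y (y ^+ 2)%:E = \int[N]_y (`|y| ^+ 2)%:E.
  by apply: eq_integral => y _; rewrite real_normK// num_real.
rewrite integral_normal_norm_pow half_momentSS half_moment0/= mul1r.
have pi0 : (0 < pi :> R)%R := pi_gt0 R.
have -> : (2 * pi : R)%R = (2 ^+ 2 * (pi / 2))%R by field.
have s0 : (0 < Num.sqrt (pi / 2) :> R)%R by rewrite sqrtr_gt0 divr_gt0.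
rewrite sqrtrM ?sqr_ge0// sqrtr_sqr ger0_norm//.
by field; rewrite gt_eqF.
Qed.

End gaussian_moments.

(** * Lindeberg's central limit theorem *)

Section bounded_integrals.
Context {d} {T : measurableType d} {R : realType} (P : probability T R).
Implicit Types f g : T -> R.

Lemma prob_integrable f (M : R) : measurable_fun setT f -> (forall x, `|f x| <= M) ->
  P.-integrable setT (EFin \o f).
Proof.
move=> mf fM; apply: measurable_bounded_integrable => //.
  by rewrite ltey_eq fin_num_measure.
exists M; split; first by rewrite num_real.
by move=> y My x _ /=; apply: le_trans (fM x) (ltW My).
Qed.

Lemma Rintegral_prob_cst (r : R) : \int[P]_x r = r.
Proof. by rewrite Rintegral_cst// [X in fine X](_ : _ = 1%E) ?mulr1//; exact: probability_setT. Qed.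

Lemma EFin_Rintegral_prob f : P.-integrable setT (EFin \o f) ->
  (\int[P]_x (f x)%:E = (\int[P]_x f x)%:E)%E.
Proof. by move=> hf; rewrite fineK//; exact: integrable_fin_num. Qed.

Lemma Rintegral_prob_near f (a e : R) : P.-integrable setT (EFin \o f) ->
  (forall x, `|f x - a| <= e) -> `|\int[P]_x f x - a| <= e.
Proof.
move=> hf fa; rewrite -[X in `|_ - X|]Rintegral_prob_cst -[leRHS]Rintegral_prob_cst.
have h r : P.-integrable setT (EFin \o cst r).
  by apply: (@prob_integrable _ `|r|).
by apply: Rintegral_near => //; exact: h.
Qed.

(** A centered increment loses its first-order term, so only the variance and the third absolute
    moment of [Y] matter. It is applied to a sample term and to a Gaussian term alike. *)
Lemma taylor_expectation (u : R -> R) (x A B C : R) (Y : T -> R) :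
  measurable_fun setT u -> (forall y, 0 <= u y <= 1) ->
  (forall h, `|u (x + h) - u x - A * h - B / 2 * h ^+ 2| <= C * `|h| ^+ 3) ->
  measurable_fun setT Y ->
  P.-integrable setT (EFin \o Y) -> P.-integrable setT (EFin \o (fun w => Y w ^+ 2)) ->
  P.-integrable setT (EFin \o (fun w => `|Y w| ^+ 3)) ->
  \int[P]_w Y w = 0 ->
  `|\int[P]_w u (x + Y w) - (u x + B / 2 * \int[P]_w (Y w ^+ 2))| <=
    C * \int[P]_w (`|Y w| ^+ 3).
Proof.
move=> mu u01 tay mY iY iY2 iY3 EY.
have iu : P.-integrable setT (EFin \o (fun w => u (x + Y w))).
  apply: (@prob_integrable _ 1); last first.
    by move=> w; rewrite ger0_norm; case/andP: (u01 (x + Y w)).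
  by apply: measurableT_comp => //; exact: measurable_funD.
have ic : P.-integrable setT (EFin \o (fun _ : T => u x)).
  by apply: (@prob_integrable _ `|u x|).
have iAY := integrable_scale measurableT A iY.
have iBY := integrable_scale measurableT (B / 2) iY2.
have iCY := integrable_scale measurableT C iY3.
have ->: u x + B / 2 * \int[P]_w Y w ^+ 2 =
    \int[P]_w (u x + A * Y w + B / 2 * Y w ^+ 2).
  rewrite RintegralD//; last by apply: integrable_add.
  by rewrite RintegralD// !RintegralZl// EY mulr0 addr0 Rintegral_prob_cst.
rewrite -RintegralZl//; apply: Rintegral_near => //.
  by apply: integrable_add => //; apply: integrable_add.
by move=> w _; apply: le_trans (tay (Y w)); rewrite !opprD !addrA.
Qed.

End bounded_integrals.

(** With [m] Gaussian and [k] sample terms, each replacement moves along the antidiagonal [m + k]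
    constant and costs at most [e]. *)
Lemma diagonal_telescope {R : realType} (E : nat -> nat -> R) (e : R) :
  (forall m k, `|E m k.+1 - E m.+1 k| <= e) ->
  forall k m, `|E m k - E (m + k)%N 0%N| <= k%:R * e.
Proof.
move=> h; elim=> [|k IH] m; first by rewrite addn0 subrr normr0 mul0r.
apply: le_trans (ler_distD (E m.+1 k) _ _) _.
by rewrite -natr1 mulrDl mul1r addrC lerD// -addSnnS; exact: IH.
Qed.

Section lindeberg.
Context {d : measure_display} {T : measurableType d} {R : realType}.
Variable P : probability T R.
Variable N : probability (measurableTypeR R) R.
Hypothesis N_conv : forall (a b : R) (g : R -> R), 0 < a -> 0 < b ->
  measurable_fun setT g -> (forall x, 0 <= g x) ->
  (\int[N]_z \int[N]_y (g (a * y + b * z)%R)%:E =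
   \int[N]_w (g (Num.sqrt (a ^+ 2 + b ^+ 2) * w)%R)%:E)%E.
Hypothesis N_pow : forall k, N.-integrable setT (EFin \o (fun y : R => y ^+ k)).
Hypothesis N_norm_pow : forall k, N.-integrable setT (EFin \o (fun y : R => `|y| ^+ k)).
Hypothesis N_mean : \int[N]_y y = 0.
Hypothesis N_second : \int[N]_y (y ^+ 2) = 1.

Variable X : nat -> {RV P >-> R}.
Hypothesis indepX : mutually_independent X.
Variables (psi : R -> R) (M q : R).
Hypothesis mpsi : measurable_fun setT psi.
Hypothesis psiM : forall u, `|psi u| <= M.
Hypothesis psi_mean : forall k, \int[P]_v psi (X k v) = 0.
Hypothesis psi_second : forall k, \int[P]_v (psi (X k v) ^+ 2) = q.

Variables (phi phi1 phi2 : R -> R) (C D : R).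
Hypothesis mphi : measurable_fun setT phi.
Hypothesis mphi1 : measurable_fun setT phi1.
Hypothesis mphi2 : measurable_fun setT phi2.
Hypothesis phi01 : forall x, 0 <= phi x <= 1.
Hypothesis phi1D : forall x, `|phi1 x| <= D.
Hypothesis phi2D : forall x, `|phi2 x| <= D.
Hypothesis phi_taylor : forall x h,
  `|phi (x + h) - phi x - phi1 x * h - phi2 x / 2 * h ^+ 2| <= C * `|h| ^+ 3.
Variable t : R.
Hypothesis t0 : 0 < t.

Let S := partial_sum X psi.
Let mS k : measurable_fun setT (S k) := measurable_partial_sum X mpsi k.
(** The mean of the test function after adding [m] independent centered Gaussian terms of standard
    deviation [t], merged into a single one. *)
Let U (m : nat) (x : R) : R := \int[N]_y phi (x + t * Num.sqrt m%:R * y).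
Let m3 : R := \int[N]_y (`|y| ^+ 3).

Let mshift (a b : R) : measurable_fun setT (fun y : R => a + b * y).
Proof. exact: measurable_affine. Qed.

Let iphi (g : R -> R) (B a b : R) : measurable_fun setT g -> (forall x, `|g x| <= B) ->
  N.-integrable setT (EFin \o (fun y : R => g (a + b * y))).
Proof.
move=> mg gB; apply: (@prob_integrable _ _ _ N _ B) => // .
exact: (measurableT_comp mg (mshift a b)).
Qed.

Let phiB x : `|phi x| <= 1.
Proof. by rewrite ger0_norm; case/andP: (phi01 x). Qed.

Let U_ereal m x : (\int[N]_y (phi (x + t * Num.sqrt m%:R * y))%:E = (U m x)%:E)%E.
Proof. by rewrite EFin_Rintegral_prob//; exact: iphi. Qed.

Let mU m : measurable_fun setT (U m).
Proof.
apply/measurable_EFinP; rewrite [X in measurable_fun _ X](_ : _ =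
  (fun x => \int[N]_y (phi (x + t * Num.sqrt m%:R * y))%:E)%E); last first.
  by apply/funext => x; rewrite U_ereal.
apply: (@measurable_fun_fubini_tonelli_F _ _ R (measurableTypeR R) R N
  (fun x => (phi (x.1 + t * Num.sqrt m%:R * x.2))%:E)).
  apply/measurable_EFinP; apply: measurableT_comp => //.
  by apply: measurable_funD => //; exact: measurable_funM.
by move=> x; rewrite lee_fin; case/andP: (phi01 (x.1 + t * Num.sqrt m%:R * x.2)).
Qed.

Let U01 m x : 0 <= U m x <= 1.
Proof.
rewrite Rintegral_ge0/=; last by move=> y _; case/andP: (phi01 (x + t * Num.sqrt m%:R * y)).
rewrite -(Rintegral_prob_cst N 1); apply: le_Rintegral => //; first exact: iphi.
  by apply: (@prob_integrable _ _ _ N _ `|1|).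
by move=> y _; case/andP: (phi01 (x + t * Num.sqrt m%:R * y)).
Qed.

Let U0 x : U 0 x = phi x.
Proof.
rewrite -[RHS](Rintegral_prob_cst N); apply: eq_Rintegral => y _.
by rewrite sqrtr0 mulr0 mul0r addr0.
Qed.

Let U_semigroup m x : \int[N]_z U m (x + t * z) = U m.+1 x.
Proof.
have iU : N.-integrable setT (EFin \o (fun z : R => U m (x + t * z))).
  apply: (@prob_integrable _ _ _ N _ 1); first exact: (measurableT_comp (mU m) (mshift x t)).
  by move=> z; rewrite ger0_norm; case/andP: (U01 m (x + t * z)).
apply: EFin_inj; rewrite -EFin_Rintegral_prob// -U_ereal.
(* Stability under convolution is stated for two positive scales, so the case without earlier
   Gaussian terms is treated apart. *)
case: m iU => [|m] iU.
  by apply: eq_integral => z _; rewrite U0 sqrtr1 mulr1.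
have sm0 : 0 < t * Num.sqrt m.+1%:R by rewrite mulr_gt0// sqrtr_gt0 ltr0n.
have mg : measurable_fun setT (fun u => phi (x + u)).
  by apply: measurableT_comp => //; exact: measurable_funD.
have g0 u : 0 <= phi (x + u) by case/andP: (phi01 (x + u)).
have := N_conv sm0 t0 mg g0.
have -> : Num.sqrt ((t * Num.sqrt m.+1%:R) ^+ 2 + t ^+ 2) = t * Num.sqrt m.+2%:R.
  rewrite exprMn sqr_sqrtr// -[X in _ + X]mulr1 -mulrDr -natr1.
  by rewrite natr1 natr1 sqrtrM ?sqr_ge0// sqrtr_sqr gtr0_norm.
move=> <-; apply: eq_integral => z _; rewrite -U_ereal.
by apply: eq_integral => y _; rewrite -!addrA (addrC (t * z)).
Qed.

(** Averaging the Taylor bound of [phi] preserves the constant [C], uniformly in [m]. Taking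
    averages of [phi1] and [phi2] as coefficients avoids differentiating under the integral. *)
Let U_taylor m x : exists A B, `|B| <= D /\ forall h,
  `|U m (x + h) - U m x - A * h - B / 2 * h ^+ 2| <= C * `|h| ^+ 3.
Proof.
pose s := t * Num.sqrt m%:R.
exists (\int[N]_y phi1 (x + s * y)), (\int[N]_y phi2 (x + s * y)); split.
  apply: le_trans (le_normr_Rintegral _ _) _ => //; first exact: iphi phi2D.
  rewrite -(Rintegral_prob_cst N D); apply: le_Rintegral => //.
  - have := integrable_norm (iphi x s mphi2 phi2D).
    exact.
  - by apply: (@prob_integrable _ _ _ N _ `|D|).
move=> h.
have i1 := integrable_scale measurableT h (iphi x s mphi1 phi1D).
have i2 := integrable_scale measurableT (h ^+ 2 / 2) (iphi x s mphi2 phi2D).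
have i0 := iphi x s mphi phiB.
have -> : U m (x + h) - U m x - (\int[N]_y phi1 (x + s * y)) * h -
    (\int[N]_y phi2 (x + s * y)) / 2 * h ^+ 2 =
    U m (x + h) - \int[N]_y (phi (x + s * y) + h * phi1 (x + s * y) +
                             h ^+ 2 / 2 * phi2 (x + s * y)).
  rewrite RintegralD//; last by apply: integrable_add.
  rewrite RintegralD// !RintegralZl//; [|exact: iphi phi2D|exact: iphi phi1D].
  by rewrite /U -/s; field.
rewrite -(Rintegral_prob_cst N (C * _)); apply: Rintegral_near => //.
- exact: iphi.
- by apply: integrable_add => //; apply: integrable_add.
- by apply: (@prob_integrable _ _ _ N _ `|C * `|h| ^+ 3|).
- move=> y _; apply: le_trans (phi_taylor (x + s * y) h).
  rewrite le_eqVlt; apply/orP; left; apply/eqP; congr (`|_|).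
  rewrite -/s (_ : x + h + s * y = x + s * y + h); last by ring.
  by field.
Qed.

(** The cost of one replacement: the third moment of a sample term, at most [M q]; the third moment
    of a Gaussian term; the mismatch of the two variances. *)
Let err : R := C * (M * q) + C * t ^+ 3 * m3 + D / 2 * `|q - t ^+ 2|.

Let mpsiX k : measurable_fun setT (fun v => psi (X k v)).
Proof. exact: measurableT_comp. Qed.

Let C0 : 0 <= C.
Proof.
have := le_trans (normr_ge0 _) (phi_taylor 0 1).
by rewrite normr1 expr1n mulr1.
Qed.

Let M0 : 0 <= M. Proof. exact: le_trans (normr_ge0 _) (psiM 0). Qed.

Let one_step m k x : `|\int[P]_v U m (x + psi (X k v)) - U m.+1 x| <= err.
Proof.
have [A [B [BD tay]]] := U_taylor m x.
have i1 : P.-integrable setT (EFin \o (fun v => psi (X k v))).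
  by apply: (@prob_integrable _ _ _ P _ M).
have i2 : P.-integrable setT (EFin \o (fun v => psi (X k v) ^+ 2)).
  apply: (@prob_integrable _ _ _ P _ (M ^+ 2)); first exact: measurable_funX.
  by move=> v; rewrite normrX lerXn2r// nnegrE.
have i3 : P.-integrable setT (EFin \o (fun v => `|psi (X k v)| ^+ 3)).
  apply: (@prob_integrable _ _ _ P _ (M ^+ 3)).
    by apply: measurable_funX; exact: measurableT_comp.
  by move=> v; rewrite normrX normr_id lerXn2r// nnegrE.
have h1 := taylor_expectation (mU m) (U01 m) tay (mpsiX k) i1 i2 i3 (psi_mean k).
have mt : measurable_fun setT (fun z : R => t * z) by exact: measurable_funM.
have h2 := @taylor_expectation _ _ _ N (U m) x A B C (fun z => t * z) (mU m) (U01 m) tay mt.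
have j1 : N.-integrable setT (EFin \o (fun z : R => t * z)).
  by have := integrable_scale measurableT t (N_pow 1).
have j2 : N.-integrable setT (EFin \o (fun z : R => (t * z) ^+ 2)).
  have := integrable_scale measurableT (t ^+ 2) (N_pow 2).
  by apply: eq_integrable => // z _ /=; rewrite exprMn.
have j3 : N.-integrable setT (EFin \o (fun z : R => `|t * z| ^+ 3)).
  have := integrable_scale measurableT (t ^+ 3) (N_norm_pow 3).
  by apply: eq_integrable => // z _ /=; rewrite normrM exprMn gtr0_norm.
have Et1 : \int[N]_z (t * z) = 0.
  rewrite RintegralZl//; last exact: (N_pow 1).
  by rewrite N_mean mulr0.
have Et2 : \int[N]_z ((t * z) ^+ 2) = t ^+ 2.
  under eq_Rintegral do rewrite exprMn.
  by rewrite RintegralZl ?N_second ?mulr1//; exact: N_pow.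
have Et3 : \int[N]_z (`|t * z| ^+ 3) = t ^+ 3 * m3.
  under eq_Rintegral do rewrite normrM exprMn gtr0_norm//.
  by rewrite RintegralZl//; exact: N_norm_pow.
move/(_ j1 j2 j3 Et1): h2; rewrite Et2 Et3 U_semigroup => h2.
rewrite psi_second in h1.
have h3 : \int[P]_v (`|psi (X k v)| ^+ 3) <= M * q.
  rewrite -(psi_second k) -RintegralZl//; apply: le_Rintegral => //.
    exact: integrable_scale.
  move=> v _; rewrite exprS ler_pM ?exprn_ge0// real_normK ?num_real//.
have h1' := le_trans h1 (ler_wpM2l C0 h3).
have hB : `|B / 2 * q - B / 2 * t ^+ 2| <= D / 2 * `|q - t ^+ 2|.
  rewrite -mulrBr normrM ler_wpM2r// normrM [X in _ * X]ger0_norm ?invr_ge0//.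
  by rewrite ler_wpM2r ?invr_ge0.
rewrite /err; rewrite -[C * t ^+ 3 * m3]mulrA.
move: h1' h2 hB; rewrite !ler_norml => /andP[? ?] /andP[? ?] /andP[? ?].
by apply/andP; split; lra.
Qed.

Lemma lindeberg n : `|\int[P]_w phi (S n w) - \int[N]_y phi (t * Num.sqrt n%:R * y)| <=
  n%:R * err.
Proof.
(* This interpolates between the sample sum at [(0, n)] and the Gaussian at [(n, 0)]. *)
pose E m k : R := \int[P]_w U m (S k w).
have iE m k : P.-integrable setT (EFin \o (fun w => U m (S k w))).
  apply: (@prob_integrable _ _ _ P _ 1); first exact: measurableT_comp.
  by move=> w; rewrite ger0_norm; case/andP: (U01 m (S k w)).
have step m k : `|E m k.+1 - E m.+1 k| <= err.
  pose V x := \int[P]_v U m (x + psi (X k v)).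
  have iv x : P.-integrable setT (EFin \o (fun v => U m (x + psi (X k v)))).
    apply: (@prob_integrable _ _ _ P _ 1).
      by apply: measurableT_comp => //; exact: measurable_funD.
    by move=> v; rewrite ger0_norm; case/andP: (U01 m (x + psi (X k v))).
  have VE x : (\int[P]_v (U m (x + psi (X k v)))%:E = (V x)%:E)%E.
    by rewrite EFin_Rintegral_prob.
  have mV : measurable_fun setT V.
    apply/measurable_EFinP; rewrite [X in measurable_fun _ X](_ : _ =
      (fun x => \int[P]_v (U m (x + psi (X k v)))%:E)%E); last first.
      by apply/funext => x; rewrite VE.
    apply: (@measurable_fun_fubini_tonelli_F _ _ R T R P
      (fun x => (U m (x.1 + psi (X k x.2)))%:E)).
      apply/measurable_EFinP; apply: measurableT_comp => //.
      by apply: measurable_funD => //; exact: (measurableT_comp (mpsiX k)).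
    by move=> x; rewrite lee_fin; case/andP: (U01 m (x.1 + psi (X k x.2))).
  have VU x : `|V x - U m.+1 x| <= err by exact: one_step.
  have iV : P.-integrable setT (EFin \o (fun w => V (S k w))).
    apply: (@prob_integrable _ _ _ P _ (err + 1)); first exact: measurableT_comp.
    move=> w; rewrite -(subrK (U m.+1 (S k w)) (V _)); apply: le_trans (ler_normD _ _) _.
    by rewrite lerD// ger0_norm; case/andP: (U01 m.+1 (S k w)).
  have -> : E m k.+1 = \int[P]_w V (S k w).
    apply: EFin_inj; rewrite /E -EFin_Rintegral_prob//.
    rewrite (expectation_partial_sumS indepX mpsi)//; last by move=> x; case/andP: (U01 m x).
    under eq_integral do rewrite VE.
    by rewrite EFin_Rintegral_prob.
  rewrite -(Rintegral_prob_cst P err); apply: Rintegral_near => //.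
  by apply: (@prob_integrable _ _ _ P _ `|err|).
have tele := diagonal_telescope step.
have := tele n 0%N; rewrite add0n /E.
have -> : \int[P]_w U 0 (S n w) = \int[P]_w phi (S n w).
  by apply: eq_Rintegral => w _; rewrite U0.
have -> : \int[P]_w U n (S 0 w) = \int[N]_y phi (t * Num.sqrt n%:R * y).
  rewrite -[RHS](Rintegral_prob_cst P); apply: eq_Rintegral => w _.
  rewrite /S /partial_sum big_ord0 /U; apply: eq_Rintegral => y _.
  by rewrite add0r.
by [].
Qed.

End lindeberg.

(** * Twice continuously differentiable spline steps as test functions *)

Section spline.
Context {R : realType}.
Implicit Types x h : R.

Definition pos_part x : R := Num.max x 0.

Lemma pos_part_ge0 x : 0 <= pos_part x.
Proof. by rewrite /pos_part le_max lexx orbT. Qed.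

Lemma pos_partE x : 0 <= x -> pos_part x = x.
Proof. by move=> x0; rewrite /pos_part max_l. Qed.

Lemma pos_part_eq0 x : x <= 0 -> pos_part x = 0.
Proof. by move=> x0; rewrite /pos_part max_r. Qed.

(** The third derivative of the truncated cube is 0 or 6, hence a remainder of at most [|h|^3]. The
    four sign patterns of [x] and [x + h] are checked directly, as the derivative jumps at the
    origin. *)
Lemma cube_pos_taylor x h :
  `|pos_part (x + h) ^+ 3 - pos_part x ^+ 3 - 3 * pos_part x ^+ 2 * h
    - 6 * pos_part x / 2 * h ^+ 2| <= `|h| ^+ 3.
Proof.
have [x0|x0] := lerP 0 x; have [y0|y0] := lerP 0 (x + h).
- rewrite !pos_partE// -normrX le_eqVlt; apply/orP; left; apply/eqP; congr (`|_|); by field.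
- rewrite (pos_partE x0) pos_part_eq0; last exact: ltW.
  have h0 : h < 0 by lra.
  rewrite (ltr0_norm h0).
  rewrite (_ : 0 ^+ 3 - x ^+ 3 - 3 * x ^+ 2 * h - 6 * x / 2 * h ^+ 2 =
    (- h - x) ^+ 3 - (- h) ^+ 3); last by field.
  have e1 : 0 <= (- h - x) ^+ 3 by rewrite exprn_ge0//; lra.
  have e2 : (- h - x) ^+ 3 <= (- h) ^+ 3 by rewrite lerXn2r ?nnegrE//; lra.
  by rewrite ler_norml; apply/andP; split; lra.
- rewrite (pos_partE y0) pos_part_eq0; last exact: ltW.
  have h0 : 0 < h by lra.
  rewrite (gtr0_norm h0) !expr0n/= !mulr0 !mul0r !subr0 ger0_norm ?exprn_ge0//.
  by rewrite lerXn2r ?nnegrE//; lra.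
- rewrite !pos_part_eq0; [|exact: ltW|exact: ltW].
  by rewrite !expr0n/= !mulr0 !mul0r !subr0 normr0 exprn_ge0.
Qed.

(* The integral of the quadratic B-spline with knots 0, 1, 2, 3. *)
Definition spline_comb (g : R -> R) x : R := (g x - 3 * g (x - 1) + 3 * g (x - 2) - g (x - 3)) / 6.

Definition spline_step := spline_comb (fun x => pos_part x ^+ 3).
Definition spline_step1 := spline_comb (fun x => 3 * pos_part x ^+ 2).
Definition spline_step2 := spline_comb (fun x => 6 * pos_part x).

(** The constant is [(1 + 3 + 3 + 1) / 6], the total absolute weight of the third difference. *)
Lemma spline_step_taylor x h :
  `|spline_step (x + h) - spline_step x - spline_step1 x * h - spline_step2 x / 2 * h ^+ 2| <=
    4 / 3 * `|h| ^+ 3.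
Proof.
have h0 := cube_pos_taylor x h.
have h1 := cube_pos_taylor (x - 1) h.
have h2 := cube_pos_taylor (x - 2) h.
have h3 := cube_pos_taylor (x - 3) h.
rewrite /spline_step /spline_step1 /spline_step2 /spline_comb.
rewrite !(addrAC x h).
move: h0 h1 h2 h3.
set a0 := pos_part (x + h); set a1 := pos_part (x - 1 + h);
set a2 := pos_part (x - 2 + h); set a3 := pos_part (x - 3 + h).
set b0 := pos_part x; set b1 := pos_part (x - 1);
set b2 := pos_part (x - 2); set b3 := pos_part (x - 3).
rewrite !ler_norml => /andP[? ?] /andP[? ?] /andP[? ?] /andP[? ?].
by apply/andP; split; lra.
Qed.

Lemma spline_step_eq0 x : x <= 0 -> spline_step x = 0.
Proof.
move=> x0; rewrite /spline_step /spline_comb !pos_part_eq0; [|lra..].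
by rewrite expr0n/=; field.
Qed.

Lemma spline_step_eq1 x : 3 <= x -> spline_step x = 1.
Proof.
move=> x3; rewrite /spline_step /spline_comb !pos_partE; [|lra..].
by field.
Qed.

Lemma spline_step01 x : 0 <= spline_step x <= 1.
Proof.
have [x0|x0] := lerP x 0; first by rewrite spline_step_eq0// lexx ler01.
have [x3|x3] := lerP 3 x; first by rewrite spline_step_eq1// lexx ler01.
rewrite /spline_step /spline_comb (pos_partE (ltW x0)) (@pos_part_eq0 (x - 3)); last lra.
have [x1|x1] := lerP x 1.
  rewrite (@pos_part_eq0 (x - 1)) ?(@pos_part_eq0 (x - 2)); [|lra..].
  by apply/andP; split; nra.
rewrite (@pos_partE (x - 1)); last lra.
have [x2|x2] := lerP x 2.
  rewrite (@pos_part_eq0 (x - 2)); last lra.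
  pose z := x - 1.
  have -> : x = z + 1 by rewrite /z; ring.
  have z0 : 0 <= z by rewrite /z; lra.
  have z1 : z <= 1 by rewrite /z; lra.
  rewrite addrK; have z3 : 0 <= z ^+ 3 by rewrite exprn_ge0.
  have z2 : 0 <= z ^+ 2 by rewrite exprn_ge0.
  have z23 : z ^+ 3 <= z ^+ 2 by exact: ler_wiXn2l.
  (* The expanded product says [3 z^2 - 2 z^3 <= 1], which bounds the middle cubic piece. *)
  have zz : 0 <= (1 - z) ^+ 2 * (1 + 2 * z) by rewrite mulr_ge0 ?sqr_ge0//; lra.
  rewrite (_ : (1 - z) ^+ 2 * (1 + 2 * z) = 1 - 3 * z ^+ 2 + 2 * z ^+ 3) in zz; last by ring.
  rewrite (_ : (z + 1) ^+ 3 = z ^+ 3 + 3 * z ^+ 2 + 3 * z + 1); last by ring.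
  by apply/andP; split; lra.
rewrite (@pos_partE (x - 2)); last lra.
pose z := 3 - x.
have z0 : 0 <= z by rewrite /z; lra.
have z1 : z <= 1 by rewrite /z; lra.
have -> : (x ^+ 3 - 3 * (x - 1) ^+ 3 + 3 * (x - 2) ^+ 3 - 0 ^+ 3) / 6 = 1 - z ^+ 3 / 6.
  by rewrite /z; field.
have z3 : 0 <= z ^+ 3 by rewrite exprn_ge0.
have z31 : z ^+ 3 <= 1 by rewrite exprn_ile1.
by apply/andP; split; lra.
Qed.

Lemma measurable_pos_part : measurable_fun setT pos_part.
Proof. by apply: measurable_maxr. Qed.

Lemma measurable_spline_comb g : measurable_fun setT g -> measurable_fun setT (spline_comb g).
Proof.
move=> mg.
have mgs a : measurable_fun setT (fun x => g (x - a)).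
  by apply: measurableT_comp => //; exact: measurable_funB.
apply: measurable_funM => //; apply: measurable_funB => //.
by apply: measurable_funD => //; [apply: measurable_funB => //|]; apply: measurable_funM.
Qed.

Lemma spline_comb_bounded (g : R -> R) B : (forall x, x <= 0 -> g x = 0) ->
  (forall x, x <= 3 -> `|g x| <= B) -> (forall x, 3 <= x -> spline_comb g x = 0) ->
  forall x, `|spline_comb g x| <= 2 * B.
Proof.
move=> g0 gB g3 x.
have B0 : 0 <= B by apply: le_trans (gB 0 _); rewrite ?normr_ge0.
have [x3|x3] := lerP 3 x; first by rewrite g3// normr0 mulr_ge0.
have h0 := gB x (ltW x3).
have h1 : `|g (x - 1)| <= B by apply: gB; lra.
have h2 : `|g (x - 2)| <= B by apply: gB; lra.
have h3 : `|g (x - 3)| <= B by apply: gB; lra.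
rewrite /spline_comb; move: h0 h1 h2 h3.
rewrite !ler_norml => /andP[? ?] /andP[? ?] /andP[? ?] /andP[? ?].
by apply/andP; split; lra.
Qed.

Lemma spline_step12_bounded : exists D, forall x, `|spline_step1 x| <= D /\ `|spline_step2 x| <= D.
Proof.
(* 27 is the maximum of [3 x^2] on [[0, 3]] and also exceeds the maximum 18 of [6 x] there; the
   factor 2 exceeds the total weight [8 / 6]. *)
exists (2 * 27 : R) => x; split.
- apply: spline_comb_bounded.
  + by move=> y y0; rewrite pos_part_eq0// expr0n/= mulr0.
  + move=> y y3; rewrite ger0_norm ?mulr_ge0 ?exprn_ge0 ?pos_part_ge0//.
    have : pos_part y <= 3 by rewrite /pos_part ge_max y3/=.
    have := pos_part_ge0 y; nra.
  + move=> y y3; rewrite /spline_comb !pos_partE; [|lra..].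
    by field.
- apply: spline_comb_bounded.
  + by move=> y y0; rewrite pos_part_eq0// mulr0.
  + move=> y y3; rewrite ger0_norm ?mulr_ge0 ?exprn_ge0 ?pos_part_ge0//.
    have : pos_part y <= 3 by rewrite /pos_part ge_max y3/=.
    have := pos_part_ge0 y; lra.
  + move=> y y3; rewrite /spline_comb !pos_partE; [|lra..].
    by field.
Qed.

(** A smooth substitute for the indicator of a left half-line; reflecting and compressing the spline
    by [k] places its transition, of width [3 / k], immediately to the left of [y]. *)
Lemma smooth_step (y k : R) : 0 < k -> exists (phi phi1 phi2 : R -> R) (C D : R),
  [/\ [/\ measurable_fun setT phi, measurable_fun setT phi1 & measurable_fun setT phi2],
      (forall x, 0 <= phi x <= 1),
      (forall x, `|phi1 x| <= D) /\ (forall x, `|phi2 x| <= D),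
      (forall x h, `|phi (x + h) - phi x - phi1 x * h - phi2 x / 2 * h ^+ 2| <= C * `|h| ^+ 3) &
      (forall x, y <= x -> phi x = 0) /\ (forall x, x <= y - 3 / k -> phi x = 1)].
Proof.
move=> k0.
have [D hD] := spline_step12_bounded.
have D0 : 0 <= D by apply: le_trans (proj1 (hD 0)).
pose a x := k * (y - x).
have ma : measurable_fun setT a by apply: measurable_funM => //; exact: measurable_funB.
exists (fun x => spline_step (a x)), (fun x => - k * spline_step1 (a x)),
  (fun x => k ^+ 2 * spline_step2 (a x)), (4 / 3 * k ^+ 3), ((k + k ^+ 2) * D).
have m1 : measurable_fun setT spline_step.
  by apply: measurable_spline_comb; apply: measurable_funX; exact: measurable_pos_part.
have m2 : measurable_fun setT spline_step1.
  apply: measurable_spline_comb; apply: measurable_funM => //; apply: measurable_funX.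
  exact: measurable_pos_part.
have m3 : measurable_fun setT spline_step2.
  apply: measurable_spline_comb; apply: measurable_funM => //.
  exact: measurable_pos_part.
split.
- by split; [exact: measurableT_comp|apply: measurable_funM => //; exact: measurableT_comp..].
- by move=> x; exact: spline_step01.
- split=> x; rewrite normrM mulrDl.
    rewrite normrN (gtr0_norm k0) -[leLHS]addr0 lerD ?mulr_ge0 ?exprn_ge0 ?(ltW k0)//.
    by rewrite ler_wpM2l ?(ltW k0)//; case: (hD (a x)).
  rewrite normrX (gtr0_norm k0) -[leLHS]add0r lerD ?mulr_ge0 ?(ltW k0)//.
  by rewrite ler_wpM2l ?exprn_ge0 ?(ltW k0)//; case: (hD (a x)).
- move=> x h; have := spline_step_taylor (a x) (- k * h).
  have -> : a x + - k * h = a (x + h) by rewrite /a; ring.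
  have -> : 4 / 3 * `|- k * h| ^+ 3 = 4 / 3 * k ^+ 3 * `|h| ^+ 3.
    by rewrite normrM normrN (gtr0_norm k0) exprMn mulrA.
  apply: le_trans; rewrite le_eqVlt; apply/orP; left; apply/eqP; congr (`|_|).
  by field.
- split=> x h.
    by apply: spline_step_eq0; rewrite /a; nra.
  apply: spline_step_eq1; rewrite /a.
  have : 3 / k <= y - x by lra.
  by rewrite ler_pdivrMr// mulrC.
Qed.

End spline.

(** * Convergence of test expectations for a triangular array *)

Section clt.
Context {d : measure_display} {T : measurableType d} {R : realType}.
Variable P : probability T R.
Local Notation N := (@normal_prob R 0 1).
Variable X : nat -> {RV P >-> R}.
Hypothesis indepX : mutually_independent X.
Variables (psi : nat -> R -> R) (M q : nat -> R) (V : R).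
Hypothesis mpsi : forall n, measurable_fun setT (psi n).
Hypothesis psiM : forall n u, `|psi n u| <= M n.
Hypothesis psi_mean : forall n k, \int[P]_v psi n (X k v) = 0.
Hypothesis psi_second : forall n k, \int[P]_v (psi n (X k v) ^+ 2) = q n.
Hypothesis M0 : M n @[n --> \oo] --> 0.
Hypothesis nqV : n%:R * q n @[n --> \oo] --> V.
Hypothesis V0 : 0 < V.

Lemma cvg_test_expectation (phi phi1 phi2 : R -> R) (C D : R) :
  measurable_fun setT phi -> measurable_fun setT phi1 -> measurable_fun setT phi2 ->
  (forall x, 0 <= phi x <= 1) -> (forall x, `|phi1 x| <= D) -> (forall x, `|phi2 x| <= D) ->
  (forall x h, `|phi (x + h) - phi x - phi1 x * h - phi2 x / 2 * h ^+ 2| <= C * `|h| ^+ 3) ->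
  \int[P]_w phi (partial_sum X (psi n) n w) @[n --> \oo] -->
    \int[N]_y phi (Num.sqrt V * y).
Proof.
move=> mphi mphi1 mphi2 phi01 phi1D phi2D tay.
pose m3 : R := \int[N]_y (`|y| ^+ 3).
(* This is [n] times the replacement cost for Gaussian terms of variance [V / n], chosen so that [n]
   of them have exactly the variance [V] of the limit. *)
pose e n := C * (M n * (n%:R * q n)) + C * m3 * (Num.sqrt V ^+ 3 * (Num.sqrt n%:R)^-1)
  + D / 2 * `|n%:R * q n - V|.
have e0 : e n @[n --> \oo] --> 0.
  rewrite -[X in _ --> X](_ : C * (0 * V) + C * m3 * (Num.sqrt V ^+ 3 * 0) + D / 2 * `|V - V| = 0); last first.
    by rewrite subrr normr0 !(mul0r, mulr0) !addr0.
  apply: cvgD; first apply: cvgD.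
  - by apply: cvgMr; apply: cvgM.
  - apply: cvgMr; apply: cvgMr.
    have sqrt_oo : Num.sqrt n%:R @[n --> \oo] --> (+oo : set_system R).
      apply/cvgryPge => A; near=> n.
      apply: le_trans (ler_norm A) _.
      rewrite -[leLHS]ger0_norm// -sqrtr_sqr ler_wsqrtr//.
      by near: n; exact: nbhs_infty_ger.
    by apply/gtr0_cvgV0 => //; near=> n; rewrite sqrtr_gt0 ltr0n; near: n; exact: nbhs_infty_gt.
  - apply: cvgMr; apply: cvg_norm; apply: cvgB => //; exact: cvg_cst.
apply/cvgrPdist_le => eps eps0.
have /cvgrPdist_le/(_ _ eps0) := e0; apply: filter_app; near=> n.
rewrite sub0r normrN => he.
have n0 : (0 < n)%N by near: n; exact: nbhs_infty_gt.
have sn0 : 0 < Num.sqrt n%:R :> R by rewrite sqrtr_gt0 ltr0n.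
have sV0 : 0 < Num.sqrt V by rewrite sqrtr_gt0.
pose t := Num.sqrt V / Num.sqrt n%:R.
have t0 : 0 < t by rewrite divr_gt0.
have := @lindeberg _ _ _ P N gaussian_convolution normal_integrable_pow
  normal_integrable_norm_pow normal_mean normal_second_moment X indepX (psi n) (M n) (q n)
  (mpsi n) (psiM n) (psi_mean n) (psi_second n) phi phi1 phi2 C D mphi mphi1 mphi2 phi01
  phi1D phi2D tay t t0 n.
rewrite -/m3 distrC.
have -> : t * Num.sqrt n%:R = Num.sqrt V by rewrite /t divfK// gt_eqF.
move=> h; apply: le_trans h _; apply: le_trans he; apply: le_trans (ler_norm _).
rewrite le_eqVlt; apply/orP; left; apply/eqP; rewrite /e.
have t2 : t ^+ 2 = V / n%:R by rewrite /t expr_div_n !sqr_sqrtr// ltW.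
have nE : n%:R = Num.sqrt n%:R ^+ 2 :> R by rewrite sqr_sqrtr.
have nn0 : n%:R != 0 :> R by rewrite pnatr_eq0 -lt0n.
have -> : n%:R * q n - V = n%:R * (q n - t ^+ 2) by rewrite t2; field.
rewrite normrM (ger0_norm (ler0n R n)) !mulrDr; congr (_ + _ + _); [by ring| |by ring].
rewrite {1}nE /t expr_div_n; field.
by rewrite gt_eqF.
Unshelve. all: by end_near.
Qed.

End clt.

Section prob_bounds.
Context {d} {T : measurableType d} {R : realType} (P : probability T R).

Lemma Rintegral_prob_indic (A : set T) : measurable A -> \int[P]_w \1_A w = fine (P A).
Proof. by move=> mA; rewrite /Rintegral integral_indic// setIT. Qed.

Lemma integrable_prob_indic (A : set T) : measurable A ->
  P.-integrable setT (EFin \o (\1_A : T -> R)).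
Proof.
move=> mA; apply: (@prob_integrable _ _ _ P _ 1); first exact: measurable_indic.
by move=> w; rewrite indicE; case: (_ \in _); rewrite ?normr1 ?normr0.
Qed.

Lemma prob_le_expectation (A : set T) (g : T -> R) : measurable A -> measurable_fun setT g ->
  (forall w, 0 <= g w <= 1) -> (forall w, A w -> g w = 1) -> fine (P A) <= \int[P]_w g w.
Proof.
move=> mA mg g01 Ag; rewrite -Rintegral_prob_indic//; apply: le_Rintegral => //.
- exact: integrable_prob_indic.
- by apply: (@prob_integrable _ _ _ P _ 1) => // w; rewrite ger0_norm; case/andP: (g01 w).
- move=> w _; rewrite indicE; case: (boolP (w \in A)); first by rewrite inE => /Ag ->.
  by move=> _; case/andP: (g01 w).
Qed.

Lemma expectation_le_prob (A : set T) (g : T -> R) : measurable A -> measurable_fun setT g ->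
  (forall w, 0 <= g w <= 1) -> (forall w, ~ A w -> g w = 0) -> \int[P]_w g w <= fine (P A).
Proof.
move=> mA mg g01 Ag; rewrite -Rintegral_prob_indic//; apply: le_Rintegral => //.
- by apply: (@prob_integrable _ _ _ P _ 1) => // w; rewrite ger0_norm; case/andP: (g01 w).
- exact: integrable_prob_indic.
- move=> w _; rewrite indicE; case: (boolP (w \in A)) => [_|]; first by case/andP: (g01 w).
  by rewrite notin_setE => /Ag ->.
Qed.

Lemma fine_prob_le (A B : set T) : measurable A -> measurable B -> A `<=` B ->
  fine (P A) <= fine (P B).
Proof.
by move=> mA mB AB; rewrite fine_le ?fin_num_measure// le_measure// inE.
Qed.

Lemma fine_prob_le_add (A B C : set T) : measurable A -> measurable B -> measurable C ->
  A `<=` B `|` C -> fine (P A) <= fine (P B) + fine (P C).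
Proof.
move=> mA mB mC ABC; rewrite -fineD ?fin_num_measure//.
apply: fine_le; rewrite ?fin_numD ?fin_num_measure//.
apply: le_trans (measureU2 P mB mC).
by rewrite le_measure// inE//; exact: measurableU.
Qed.

End prob_bounds.

(** * Limit law under a perturbation small in probability *)

Section slutsky.
Context {d : measure_display} {T : measurableType d} {R : realType}.
Variable P : probability T R.
Local Notation N := (@normal_prob R 0 1).
Variable X : nat -> {RV P >-> R}.
Hypothesis indepX : mutually_independent X.
Variables (psi : nat -> R -> R) (M q : nat -> R) (V : R).
Hypothesis mpsi : forall n, measurable_fun setT (psi n).
Hypothesis psiM : forall n u, `|psi n u| <= M n.
Hypothesis psi_mean : forall n k, \int[P]_v psi n (X k v) = 0.
Hypothesis psi_second : forall n k, \int[P]_v (psi n (X k v) ^+ 2) = q n.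
Hypothesis M0 : M n @[n --> \oo] --> 0.
Hypothesis nqV : n%:R * q n @[n --> \oo] --> V.
Hypothesis V0 : 0 < V.
Variable Y : nat -> T -> R.
Hypothesis mY : forall n, measurable_fun setT (Y n).
Hypothesis Y_near : forall e k : R, 0 < e -> 0 < k ->
  \forall n \near \oo, fine (P [set w | e < `|Y n w - partial_sum X (psi n) n w|]) <= k.

Let S n := partial_sum X (psi n) n.
Let mS n : measurable_fun setT (S n) := measurable_partial_sum X (mpsi n) n.
Let nu := normal_prob 0 (Num.sqrt V).
Let F (z : R) : R := fine (nu `]-oo, z]).

Let mray (f : T -> R) z : measurable_fun setT f -> measurable (f @^-1` `]-oo, z]).
Proof. by move=> mf; apply: measurable_preimage. Qed.

Let mdist n e : measurable [set w | e < `|Y n w - S n w|].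
Proof.
have -> : [set w | e < `|Y n w - S n w|] = (fun w => `|Y n w - S n w|) @^-1` `]e, +oo[.
  by apply/seteqP; split=> w /=; rewrite in_itv/= andbT.
apply: measurable_preimage => //; apply: measurableT_comp => //; exact: measurable_funB.
Qed.

Let test_integral (phi : R -> R) : measurable_fun setT phi -> (forall x, 0 <= phi x <= 1) ->
  \int[N]_y phi (Num.sqrt V * y) = \int[nu]_y phi y.
Proof.
move=> mphi phi01; have sV0 : 0 < Num.sqrt V by rewrite sqrtr_gt0.
have mphiE : measurable_fun setT (fun y => (phi y)%:E) by exact/measurable_EFinP.
have phi0 x : (0 <= (phi x)%:E)%E by rewrite lee_fin; case/andP: (phi01 x).
exact: (congr1 fine (esym (integral_normal_scale sV0 mphiE phi0))).
Qed.

(** The step lies between the indicators of []-oo, x + e]] and []-oo, x + 2 e]]; the first gap of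
    width [e] pays for the distance between [Y] and the sum, the second for the smoothing. *)
Let upper (x e k : R) : 0 < e -> 0 < k ->
  \forall n \near \oo, fine (P (Y n @^-1` `]-oo, x])) <= F (x + 2 * e) + k.
Proof.
move=> e0 k0.
(* The compression [3 / e] makes the transition interval exactly of length [e]. *)
have r0 : 0 < 3 / e by rewrite divr_gt0.
have [phi [phi1 [phi2 [C [D [[m0 m1 m2] phi01 [b1 b2] tay [z0 z1]]]]]]] :=
  smooth_step (x + 2 * e) r0.
have cv := cvg_test_expectation indepX mpsi psiM psi_mean psi_second M0 nqV V0 m0 m1 m2 phi01 b1 b2 tay.
have k2 : 0 < k / 2 by rewrite divr_gt0.
have /cvgrPdist_le/(_ _ k2) cv' := cv.
have near2 := Y_near e0 k2.
near=> n.
have h1 : `|\int[N]_y phi (Num.sqrt V * y) - \int[P]_w phi (S n w)| <= k / 2.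
  by near: n.
have h2 : fine (P [set w | e < `|Y n w - S n w|]) <= k / 2 by near: n.
have h3 : fine (P (Y n @^-1` `]-oo, x])) <=
    fine (P (S n @^-1` `]-oo, x + e])) + fine (P [set w | e < `|Y n w - S n w|]).
  apply: fine_prob_le_add; [exact: mray|exact: mray|exact: mdist|].
  move=> w /=; rewrite !in_itv/= => Yx.
  have [h|h] := lerP `|Y n w - S n w| e; last by right.
  by left; move: h; rewrite ler_norml => /andP[? ?]; lra.
have h4 : fine (P (S n @^-1` `]-oo, x + e])) <= \int[P]_w phi (S n w).
  apply: prob_le_expectation; first exact: mray.
  - exact: measurableT_comp.
  - by move=> w; exact: phi01.
  - move=> w /=; rewrite in_itv/= => Sx; apply: z1.
    have -> : 3 / (3 / e) = e by field; rewrite gt_eqF.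
    lra.
have h5 : \int[N]_y phi (Num.sqrt V * y) <= F (x + 2 * e).
  rewrite test_integral//; apply: expectation_le_prob => //.
  by move=> w /=; rewrite in_itv/= => /negP; rewrite -ltNge => /ltW; exact: z0.
by move: h1; rewrite ler_norml => /andP[? ?]; lra.
Unshelve. all: by end_near.
Qed.

(** The mirror image: the step now lies between the indicators of []-oo, x - 2 e]] and []-oo, x -
    e]]. *)
Let lower (x e k : R) : 0 < e -> 0 < k ->
  \forall n \near \oo, F (x - 2 * e) - k <= fine (P (Y n @^-1` `]-oo, x])).
Proof.
move=> e0 k0.
have r0 : 0 < 3 / e by rewrite divr_gt0.
have [phi [phi1 [phi2 [C [D [[m0 m1 m2] phi01 [b1 b2] tay [z0 z1]]]]]]] :=
  smooth_step (x - e) r0.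
have cv := cvg_test_expectation indepX mpsi psiM psi_mean psi_second M0 nqV V0 m0 m1 m2 phi01 b1 b2 tay.
have k2 : 0 < k / 2 by rewrite divr_gt0.
have /cvgrPdist_le/(_ _ k2) cv' := cv.
have near2 := Y_near e0 k2.
near=> n.
have h1 : `|\int[N]_y phi (Num.sqrt V * y) - \int[P]_w phi (S n w)| <= k / 2.
  by near: n.
have h2 : fine (P [set w | e < `|Y n w - S n w|]) <= k / 2 by near: n.
have h3 : fine (P (S n @^-1` `]-oo, x - e])) <=
    fine (P (Y n @^-1` `]-oo, x])) + fine (P [set w | e < `|Y n w - S n w|]).
  apply: fine_prob_le_add; [exact: mray|exact: mray|exact: mdist|].
  move=> w /=; rewrite !in_itv/= => Yx.
  have [h|h] := lerP `|Y n w - S n w| e; last by right.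
  by left; move: h; rewrite ler_norml => /andP[? ?]; lra.
have h4 : \int[P]_w phi (S n w) <= fine (P (S n @^-1` `]-oo, x - e])).
  apply: expectation_le_prob; first exact: mray.
  - exact: measurableT_comp.
  - by move=> w; exact: phi01.
  - by move=> w /=; rewrite in_itv/= => /negP; rewrite -ltNge => /ltW; exact: z0.
have h5 : F (x - 2 * e) <= \int[N]_y phi (Num.sqrt V * y).
  rewrite test_integral//; apply: prob_le_expectation => //.
  move=> w /=; rewrite in_itv/= => Sx; apply: z1.
  have -> : 3 / (3 / e) = e by field; rewrite gt_eqF.
  lra.
by move: h1; rewrite ler_norml => /andP[? ?]; lra.
Unshelve. all: by end_near.
Qed.

Lemma clt_perturbed : cvg_in_distribution P Y (normal_prob 0 (Num.sqrt V)).
Proof.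
split; first exact: mY.
move=> x cx.
have finF z : nu `]-oo, z] = (F z)%:E by rewrite /F fineK// fin_num_measure.
have finP n : P (Y n @^-1` `]-oo, x]) = (fine (P (Y n @^-1` `]-oo, x])))%:E.
  by rewrite fineK// fin_num_measure//; exact: mray.
have cF : F z @[z --> x] --> F x.
  have /fine_cvgP[_ h] : nu `]-oo, z] @[z --> x] --> (F x)%:E by rewrite -finF; exact: cx.
  exact: h.
rewrite -[X in _ --> X]/(nu `]-oo, x]) finF.
under eq_fun do rewrite finP.
apply: cvg_EFin; first by near=> n.
apply/cvgrPdist_le => eps eps0.
have eps2 : 0 < eps / 2 by rewrite divr_gt0.
have /cvgrPdist_le/(_ _ eps2) := cF.
move=> /nbhs_normP[r /= r0 hr].
(* The two bounds reach [2 e] away from [x]; a quarter of the radius keeps this at [r / 2], inside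
   the open ball. *)
have e0 : 0 < r / 4 by rewrite divr_gt0.
have hu := upper x e0 eps2.
have hl := lower x e0 eps2.
near=> n.
have u : fine (P (Y n @^-1` `]-oo, x])) <= F (x + 2 * (r / 4)) + eps / 2 by near: n.
have l : F (x - 2 * (r / 4)) - eps / 2 <= fine (P (Y n @^-1` `]-oo, x])) by near: n.
have hru : `|F x - F (x + 2 * (r / 4))| <= eps / 2.
  by apply: hr; rewrite /ball_/= opprD addrA subrr sub0r normrN gtr0_norm; lra.
have hrl : `|F x - F (x - 2 * (r / 4))| <= eps / 2.
  by apply: hr; rewrite /ball_/= opprB addrC subrK gtr0_norm; lra.
move: hru hrl; rewrite !ler_norml => /andP[? ?] /andP[? ?].
by apply/andP; split; lra.
Unshelve. all: by end_near.
Qed.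

End slutsky.

(** * Second moments of sums and Chebyshev's inequality *)

Section second_moment.
Context {d : measure_display} {T : measurableType d} {R : realType}.
Variable P : probability T R.
Variable X : nat -> {RV P >-> R}.
Hypothesis indepX : mutually_independent X.
Variables (psi : R -> R) (M q : R).
Hypothesis mpsi : measurable_fun setT psi.
Hypothesis psiM : forall u, `|psi u| <= M.
Hypothesis psi_mean : forall k, \int[P]_v psi (X k v) = 0.
Hypothesis psi_second : forall k, \int[P]_v (psi (X k v) ^+ 2) = q.

Let S := partial_sum X psi.
Let mS k : measurable_fun setT (S k) := measurable_partial_sum X mpsi k.

Let S_le k w : `|S k w| <= k%:R * M.
Proof.
rewrite /S /partial_sum; apply: le_trans (ler_norm_sum _ _ _) _.
apply: le_trans (ler_sum _ (fun i _ => psiM _)) _.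
by rewrite sumr_const card_ord mulr_natl.
Qed.

Let iS2 k : P.-integrable setT (EFin \o (fun w => S k w ^+ 2)).
Proof.
apply: (@prob_integrable _ _ _ P _ ((k%:R * M) ^+ 2)); first exact: measurable_funX.
by move=> w; rewrite normrX lerXn2r ?nnegrE// (le_trans _ (S_le k w)).
Qed.

(** Conditionally on the earlier sum, the cross term has mean zero, so each new term adds [q]. *)
Lemma partial_sum_second_moment n : \int[P]_w (S n w ^+ 2) = n%:R * q.
Proof.
elim: n => [|n IH].
  rewrite mul0r -[RHS](Rintegral_prob_cst P); apply: eq_Rintegral => w _.
  by rewrite /S /partial_sum big_ord0 expr0n.
apply: EFin_inj; rewrite -EFin_Rintegral_prob//.
rewrite (@expectation_partial_sumS _ _ _ P X indepX psi mpsi n (fun x => x ^+ 2))//; last first.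
  by move=> x; exact: sqr_ge0.
have i1 : P.-integrable setT (EFin \o (fun v => psi (X n v))).
  by apply: (@prob_integrable _ _ _ P _ M) => //; exact: measurableT_comp.
have i2 : P.-integrable setT (EFin \o (fun v => psi (X n v) ^+ 2)).
  apply: (@prob_integrable _ _ _ P _ (M ^+ 2)).
    by apply: measurable_funX; exact: measurableT_comp.
  by move=> v; rewrite normrX lerXn2r// nnegrE (le_trans _ (psiM 0)).
have inner w : (\int[P]_v ((S n w + psi (X n v)) ^+ 2)%:E = (S n w ^+ 2 + q)%:E)%E.
  have ic : P.-integrable setT (EFin \o (fun _ : T => S n w ^+ 2)).
    by apply: (@prob_integrable _ _ _ P _ `|S n w ^+ 2|).
  have i1' := integrable_scale measurableT (2 * S n w) i1.
  have -> : (\int[P]_v ((S n w + psi (X n v)) ^+ 2)%:E =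
      \int[P]_v (S n w ^+ 2 + 2 * S n w * psi (X n v) + psi (X n v) ^+ 2)%:E)%E.
    by apply: eq_integral => v _; congr EFin; ring.
  rewrite EFin_Rintegral_prob; last by apply: integrable_add => //; exact: integrable_add.
  congr EFin; rewrite RintegralD//; last exact: integrable_add.
  by rewrite RintegralD// RintegralZl// psi_mean psi_second mulr0 addr0 Rintegral_prob_cst.
rewrite -/S; under eq_integral do rewrite inner.
have iq : P.-integrable setT (EFin \o (fun _ : T => q)).
  by apply: (@prob_integrable _ _ _ P _ `|q|).
rewrite EFin_Rintegral_prob; last by apply: integrable_add.
by rewrite RintegralD// IH Rintegral_prob_cst -natr1 mulrDl mul1r.
Qed.

Lemma partial_sum_chebyshev n (e : R) : 0 < e ->
  fine (P [set w | e < `|S n w|]) <= n%:R * q / e ^+ 2.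
Proof.
move=> e0.
have mA : measurable [set w | e < `|S n w|].
  have -> : [set w | e < `|S n w|] = (fun w => `|S n w|) @^-1` `]e, +oo[.
    by apply/seteqP; split=> w /=; rewrite in_itv/= andbT.
  by apply: measurable_preimage => //; exact: measurableT_comp.
rewrite -Rintegral_prob_indic// -partial_sum_second_moment mulrC -RintegralZl//.
apply: le_Rintegral => //; [exact: integrable_prob_indic|exact: integrable_scale|].
move=> w _; rewrite indicE; case: (boolP (w \in _)) => [|_].
  rewrite inE/= => h; rewrite ler_pdivlMl ?exprn_gt0// mulr1.
  by rewrite -(real_normK (num_real (S n w))) lerXn2r// ?nnegrE ltW.
by rewrite mulr_ge0 ?sqr_ge0// invr_ge0 sqr_ge0.
Qed.

End second_moment.

(** * Laplace's method *)

Section laplace_pointwise.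
Context {R : realType}.
Implicit Types a v x y s r : R.

Lemma mvt_bound (f df : R -> R) (x y B : R) : x <= y ->
  (forall z : R, x <= z <= y -> is_derive z 1 f (df z)) ->
  (forall z, x <= z <= y -> `|df z| <= B) -> `|f y - f x| <= B * (y - x).
Proof.
move=> xy dfz dfB.
have cf : {within `[x, y], continuous f}.
  apply: derivable_within_continuous => z; rewrite in_itv/= => /dfz h.
  by case: h.
have [z zxy ->] : exists2 z, z \in `[x, y] & f y - f x = df z * (y - x).
  apply: MVT_segment => // z; rewrite in_itv/= => /andP[h1 h2].
  by apply: dfz; rewrite !ltW.
rewrite normrM [X in _ * X]ger0_norm ?subr_ge0// ler_wpM2r ?subr_ge0//.
by apply: dfB; move: zxy; rewrite in_itv.
Qed.

(** With [r = sqrt (1 + v)] the right side is [r^2 - 1 - 2 ln r], and [ln r <= r - 1]. The square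
    root yields a bound that is quadratic near 0 and linear at infinity. *)
Lemma sub_ln_ge v : -1 < v -> (Num.sqrt (1 + v) - 1) ^+ 2 <= v - ln (1 + v).
Proof.
move=> v1; set r := Num.sqrt _.
have v0 : 0 < 1 + v by lra.
have r0 : 0 < r by rewrite sqrtr_gt0.
have r2 : r ^+ 2 = 1 + v by rewrite sqr_sqrtr// ltW.
have -> : ln (1 + v) = 2 * ln r by rewrite -r2 lnXn// mulr_natl.
have : ln r <= r - 1.
  have := @le_ln1Dx R (r - 1); rewrite addrCA subrr addr0; apply; lra.
have -> : v = r ^+ 2 - 1 by rewrite r2; ring.
move=> h; rewrite sqrrB1; lra.
Qed.

Lemma sub_ln_ge0 v : -1 < v -> 0 <= v - ln (1 + v).
Proof. by move=> v1; apply: le_trans (sub_ln_ge v1); rewrite sqr_ge0. Qed.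

(** Since [v = (r - 1)(r + 1)], the bound follows from [|r - 1| >= (r + 1) / 18], that is
    [r >= 19 / 17] or [r <= 17 / 19]. The condition on [|v|] ensures this: [sqrt (5/4)] barely
    exceeds [19 / 17]. *)
Lemma sub_ln_ge_norm v : -1 < v -> 1 / 4 <= `|v| -> `|v| / 18 <= v - ln (1 + v).
Proof.
move=> v1 v4; apply: le_trans (sub_ln_ge v1); set r := Num.sqrt _.
have v0 : 0 < 1 + v by lra.
have r0 : 0 < r by rewrite sqrtr_gt0.
have r2 : r ^+ 2 = 1 + v by rewrite sqr_sqrtr// ltW.
have ve : v = r ^+ 2 - 1 by rewrite r2; ring.
have [vp|vn] := lerP 0 v.
  rewrite ger0_norm // in v4 *.
  have r1 : 19 / 17 <= r by rewrite leNgt; apply/negP => h; nra.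
  by rewrite ve; nra.
rewrite ltr0_norm // in v4 *.
have r1 : r <= 17 / 19 by rewrite leNgt; apply/negP => h; nra.
by rewrite ve; nra.
Qed.

(** The error has derivative [- x^3 / (1 + x)], and [1 / (1 + x)] is at most [4 / 3], hence below 2,
    on the range considered. *)
Lemma ln_taylor v : `|v| <= 1 / 4 ->
  `|ln (1 + v) - (v - v ^+ 2 / 2 + v ^+ 3 / 3)| <= 2 * v ^+ 4.
Proof.
move=> v4.
pose f x := ln (1 + x) - (x - x ^+ 2 / 2 + x ^+ 3 / 3).
pose df x := - (x ^+ 3 / (1 + x)).
have dfP x : - (1/4) <= x -> is_derive x 1 f (df x).
  move=> x1; have x0 : 0 < 1 + x by lra.
  have h1 : is_derive x 1 (fun x : R => ln (1 + x)) ((1 + x)^-1 * (0 + 1)).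
    exact: (is_derive_comp (is_derive1_ln x0)
      (is_derive_add (is_derive_cst _ _ _) (is_derive_id _ _))).
  have h2 : is_derive x 1 (fun x : R => x - x ^+ 2 / 2 + x ^+ 3 / 3)
     (1 - (2%:R * x ^+ 1 * 2^-1 + x ^+ 2 * 0) + (3%:R * x ^+ 2 * 3^-1 + x ^+ 3 * 0)).
    exact: (is_derive_add (is_derive_sub (is_derive_id _ _)
      (is_derive_mul (is_derive_pow 2 _) (is_derive_cst _ _ _)))
      (is_derive_mul (is_derive_pow 3 _) (is_derive_cst _ _ _))).
  have := is_derive_sub h1 h2; rewrite -/(f) (_ : _ - _ = df x)//.
  by rewrite /df; field; rewrite gt_eqF.
have dfB x : `|x| <= `|v| -> `|df x| <= 2 * `|v| ^+ 3.
  move=> xv; have x4 := le_trans xv v4.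
  have : - (1/4) <= x by move: x4; rewrite ler_norml => /andP[].
  move=> x1; have x0 : 0 < 1 + x by lra.
  rewrite /df normrN normrM normrX mulrC ler_pM ?exprn_ge0//.
    by rewrite gtr0_norm ?invr_gt0// invf_ple ?posrE//; lra.
  by rewrite lerXn2r ?nnegrE.
have f0 : f 0 = 0 by rewrite /f !expr0n/= addr0 ln1; field.
have v44 : `|v| ^+ 3 * `|v| = v ^+ 4 by rewrite -exprSr -normrX ger0_norm// exprn_even_ge0.
rewrite -[X in `|X|](_ : f v = _) // -v44 mulrA.
have [v0|v0] := lerP 0 v.
  have := @mvt_bound f df 0 v (2 * `|v| ^+ 3) v0; rewrite f0 !subr0 {4}(ger0_norm v0); apply.
  - by move=> z /andP[z0 _]; apply: dfP; lra.
  - by move=> z /andP[z0 zv]; apply: dfB; rewrite !ger0_norm.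
have := @mvt_bound f df v 0 (2 * `|v| ^+ 3) (ltW v0).
rewrite f0 !sub0r normrN {4}(ltr0_norm v0); apply.
- by move=> z /andP[z0 _]; apply: dfP; move: v4; rewrite ltr0_norm//; lra.
- by move=> z /andP[z0 zv]; apply: dfB; rewrite (ler0_norm zv) (ltr0_norm v0) lerN2.
Qed.

(** Convexity gives both [1 + x <= exp x] and [exp x - 1 <= x exp x]; together they place the error
    between 0 and [x (exp x - 1)]. *)
Lemma expR_taylor1 x : `|expR x - 1 - x| <= x ^+ 2 * expR `|x|.
Proof.
have h1 := expR_ge1Dx x.
have h2 : expR x - 1 <= x * expR x.
  have := expR_ge1Dx (- x); rewrite -(ler_pM2r (expR_gt0 x)).
  by rewrite -expRD addNr expR0 mulrDl mul1r; lra.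
rewrite ger0_norm; last by lra.
apply: (@le_trans _ _ (x * (expR x - 1))); first by nra.
have [x0|x0] := lerP 0 x.
  by rewrite (ger0_norm x0) expr2 -mulrA ler_wpM2l.
have -> : x * (expR x - 1) = - x * (1 - expR x) by ring.
rewrite -sqrrN expr2 -mulrA; apply: ler_wpM2l; first lra.
apply: (@le_trans _ _ (- x)); first by lra.
rewrite ler_peMr//; first by lra.
by rewrite -expR0 ler_expR normr_ge0.
Qed.

(* [laplace_weight s a y] is [((1 + v) expR (- v))^a] with [v = s y / sqrt a], extended by [0]. *)
Definition laplace_weight s a y : R :=
  \1_`]0, +oo[ (1 + s * y / Num.sqrt a) *
  expR (- (a * (s * y / Num.sqrt a - ln (1 + s * y / Num.sqrt a)))).

Lemma measurable_laplace_weight s a : measurable_fun setT (laplace_weight s a).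
Proof.
have m1 : measurable_fun setT (fun y : R => s * y / Num.sqrt a).
  by apply: measurable_funM => //; exact: measurable_funM.
have m2 : measurable_fun setT (fun y : R => 1 + s * y / Num.sqrt a) by exact: measurable_funD.
apply: measurable_funM.
  by apply: measurableT_comp => //; exact: measurable_indic.
apply: measurableT_comp => //; apply: measurableT_comp => //.
apply: measurable_funM => //; apply: measurable_funB => //.
by apply: measurableT_comp => //; exact: measurable_ln.
Qed.

Lemma laplace_weightE s a y : -1 < s * y / Num.sqrt a ->
  laplace_weight s a y =
  expR (- (a * (s * y / Num.sqrt a - ln (1 + s * y / Num.sqrt a)))).
Proof.
by move=> h; rewrite /laplace_weight indicE mem_set ?mul1r//= in_itv/= andbT; lra.
Qed.

Lemma laplace_weight_eq0 s a y : s * y / Num.sqrt a <= -1 -> laplace_weight s a y = 0.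
Proof.
move=> h; rewrite /laplace_weight indicE memNset ?mul0r//= in_itv/= andbT.
by apply/negP; rewrite -leNgt; lra.
Qed.

Lemma laplace_weight01 s a y : 0 <= a -> 0 <= laplace_weight s a y <= 1.
Proof.
move=> a0; have [h|h] := lerP (s * y / Num.sqrt a) (-1).
  by rewrite laplace_weight_eq0// lexx ler01.
rewrite laplace_weightE// expR_ge0/= expR_le1 oppr_le0 mulr_ge0//.
exact: sub_ln_ge0.
Qed.

(** Two regimes for [v = s y / sqrt a]. When [|v| <= 1/4] the logarithm is expanded: [y^6] is the
    square of the error exponent and [2 y^4] its quartic remainder. Otherwise both functions are
    exponentially small and [16 y^2 / a >= 1] supplies the factor [1 / a]; this gives the other two
    powers. *)
Lemma laplace_weight_approx s a y : s ^+ 2 = 1 -> 1 <= a -> 0 <= y ->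
  `|laplace_weight s a y - gauss_weight y * (1 + s * y ^+ 3 / (3 * Num.sqrt a))| <=
  a^-1 * (expR 1 * expR (- (y / 18)) * (y ^+ 6 + 2 * y ^+ 4 + 32 * y ^+ 2 + 16 * y ^+ 5)).
Proof.
move=> s2 a1 y0.
have a0 : 0 < a by lra.
set r := Num.sqrt a.
have r1 : 1 <= r by rewrite -sqrtr1 ler_wsqrtr.
have r0 : 0 < r by lra.
have r2 : r ^+ 2 = a by rewrite sqr_sqrtr// ltW.
have ns : `|s| = 1 by apply/eqP; rewrite -sqr_norm_eq1 // s2.
pose v := s * y / r.
have nv : `|v| = y / r by rewrite /v !normrM ns mul1r ger0_norm// gtr0_norm// invr_gt0.
have v2 : v ^+ 2 = y ^+ 2 / a by rewrite /v !exprMn exprVn s2 mul1r r2.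
have av2 : a * v ^+ 2 = y ^+ 2 by rewrite v2; field; rewrite gt_eqF.
have e18 : expR (- (y / 18)) <= expR 1 * expR (- (y / 18)).
  by rewrite ler_peMl ?expR_ge0// -expR0 ler_expR.
(* The rate [y / 18] is all that the far regime provides; Gaussian factors are weakened to it at the
   price of a factor [exp 1]. *)
have y4 : expR (- (y ^+ 2 / 4)) <= expR 1 * expR (- (y / 18)).
  rewrite -expRD ler_expR; have := sqr_ge0 (y / 2 - 1); rewrite sqrrB1 expr_div_n; lra.
have g18 : gauss_weight y <= expR 1 * expR (- (y / 18)).
  apply: le_trans y4; rewrite /gauss_weight ler_expR lerN2.
  by rewrite ler_wpM2l ?sqr_ge0// lef_pV2 ?posrE//; lra.
have [v4|v4] := lerP `|v| (1/4).
- have v1 : -1 < v by move: v4; rewrite ler_norml => /andP[]; lra.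
  rewrite laplace_weightE// -/r -/v.
  pose g := ln (1 + v) - (v - v ^+ 2 / 2 + v ^+ 3 / 3).
  have gB : `|g| <= 2 * v ^+ 4 := ln_taylor v4.
  pose E := - (a * v ^+ 3 / 3) - a * g.
  have -> : a * (v - ln (1 + v)) = y ^+ 2 / 2 + E.
    by rewrite /E /g -av2; field.
  rewrite opprD expRD -/(gauss_weight y).
  have av3 : a * v ^+ 3 = s * y ^+ 3 / r.
    by rewrite exprSr mulrA av2 /v; field; rewrite gt_eqF.
  have -> : gauss_weight y * expR (- E) - gauss_weight y * (1 + s * y ^+ 3 / (3 * r)) =
     gauss_weight y * ((expR (- E) - 1 - (- E)) + a * g).
    by rewrite /E av3; field; rewrite gt_eqF.
  have av3n : a * `|v| ^+ 3 = y ^+ 3 / r.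
    by rewrite exprSr mulrA real_normK ?num_real// av2 nv; field; rewrite gt_eqF.
  have v4n : v ^+ 4 = `|v| ^+ 3 * `|v| by rewrite -exprSr -normrX ger0_norm// exprn_even_ge0.
  have E1 : `|E| <= y ^+ 3 / r.
    rewrite -av3n /E; apply: le_trans (ler_normB _ _) _.
    have i3 : 0 <= (3 : R)^-1 by rewrite invr_ge0.
    have -> : `|- (a * v ^+ 3 / 3)| = a * `|v| ^+ 3 / 3.
      by rewrite normrN [LHS]normrM [X in X * _]normrM (gtr0_norm a0) normrX (ger0_norm i3).
    rewrite [X in _ + X]normrM (gtr0_norm a0).
    have : a * `|g| <= a * (2 * (`|v| ^+ 3 * (1 / 4))).
      rewrite ler_pM2l//; apply: le_trans gB _; rewrite v4n ler_pM2l//.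
      by rewrite ler_wpM2l// exprn_ge0.
    have : 0 <= a * `|v| ^+ 3 by rewrite mulr_ge0 ?exprn_ge0// ltW.
    lra.
  (* The restriction on [|v|] lets the error consume at most half of the Gaussian exponent, so
     [exp(-y^2/4)] remains. *)
  have E2 : `|E| <= y ^+ 2 / 4.
    apply: le_trans E1 _.
    have -> : y ^+ 3 / r = y ^+ 2 * `|v| by rewrite nv; field; rewrite gt_eqF.
    by rewrite ler_wpM2l ?sqr_ge0//; lra.
  have EE : E ^+ 2 <= y ^+ 6 / a.
    rewrite -(real_normK (num_real E)).
    have -> : y ^+ 6 / a = (y ^+ 3 / r) ^+ 2 by rewrite expr_div_n r2; field; rewrite gt_eqF.
    by rewrite lerXn2r// nnegrE// divr_ge0 ?exprn_ge0// ltW.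
  have ag : `|a * g| <= 2 * y ^+ 4 / a.
    rewrite normrM (gtr0_norm a0).
    have -> : 2 * y ^+ 4 / a = a * (2 * v ^+ 4).
      have -> : v ^+ 4 = (v ^+ 2) ^+ 2 by rewrite -exprM.
      by rewrite v2; field; rewrite gt_eqF.
    by rewrite ler_pM2l.
  rewrite normrM (ger0_norm (gauss_weight_ge0 y)).
  have t1 : `|expR (- E) - 1 - - E| <= y ^+ 6 / a * expR (y ^+ 2 / 4).
    apply: le_trans (expR_taylor1 _) _; rewrite sqrrN normrN.
    by rewrite ler_pM ?sqr_ge0 ?expR_ge0// ler_expR.
  apply: (@le_trans _ _ (gauss_weight y * (y ^+ 6 / a * expR (y ^+ 2 / 4) + 2 * y ^+ 4 / a))).
    by rewrite ler_wpM2l ?gauss_weight_ge0//; apply: le_trans (ler_normD _ _) _; exact: lerD.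
  have -> : gauss_weight y * (y ^+ 6 / a * expR (y ^+ 2 / 4) + 2 * y ^+ 4 / a) =
     a^-1 * (gauss_weight y * expR (y ^+ 2 / 4) * y ^+ 6 + gauss_weight y * (2 * y ^+ 4)) by ring.
  have -> : gauss_weight y * expR (y ^+ 2 / 4) = expR (- (y ^+ 2 / 4)).
    by rewrite /gauss_weight -expRD; congr expR; field.
  rewrite ler_pM2l ?invr_gt0// !mulrDr -!addrA lerD//.
    by rewrite ler_wpM2r// exprn_ge0.
  rewrite -[leLHS]addr0 lerD//.
    by rewrite ler_wpM2r// mulr_ge0// exprn_ge0.
  by rewrite addr_ge0// ?mulr_ge0 ?expR_ge0 ?exprn_ge0.
- set K := expR 1 * _.
  have K0 : 0 <= K by rewrite mulr_ge0 ?expR_ge0.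
  (* In the far regime the trivial factor 1 is exchanged for [16 v^2], which has order [1 / a]. *)
  have one : 1 <= 16 * y ^+ 2 / a.
    have -> : 16 * y ^+ 2 / a = 16 * `|v| ^+ 2 by rewrite nv expr_div_n r2; ring.
    by nra.
  have lapK : `|laplace_weight s a y| <= K.
    have [h|h] := lerP v (-1); first by rewrite laplace_weight_eq0// normr0.
    rewrite laplace_weightE// -/r -/v ger0_norm ?expR_ge0//; apply: le_trans e18.
    rewrite ler_expR lerN2.
    have := ler_wpM2l (ltW a0) (sub_ln_ge_norm h (ltW v4)); apply: le_trans.
    have -> : a * (`|v| / 18) = r * (y / 18) by rewrite nv -r2; field; rewrite gt_eqF.
    by rewrite ler_peMl// divr_ge0.
  have gK : `|gauss_weight y * (1 + s * y ^+ 3 / (3 * r))| <= K * (1 + y ^+ 3).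
    rewrite normrM (ger0_norm (gauss_weight_ge0 y)) ler_pM ?gauss_weight_ge0//.
    apply: le_trans (ler_normD _ _) _; rewrite normr1 lerD2l.
    have y3 : 0 <= y ^+ 3 by rewrite exprn_ge0.
    have r3 : 0 < 3 * r by lra.
    rewrite -mulrA [X in X <= _]normrM ns mul1r ger0_norm; last by rewrite divr_ge0// ltW.
    by rewrite ler_pdivrMr// ler_peMr//; lra.
  apply: le_trans (ler_normB _ _) _; apply: le_trans (lerD lapK gK) _.
  have -> : K + K * (1 + y ^+ 3) = 1 * (K * (2 + y ^+ 3)) by ring.
  have p3 : 0 <= y ^+ 3 by rewrite exprn_ge0.
  have Kp : 0 <= K * (2 + y ^+ 3) by rewrite mulr_ge0// addr_ge0.
  apply: le_trans (ler_wpM2r Kp one) _.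
  have -> : 16 * y ^+ 2 / a * (K * (2 + y ^+ 3)) =
    a^-1 * (K * (32 * y ^+ 2 + 16 * y ^+ 5)) by ring.
  rewrite ler_pM2l ?invr_gt0// ler_wpM2l// -addrA lerDr.
  by rewrite addr_ge0// ?mulr_ge0 ?exprn_ge0.
Qed.

End laplace_pointwise.

Section laplace_moments.
Context {R : realType}.
Local Notation mu := (@lebesgue_measure R).
Local Notation HL := (`[0, +oo[%classic : set R).
Implicit Types a x y s : R.

Definition laplace_moment s a k : R := \int[mu]_(y in HL) (y ^+ k * laplace_weight s a y).

(** Half of the decay rate absorbs the power, the other half survives. *)
Lemma pow_exp_decay k : exists2 C, 0 < C & forall y, 0 <= y ->
  y ^+ k * expR (- (y / 18)) <= C * expR (- (36^-1 * y)).
Proof.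
have t0 : (0 : R) < 36^-1 by rewrite invr_gt0.
have [C C0 hC] := @pow_le_expR R k _ t0.
exists C => // y y0; apply: le_trans (ler_wpM2r (expR_ge0 _) (hC y y0)) _.
by rewrite -mulrA -expRD ler_pM2l// ler_expR; lra.
Qed.

Lemma laplace_pointwise_approx k : exists2 C, 0 < C & forall s a y, s ^+ 2 = 1 -> 1 <= a -> 0 <= y ->
  `|y ^+ k * laplace_weight s a y -
    (y ^+ k * gauss_weight y + s / (3 * Num.sqrt a) * (y ^+ (k + 3) * gauss_weight y))| <=
  C / a * expR (- (36^-1 * y)).
Proof.
have [C6 C60 h6] := pow_exp_decay (k + 6).
have [C4 C40 h4] := pow_exp_decay (k + 4).
have [C2 C20 h2] := pow_exp_decay (k + 2).
have [C5 C50 h5] := pow_exp_decay (k + 5).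
exists (expR 1 * (C6 + 2 * C4 + 32 * C2 + 16 * C5)).
  by rewrite mulr_gt0 ?expR_gt0// !addr_gt0// mulr_gt0.
move=> s a y s2 a1 y0; have a0 : 0 < a by lra.
have h := laplace_weight_approx s2 a1 y0.
have -> : y ^+ k * laplace_weight s a y -
    (y ^+ k * gauss_weight y + s / (3 * Num.sqrt a) * (y ^+ (k + 3) * gauss_weight y)) =
    y ^+ k * (laplace_weight s a y - gauss_weight y * (1 + s * y ^+ 3 / (3 * Num.sqrt a))).
  by rewrite exprD; ring.
rewrite normrM ger0_norm ?exprn_ge0//.
apply: le_trans (ler_wpM2l (exprn_ge0 k y0) h) _.
set e := expR (- (y / 18)); set e' := expR (- (36^-1 * y)).
have -> : y ^+ k * (a^-1 * (expR 1 * e * (y ^+ 6 + 2 * y ^+ 4 + 32 * y ^+ 2 + 16 * y ^+ 5))) =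
  a^-1 * expR 1 * (y ^+ (k + 6) * e + 2 * (y ^+ (k + 4) * e) + 32 * (y ^+ (k + 2) * e)
     + 16 * (y ^+ (k + 5) * e)).
  by rewrite !exprD; ring.
have -> : expR 1 * (C6 + 2 * C4 + 32 * C2 + 16 * C5) / a * e' =
  a^-1 * expR 1 * (C6 * e' + 2 * (C4 * e') + 32 * (C2 * e') + 16 * (C5 * e')) by ring.
rewrite ler_pM2l ?mulr_gt0 ?invr_gt0 ?expR_gt0//.
have := h6 y y0; have := h4 y y0; have := h2 y y0; have := h5 y y0.
rewrite -/e -/e'; lra.
Qed.

Lemma measurable_pow_laplace s a k : measurable_fun HL (fun y => y ^+ k * laplace_weight s a y).
Proof.
by apply: measurable_funTS; apply: measurable_funM => //; exact: measurable_laplace_weight.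
Qed.

(** The majorant is independent of [a], which makes all moments of the weight finite and bounded
    uniformly. *)
Lemma pow_laplace_bound k : exists2 C, 0 < C & forall s a y, s ^+ 2 = 1 -> 1 <= a -> 0 <= y ->
  `|y ^+ k * laplace_weight s a y| <= C * expR (- (36^-1 * y)).
Proof.
have [C1 C10 h1] := laplace_pointwise_approx k.
have [C2 C20 h2] := @pow_gauss_le R k.
have [C3 C30 h3] := @pow_gauss_le R (k + 3).
exists (C1 + C2 + C3); first by rewrite !addr_gt0.
move=> s a y s2 a1 y0; have a0 : 0 < a by lra.
have {}h1 := h1 s a y s2 a1 y0; have {}h2 := h2 y y0; have {}h3 := h3 y y0.
set e := expR (- (36^-1 * y)) in h1 *.
have ee : expR (- (2^-1 * y)) <= e by rewrite ler_expR; lra.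
have e0 : 0 <= e by exact: expR_ge0.
have ns : `|s| = 1 by apply/eqP; rewrite -sqr_norm_eq1 // s2.
have r1 : 1 <= Num.sqrt a by rewrite -sqrtr1 ler_wsqrtr.
set u := y ^+ k * gauss_weight y in h1 h2; set v := y ^+ (k + 3) * gauss_weight y in h1 h3.
have u0 : 0 <= u by rewrite mulr_ge0 ?exprn_ge0 ?gauss_weight_ge0.
have v0 : 0 <= v by rewrite mulr_ge0 ?exprn_ge0 ?gauss_weight_ge0.
have g : `|u + s / (3 * Num.sqrt a) * v| <= C2 * e + C3 * e.
  apply: le_trans (ler_normD _ _) _; rewrite (ger0_norm u0); apply: lerD.
    by apply: le_trans h2 _; rewrite ler_pM2l.
  rewrite [leLHS]normrM (ger0_norm v0) normrM ns mul1r ger0_norm ?invr_ge0; last by lra.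
  apply: (@le_trans _ _ v); last by apply: le_trans h3 _; rewrite ler_pM2l.
  by rewrite ler_piMl// invf_le1; lra.
have C1a : C1 / a * e <= C1 * e.
  by rewrite ler_wpM2r// ler_pdivrMr// ler_peMr// ltW.
rewrite -[X in `|X|](subrK (u + s / (3 * Num.sqrt a) * v)).
apply: le_trans (ler_normD _ _) _.
apply: le_trans (lerD (le_trans h1 C1a) g) _.
by rewrite !mulrDl addrA.
Qed.

Lemma integrable_laplace s a k : s ^+ 2 = 1 -> 1 <= a ->
  mu.-integrable HL (EFin \o (fun y => y ^+ k * laplace_weight s a y)).
Proof.
move=> s2 a1; have [C C0 hC] := pow_laplace_bound k.
apply: (@integrable_HL_le _ _ C 36^-1); first by rewrite invr_gt0.
  exact: measurable_pow_laplace.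
by move=> y y0; exact: hC.
Qed.

Lemma laplace_moment_approx k : exists2 C, 0 < C & forall s a, s ^+ 2 = 1 -> 1 <= a ->
  `|laplace_moment s a k - (half_moment k + s / (3 * Num.sqrt a) * half_moment (k + 3))| <= C / a.
Proof.
have [C C0 hC] := laplace_pointwise_approx k.
exists (C * 36); first by rewrite mulr_gt0.
move=> s a s2 a1.
have t0 : (0 : R) < 36^-1 by rewrite invr_gt0.
have i1 := integrable_laplace k s2 a1.
have i2 := @integrable_pow_gauss R k.
have mHL : @measurable _ (measurableTypeR R) HL by [].
have i3 := integrable_scale mHL (s / (3 * Num.sqrt a)) (@integrable_pow_gauss R (k + 3)).
have -> : half_moment k + s / (3 * Num.sqrt a) * half_moment (k + 3) =
    \int[mu]_(y in HL) (y ^+ k * gauss_weight y +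
      s / (3 * Num.sqrt a) * (y ^+ (k + 3) * gauss_weight y)).
  by rewrite RintegralD// RintegralZl//; exact: integrable_pow_gauss.
have -> : C * 36 / a = \int[mu]_(y in HL) (C / a * expR (- (36^-1 * y))).
  by rewrite Rintegral_HL_expRNM// invrK mulrAC.
apply: Rintegral_near => //.
- exact: integrable_add.
- apply: (@integrable_HL_le _ _ (C / a) 36^-1) => //.
    apply: measurable_funTS; apply: measurable_funM => //; exact: measurable_expRNM.
  move=> x x0; rewrite ger0_norm// mulr_ge0 ?expR_ge0// divr_ge0//; lra.
- by move=> y /=; rewrite in_itv/= andbT => y0; exact: hC.
Qed.

Lemma laplace_moment_bound k : exists2 C, 0 < C & forall s a, s ^+ 2 = 1 -> 1 <= a ->
  laplace_moment s a k <= C.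
Proof.
have [C C0 hC] := pow_laplace_bound k.
exists (C * 36); first by rewrite mulr_gt0.
move=> s a s2 a1.
have t0 : (0 : R) < 36^-1 by rewrite invr_gt0.
have -> : C * 36 = \int[mu]_(y in HL) (C * expR (- (36^-1 * y))).
  by rewrite Rintegral_HL_expRNM// invrK.
apply: le_Rintegral => //; first exact: integrable_laplace.
- apply: (@integrable_HL_le _ _ C 36^-1) => //.
    apply: measurable_funTS; apply: measurable_funM => //; exact: measurable_expRNM.
  by move=> x x0; rewrite ger0_norm// mulr_ge0 ?expR_ge0// ltW.
- move=> y /=; rewrite in_itv/= andbT => y0.
  by apply: le_trans (hC s a y s2 a1 y0); exact: ler_norm.
Qed.

Lemma laplace_moment_ge0 s a k : 0 <= a -> 0 <= laplace_moment s a k.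
Proof.
move=> a0; apply: Rintegral_ge0 => y /=; rewrite in_itv/= andbT => y0.
by rewrite mulr_ge0 ?exprn_ge0//; case/andP: (laplace_weight01 s y a0).
Qed.

End laplace_moments.

(** * Truncated gamma kernels *)

Section side_kernels.
Context {R : realType}.
Local Notation mu := (@lebesgue_measure R).
Local Notation HL := (`[0, +oo[%classic : set R).
Implicit Types a b c s u v y : R.

Lemma powR_mul1D z v a : 0 < z -> -1 < v ->
  (z * (1 + v)) `^ a = z `^ a * expR (a * ln (1 + v)).
Proof.
move=> z0 v1; have v0 : 0 < 1 + v by lra.
rewrite powRM ?ltW//; congr (_ * _).
by rewrite /powR gt_eqF.
Qed.

Lemma gamma_weightE z v a : 0 < z -> -1 < v ->
  (z * (1 + v)) `^ a * expR (- (a * (1 + v))) =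
  z `^ a * expR (- a) * expR (- (a * (v - ln (1 + v)))).
Proof.
move=> z0 v1; rewrite powR_mul1D// -!mulrA -!expRD; congr (_ * expR _); ring.
Qed.

(** Both incomplete gamma functions at once. The integrand [t^a exp(-t)] peaks at [t = a], the point
    of truncation; the substitution [t = a + s sqrt a y] factors out the peak value, and [D] becomes
    the part of the half-line where the weight is positive. *)
Lemma integral_gamma_side s a (D : set R) : s ^+ 2 = 1 -> 1 <= a -> measurable D ->
  (forall y, D (a + s * Num.sqrt a * y) <-> 0 <= y /\ -1 < s * y / Num.sqrt a) ->
  \int[mu]_(t in D) (t `^ (a + 1 - 1) * expR (- t)) =
  a `^ a * expR (- a) * Num.sqrt a * laplace_moment s a 0.
Proof.
move=> s2 a1 mD DP; have a0 : 0 < a by lra.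
have r0 : 0 < Num.sqrt a by rewrite sqrtr_gt0.
have r2 : Num.sqrt a ^+ 2 = a by rewrite sqr_sqrtr// ltW.
have ns : `|s| = 1 by apply/eqP; rewrite -sqr_norm_eq1 // s2.
have s0 : s != 0 by rewrite -normr_eq0 ns oner_neq0.
rewrite addrK Rintegral_mkcond.
pose g := (fun t : R => t `^ a * expR (- t)) \_ D.
have mg : measurable_fun setT g.
  have mf : measurable_fun setT (fun t : R => t `^ a * expR (- t)).
    apply: measurable_funM; first exact: measurable_powR.
    by apply: measurableT_comp => //; exact: measurableT_comp.
  by apply: (proj1 (measurable_restrictT _ mD)); exact: measurable_funTS.
have g0 t : 0 <= g t.
  by rewrite /g patchE; case: ifP => // _; rewrite mulr_ge0 ?powR_ge0 ?expR_ge0.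
have sr0 : s * Num.sqrt a != 0 by rewrite mulf_neq0// gt_eqF.
rewrite (Rintegral_affine a sr0 mg g0) normrM ns mul1r gtr0_norm//.
have -> : \int[mu]_y g (a + s * Num.sqrt a * y) =
    \int[mu]_(y in HL) (a `^ a * expR (- a) * (y ^+ 0 * laplace_weight s a y)).
  rewrite [RHS]Rintegral_mkcond; apply: eq_Rintegral => y _.
  have e1 : a + s * Num.sqrt a * y = a * (1 + s * y / Num.sqrt a).
    by rewrite -{1 3}r2; field; rewrite gt_eqF.
  rewrite /g !patchE; case: (boolP (_ \in D)) => [|/negP].
    rewrite inE => /DP[y0 v1]; rewrite mem_set; last by rewrite /= in_itv/= y0.
    by rewrite expr0 mul1r laplace_weightE// e1 gamma_weightE.
  rewrite inE => nD; case: (boolP (y \in HL)) => //.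
  rewrite inE/= in_itv/= andbT => y0.
  rewrite laplace_weight_eq0 ?mulr0// leNgt; apply/negP => v1; apply: nD.
  by apply/DP.
rewrite RintegralZl//; last exact: integrable_laplace.
by rewrite -/(laplace_moment s a 0); ring.
Qed.

Lemma upper_gammaE a : 1 <= a ->
  upper_gamma (a + 1) a = a `^ a * expR (- a) * Num.sqrt a * laplace_moment 1 a 0.
Proof.
move=> a1; have r0 : 0 < Num.sqrt a by rewrite sqrtr_gt0; lra.
rewrite /upper_gamma; apply: integral_gamma_side => //; first by rewrite expr1n.
move=> y; rewrite /= in_itv/= andbT !mul1r lerDl pmulr_rge0//; split=> [y0|[]//].
by split=> //; apply: lt_le_trans (_ : 0 <= _); rewrite ?divr_ge0// ?(ltW r0)//; lra.
Qed.

Lemma lower_gammaE a : 1 <= a ->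
  lower_gamma (a + 1) a = a `^ a * expR (- a) * Num.sqrt a * laplace_moment (-1) a 0.
Proof.
move=> a1; have a0 : 0 < a by lra.
have r0 : 0 < Num.sqrt a by rewrite sqrtr_gt0.
have r2 : Num.sqrt a ^+ 2 = a by rewrite sqr_sqrtr// ltW.
rewrite /lower_gamma; apply: integral_gamma_side => //; first by rewrite sqrrN expr1n.
move=> y; rewrite /= in_itv/= !mulN1r mulNr gerDl oppr_le0 pmulr_rge0//.
rewrite subr_gt0 mulNr ltrN2 ltr_pdivrMr// mul1r -{2}r2 expr2 ltr_pM2l//.
by split=> [/andP[]|[-> ->]].
Qed.

Variable c : R.
Hypothesis c0 : 0 < c.

Definition side_set s : set R := if s == 1 then `[c, +oo[%classic else `[0, c[%classic.

Definition side_scale b : R := Num.sqrt (b * c).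

(** The normalizing constant once the shape of the kernel is divided by its value at the mode [c];
    its inverse is therefore the height of the kernel. *)
Definition side_mass s b : R := side_scale b * laplace_moment s (c / b) 0.

(* Both truncated gamma kernels evaluated at [x = c], with [s = 1] for the right and [s = -1]
   for the left one. *)
Definition side_kernel s b u : R :=
  u `^ (c / b) * expR (- u / b) / (c `^ (c / b) * expR (- (c / b)) * side_mass s b) *
  \1_(side_set s) u.

Lemma side_kernel_norm b (J : R) : 0 < b ->
  b `^ (c / b + 1) * ((c / b) `^ (c / b) * expR (- (c / b)) * Num.sqrt (c / b) * J) =
  c `^ (c / b) * expR (- (c / b)) * (side_scale b * J).
Proof.
move=> b0; have cb0 : 0 < c / b by rewrite divr_gt0.
have bn : b != 0 by rewrite gt_eqF.
rewrite powRD ?bn ?implybT// powRr1 ?ltW//.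
have -> : c `^ (c / b) = b `^ (c / b) * (c / b) `^ (c / b).
  by rewrite -powRM ?ltW// (mulrC b) divfK.
have -> : side_scale b = b * Num.sqrt (c / b).
  rewrite /side_scale (_ : b * c = b ^+ 2 * (c / b)); last by field.
  by rewrite sqrtrM ?sqr_ge0// sqrtr_sqr gtr0_norm.
by ring.
Qed.

Lemma kernel_plusE b u : 0 < b -> b <= c -> kernel_plus c b c u = side_kernel 1 b u.
Proof.
move=> b0 bc; have a1 : 1 <= c / b by rewrite ler_pdivlMr// mul1r.
by rewrite /kernel_plus /side_kernel /side_set eqxx upper_gammaE// side_kernel_norm.
Qed.

Lemma kernel_minusE b u : 0 < b -> b <= c -> kernel_minus c b c u = side_kernel (-1) b u.
Proof.
move=> b0 bc; have a1 : 1 <= c / b by rewrite ler_pdivlMr// mul1r.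
rewrite /kernel_minus /side_kernel /side_set lower_gammaE// side_kernel_norm//.
by case: eqP => //; lra.
Qed.

Lemma side_scale_gt0 b : 0 < b -> 0 < side_scale b.
Proof. by move=> b0; rewrite sqrtr_gt0 mulr_gt0. Qed.

Lemma side_scale_sqr b : 0 < b -> side_scale b ^+ 2 = b * c.
Proof. by move=> b0; rewrite sqr_sqrtr// mulr_ge0// ltW. Qed.

Lemma side_mass_ge0 s b : 0 < b -> 0 <= side_mass s b.
Proof.
by move=> b0; rewrite mulr_ge0 ?laplace_moment_ge0 ?divr_ge0 ?ltW// side_scale_gt0.
Qed.

Lemma side_kernel_ge0 s b u : 0 < b -> 0 <= side_kernel s b u.
Proof.
move=> b0; apply: mulr_ge0; last by rewrite indicE.
apply: divr_ge0; first by rewrite mulr_ge0 ?powR_ge0 ?expR_ge0.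
by apply: mulr_ge0; [rewrite mulr_ge0 ?powR_ge0 ?expR_ge0|exact: side_mass_ge0].
Qed.

Lemma measurable_side_set s : measurable (side_set s).
Proof. by rewrite /side_set; case: ifP. Qed.

Lemma measurable_side_kernel s b : measurable_fun setT (side_kernel s b).
Proof.
apply: measurable_funM; last by apply: measurable_indic; exact: measurable_side_set.
apply: measurable_funM => //; apply: measurable_funM; first exact: measurable_powR.
by apply: measurableT_comp => //; apply: measurable_funM => //; exact: measurableT_comp.
Qed.

(** The point [y = 0] is left out because [c] belongs to the right set only: the left kernel
    vanishes there although the weight does not. *)
Lemma side_kernel_at s b y : s = 1 \/ s = -1 -> 0 < b -> y != 0 ->
  side_kernel s b (c + s * side_scale b * y) =
  laplace_weight s (c / b) y / side_mass s b * \1_HL y.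
Proof.
move=> s1 b0 y0.
have cb0 : 0 < c / b by rewrite divr_gt0.
set r := Num.sqrt (c / b); have r0 : 0 < r by rewrite sqrtr_gt0.
have r2 : r ^+ 2 = c / b by rewrite sqr_sqrtr// ltW.
have sc : side_scale b = c / r.
  apply/eqP; rewrite -(@eqrXn2 _ 2) ?divr_ge0 ?(ltW c0) ?(ltW r0) ?(ltW (side_scale_gt0 b0))//.
  by rewrite side_scale_sqr// expr_div_n r2; apply/eqP; field; rewrite !gt_eqF.
pose v := s * y / r.
have uE : c + s * side_scale b * y = c * (1 + v) by rewrite sc /v; ring.
rewrite uE /side_kernel.
have [v1|v1] := lerP v (-1).
  (* Here the argument [c (1 + v)] is at most 0. At 0 itself, a point of the left set, the kernel
     vanishes through its power; below 0 through its indicator. *)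
  rewrite laplace_weight_eq0// !mul0r; have [vE|vE] := eqVneq v (-1).
    by rewrite vE subrr mulr0 powR0 ?gt_eqF// !mul0r.
  rewrite indicE memNset ?mulr0// /side_set; have cv : c * (1 + v) < 0.
    by rewrite pmulr_rlt0//; move: vE v1; rewrite le_eqVlt => /negbTE ->/=; lra.
  by case: ifP => _ /=; rewrite in_itv/= => /andP[h _]; have := le_lt_trans h cv;
    rewrite ?ltxx// ltNge (ltW c0).
have v1' : 0 < 1 + v by lra.
have -> : - (c * (1 + v)) / b = - (c / b * (1 + v)) by ring.
rewrite gamma_weightE// laplace_weightE// -/r -/v.
have -> : \1_(side_set s) (c * (1 + v)) = \1_HL y :> R.
  rewrite !indicE; congr (_%:R); congr nat_of_bool; apply/idP/idP; rewrite !inE /side_set.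
    case: s1 => s1; rewrite s1 ?eqxx/=.
      rewrite in_itv/= andbT -[leLHS]mulr1 ler_pM2l// lerDl /v s1 mul1r.
      by rewrite in_itv/= pmulr_lge0 ?invr_gt0// => ->.
    case: eqP => [|_]; first lra.
    rewrite /= in_itv/= => /andP[_]; rewrite -[ltRHS]mulr1 ltr_pM2l// gtrDl /v s1 mulN1r mulNr oppr_lt0.
    by rewrite pmulr_lgt0 ?invr_gt0// in_itv/= andbT => /ltW.
  rewrite /= in_itv/= andbT => yge; have {yge} ygt : 0 < y by rewrite lt_neqAle eq_sym y0.
  case: s1 => s1; rewrite s1 ?eqxx/=.
    by rewrite in_itv/= andbT -[leLHS]mulr1 ler_pM2l// lerDl /v s1 mul1r divr_ge0// ltW.
  case: eqP => [|_]; first lra.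
  rewrite /= in_itv/=; apply/andP; split; first by rewrite mulr_ge0// ltW.
  by rewrite -[ltRHS]mulr1 ltr_pM2l// gtrDl /v s1 mulN1r mulNr oppr_lt0 divr_gt0.
have w0 : c `^ (c / b) * expR (- (c / b)) != 0.
  by rewrite mulf_neq0// gt_eqF ?powR_gt0 ?expR_gt0.
by rewrite -mulf_div divff// mul1r.
Qed.

End side_kernels.

(** * Height, integrals and products of the one-sided kernels *)

Section side_kernel_integrals.
Context {R : realType}.
Local Notation mu := (@lebesgue_measure R).
Local Notation HL := (`[0, +oo[%classic : set R).
Local Notation HLo := (`]0, +oo[%classic : set R).
Implicit Types s b u y : R.

Lemma Rintegral_eq_off0 (f g : R -> R) : measurable_fun setT f -> measurable_fun setT g ->
  (forall y, y != 0 -> f y = g y) -> \int[mu]_y f y = \int[mu]_y g y.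
Proof.
move=> mf mg fg; rewrite /Rintegral; congr fine.
have mfE : measurable_fun (setT : set (measurableTypeR R)) (EFin \o f) by exact/measurable_EFinP.
have mgE : measurable_fun (setT : set (measurableTypeR R)) (EFin \o g) by exact/measurable_EFinP.
apply: (@ae_eq_integral _ (measurableTypeR R) R mu setT (EFin \o g) (EFin \o f)) => //.
exists [set 0]; split; [by []|exact: lebesgue_measure_set1|].
move=> y /= h; apply/eqP/negP => /negP y0; apply: h => _ /=.
by rewrite fg.
Qed.

Variable c : R.
Hypothesis c0 : 0 < c.

Lemma side_kernel_le s b u : s = 1 \/ s = -1 -> 0 < b ->
  side_kernel c s b u <= (side_mass c s b)^-1.
Proof.
move=> s1 b0; have cb0 : 0 < c / b by rewrite divr_gt0.
have S0 := side_scale_gt0 c0 b0.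
have M0 := side_mass_ge0 c0 s b0.
have sn0 : s != 0 by case: s1 => ->; rewrite ?oppr_eq0 oner_eq0.
have [->|uc] := eqVneq u c.
  rewrite /side_kernel.
  have w0 : c `^ (c / b) * expR (- (c / b)) != 0.
    by rewrite mulf_neq0// gt_eqF ?powR_gt0 ?expR_gt0.
  rewrite mulNr -{1}(mulr1 (_ * expR _)) -mulf_div divff// !mul1r.
  by rewrite ler_piMr ?invr_ge0// indicE; case: (_ \in _).
pose y := (u - c) / (s * side_scale c b).
have sS : s * side_scale c b != 0 by rewrite mulf_neq0// gt_eqF.
have y0 : y != 0 by rewrite mulf_neq0 ?invr_eq0// subr_eq0.
have -> : u = c + s * side_scale c b * y by rewrite /y mulrC divfK// addrC subrK.
rewrite side_kernel_at// -[leRHS]mulr1 mulrAC [leLHS]mulrC ler_wpM2l ?invr_ge0//.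
have /andP[w0 w1] := laplace_weight01 s y (ltW cb0).
by rewrite indicE; case: (_ \in _); rewrite ?mulr1 ?mulr0.
Qed.

(** The Jacobian [side_scale] cancels the same factor in the mass. Integrating over the open
    half-line discards the exceptional point [y = 0]. *)
Lemma Rintegral_side_kernel s b (g : R -> R) : s = 1 \/ s = -1 -> 0 < b ->
  measurable_fun setT g -> (forall u, 0 <= g u) ->
  mu.-integrable HLo (EFin \o
    (fun y => laplace_weight s (c / b) y * g (c + s * side_scale c b * y))) ->
  \int[mu]_u (side_kernel c s b u * g u) =
  (laplace_moment s (c / b) 0)^-1 *
  \int[mu]_(y in HLo) (laplace_weight s (c / b) y * g (c + s * side_scale c b * y)).
Proof.
move=> s1 b0 mg g0 hint.
have S0 := side_scale_gt0 c0 b0.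
have sn0 : s != 0 by case: s1 => ->; rewrite ?oppr_eq0 oner_eq0.
have ns : `|s| = 1 by case: s1 => ->; rewrite ?normrN1 ?normr1.
have sS : s * side_scale c b != 0 by rewrite mulf_neq0// gt_eqF.
have mk := measurable_side_kernel c s b.
have mkg : measurable_fun setT (fun u => side_kernel c s b u * g u) by exact: measurable_funM.
have ma := @measurable_affine R c (s * side_scale c b).
rewrite (Rintegral_affine c sS mkg); last first.
  by move=> u; rewrite mulr_ge0 ?side_kernel_ge0.
rewrite normrM ns mul1r gtr0_norm//.
pose G y := (side_mass c s b)^-1 * (laplace_weight s (c / b) y * g (c + s * side_scale c b * y)).
have mG : measurable_fun setT G.
  apply: measurable_funM => //; apply: measurable_funM; first exact: measurable_laplace_weight.
  exact: (measurableT_comp mg ma).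
rewrite (@Rintegral_eq_off0 _ (G \_ HLo)); last 3 first.
- exact: (measurableT_comp mkg ma).
- by apply: (proj1 (measurable_restrictT _ _)) => //; exact: measurable_funTS.
- move=> y y0; rewrite side_kernel_at// patchE indicE.
  have -> : (y \in HLo) = (y \in HL).
    by apply/idP/idP; rewrite !inE /= !in_itv/= !andbT le_eqVlt eq_sym (negbTE y0).
  by case: (_ \in HL); rewrite ?mulr1 ?mulr0 ?mul0r// /G mulrC [_ / _]mulrC mulrCA mulrC -mulrA; ring.
rewrite -Rintegral_mkcond RintegralZl// mulrA; congr (_ * _).
by rewrite /side_mass invfM mulrA divff ?mul1r// gt_eqF.
Qed.

(* The exponents add up: [c / b + c / b' = c / b''] when [1 / b'' = 1 / b + 1 / b']. *)
Lemma side_kernelM s b b' u : 0 < b -> 0 < b' ->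
  side_mass c s b != 0 -> side_mass c s b' != 0 -> side_mass c s (b * b' / (b + b')) != 0 ->
  side_kernel c s b u * side_kernel c s b' u =
  side_mass c s (b * b' / (b + b')) / (side_mass c s b * side_mass c s b') *
  side_kernel c s (b * b' / (b + b')) u.
Proof.
move=> b0 b0' m0 m0' M0; set b2 := b * b' / (b + b') in M0 *.
have bb0 : 0 < b + b' by rewrite addr_gt0.
have b20 : 0 < b2 by rewrite divr_gt0// mulr_gt0.
have e : c / b2 = c / b + c / b' by rewrite /b2; field; rewrite !gt_eqF.
have e' : - u / b2 = - u / b + - u / b' by rewrite /b2; field; rewrite !gt_eqF.
have ca : c / b + c / b' != 0 by rewrite gt_eqF// addr_gt0// divr_gt0.
have pD x : x `^ (c / b + c / b') = x `^ (c / b) * x `^ (c / b').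
  by apply: powRD; rewrite (negbTE ca).
have eD x y : expR (x + y) = expR x * expR y := expRD x y.
rewrite /side_kernel e e' opprD !pD (eD (- u / b)) (eD (- (c / b))).
set i := \1_ _ u.
have ii : i * i = i by rewrite /i indicE; case: (_ \in _); rewrite ?mulr1 ?mulr0.
have A0 : c `^ (c / b) != 0 by rewrite gt_eqF ?powR_gt0.
have A0' : c `^ (c / b') != 0 by rewrite gt_eqF ?powR_gt0.
have E0 : expR (- (c / b)) != 0 by rewrite gt_eqF ?expR_gt0.
have E0' : expR (- (c / b')) != 0 by rewrite gt_eqF ?expR_gt0.
move: ii m0 m0' M0 A0 A0' E0 E0'; move: i => i.
move: (u `^ (c / b)) (u `^ (c / b')) (expR (- u / b)) (expR (- u / b'))
  (side_mass c s b) (side_mass c s b') (side_mass c s b2) (c `^ (c / b)) (c `^ (c / b'))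
  (expR (- (c / b))) (expR (- (c / b'))) => p p' q q' m m' m2 A A' E E' ii *.
rewrite mulrACA ii mulrA; congr (_ * i).
by field; do ?[apply/andP; split].
Qed.

End side_kernel_integrals.

(** * One-sided Taylor expansions *)

Section one_sided_taylor.
Context {R : realType}.
Implicit Types (g q : R -> R) (x y z c s k L : R).

Lemma cvg_at_right0 g k : (forall e, 0 < e -> exists2 d, 0 < d & forall x, 0 < x -> x < d -> `|g x - k| <= e) ->
  g x @[x --> 0^'+] --> k.
Proof.
move=> h; apply/cvgrPdist_le => e e0; have [d d0 hd] := h e e0.
near=> x; rewrite distrC; apply: hd; first by near: x; exact: nbhs_right_gt.
by near: x; exact: nbhs_right_lt.
Unshelve. all: by end_near.
Qed.

Lemma lipschitz_limit g k B y : 0 <= B -> g x @[x --> 0^'+] --> k -> 0 < y ->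
  (forall x, 0 < x -> x <= y -> `|g y - g x| <= B * (y - x)) -> `|g y - k| <= B * y.
Proof.
move=> B0 gk y0 h; apply/ler_addgt0Pr => e e0.
have /cvgrPdist_le/(_ _ e0) gk' := gk.
have [x [x0 xy gx]] : exists x, [/\ 0 < x, x <= y & `|k - g x| <= e].
  have F : ProperFilter (0 : R)^'+ by exact: at_right_proper_filter.
  apply: (@filter_ex _ _ F); near=> x; split.
  - by near: x; exact: nbhs_right_gt.
  - by near: x; exact: nbhs_right_le.
  - by near: x.
rewrite -(subrKA (g x)); apply: le_trans (ler_normD _ _) _.
rewrite lerD//; last by rewrite distrC.
apply: le_trans (h x x0 xy) _; rewrite ler_wpM2l//; lra.
Unshelve. all: by end_near.
Qed.

Lemma lipschitz_cvg g B z : 0 <= B -> 0 < z ->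
  (forall x y, 0 < x -> x <= y -> y <= z -> `|g y - g x| <= B * (y - x)) ->
  exists k : R, g x @[x --> 0^'+] --> k.
Proof.
move=> B0 z0 h.
have : cvg (g x @[x --> 0^'+]).
  apply/cauchy_cvgP/cauchy_exP => e e0.
  pose d := Num.min z (e / (B + 1) / 2).
  have d0 : 0 < d.
    by rewrite lt_min z0 !divr_gt0// ltr_wpDl.
  exists (g d); suff : \forall x \near 0^'+, ball (g d) e (g x) by [].
  near=> x.
  have x0 : 0 < x by near: x; exact: nbhs_right_gt.
  have xd : x <= d by near: x; exact: nbhs_right_le.
  rewrite /ball/=; apply: le_lt_trans (h x d x0 xd _) _; first by rewrite ge_min lexx.
  apply: (@le_lt_trans _ _ ((B + 1) * d)); first by rewrite ler_pM//; lra.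
  apply: (@le_lt_trans _ _ (e / 2)); last by lra.
  have -> : e / 2 = (B + 1) * (e / (B + 1) / 2) by field; rewrite gt_eqF//; lra.
  by rewrite ler_pM2l ?ge_min ?lexx ?orbT//; lra.
by move=> /cvg_ex[k hk]; exists k.
Unshelve. all: by end_near.
Qed.

(** The limit of the first derivative is not given; it is obtained here from a Lipschitz bound. The
    predicate [P] delimits the side of the point, and the remainder holds on all of it. *)
Lemma one_sided_taylor g g1 g2 (P : R -> Prop) (k0 k2 L r : R) :
  (exists2 z, 0 < z & P z) -> (forall y z, 0 < y -> y <= z -> P z -> P y) ->
  0 < L -> 0 < r ->
  (forall y : R, 0 < y -> P y -> is_derive y 1 g (g1 y)) ->
  (forall y : R, 0 < y -> P y -> is_derive y 1 g1 (g2 y)) ->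
  (forall y, 0 < y -> P y -> `|g2 y - k2| <= L * y `^ r) ->
  g x @[x --> 0^'+] --> k0 ->
  exists2 k1 : R, g1 x @[x --> 0^'+] --> k1 &
    forall y, 0 < y -> P y ->
      `|g y - (k0 + k1 * y + k2 / 2 * y ^+ 2)| <= L * y `^ (2 + r).
Proof.
move=> [z0 z00 Pz0] Pdown L0 r0 dg dg1 g2k gk0.
(* Removing the linear part leaves a function with derivative [g2 - k2], of size [L y^r]; it is
   Lipschitz, hence has a limit at 0. *)
pose q y := g1 y - k2 * y.
have powle z y : 0 < z -> z <= y -> z `^ r <= y `^ r.
  move=> z0' zy; apply: ge0_ler_powR => //; first exact: ltW.
    by rewrite nnegrE ltW.
  by rewrite nnegrE (le_trans _ zy)// ltW.
have qlip y x : 0 < x -> x <= y -> P y -> `|q y - q x| <= L * y `^ r * (y - x).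
  move=> x0 xy Py; apply: (@mvt_bound R q (fun y => g2 y - k2) x y) => //.
    move=> z /andP[xz zy]; have z0' : 0 < z := lt_le_trans x0 xz.
    have Pz := Pdown _ _ z0' zy Py.
    have := is_derive_sub (dg1 z z0' Pz) (is_derive_scale k2 (is_derive_id z (1 : R))).
    by rewrite mulr1.
  move=> z /andP[xz zy]; have z0' : 0 < z := lt_le_trans x0 xz.
  apply: le_trans (g2k z z0' (Pdown _ _ z0' zy Py)) _.
  by rewrite ler_pM2l// powle.
have LB y : 0 <= L * y `^ r by rewrite mulr_ge0 ?powR_ge0// ltW.
have [k1 qk1] : exists k : R, q x @[x --> 0^'+] --> k.
  apply: (@lipschitz_cvg q (L * z0 `^ r) z0) => // x y x0 xy yz.
  have y0 : 0 < y := lt_le_trans x0 xy.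
  apply: le_trans (qlip y x x0 xy (Pdown _ _ y0 yz Pz0)) _.
  by rewrite ler_wpM2r ?subr_ge0// ler_pM2l// powle.
have q1 y : 0 < y -> P y -> `|q y - k1| <= L * y `^ r * y.
  by move=> y0 Py; apply: lipschitz_limit => // x x0 xy; exact: qlip.
have yr y a : 0 < y -> y `^ a * y = y `^ (a + 1).
  move=> y0; rewrite powRD ?powRr1 ?(ltW y0)//; apply/implyP => _; by rewrite gt_eqF.
exists k1.
  have -> : g1 = (fun x => q x + k2 * x) by apply/funext => x; rewrite /q subrK.
  rewrite -[X in _ --> X](_ : k1 + k2 * 0 = k1); last by rewrite mulr0 addr0.
  apply: cvgD => //; apply: cvgMr; apply: cvg_at_right_filter; exact: cvg_id.
move=> y y0 Py.
(* The same step one order higher: the derivative of [p] is [q - k1], already bounded by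
   [L y^r y]. *)
pose p y := g y - k1 * y - k2 / 2 * y ^+ 2.
have pk0 : p x @[x --> 0^'+] --> k0.
  rewrite -[X in _ --> X](_ : k0 - k1 * 0 - k2 / 2 * 0 ^+ 2 = k0); last first.
    by rewrite expr0n/= !mulr0 !subr0.
  apply: cvgB; first apply: cvgB => //.
    by apply: cvgMr; apply: cvg_at_right_filter; exact: cvg_id.
  apply: cvgMr; apply: cvg_at_right_filter; exact: exprn_continuous.
have -> : g y - (k0 + k1 * y + k2 / 2 * y ^+ 2) = p y - k0 by rewrite /p; ring.
have -> : L * y `^ (2 + r) = L * y `^ r * y * y.
  rewrite -!mulrA [y `^ r * (_ * _)]mulrA !yr//; congr (_ * _ `^ _); ring.
apply: lipschitz_limit => //; first by rewrite mulr_ge0// ltW.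
move=> x x0 xy; apply: (@mvt_bound R p (fun y => g1 y - k1 - k2 * y) x y) => //.
  move=> z /andP[xz zy]; have z0' : 0 < z := lt_le_trans x0 xz.
  have Pz := Pdown _ _ z0' zy Py.
  have := is_derive_sub (is_derive_sub (dg z z0' Pz) (is_derive_scale k1 (is_derive_id z (1 : R))))
     (is_derive_scale (k2 / 2) (is_derive_pow 2 z)).
  by rewrite mulr1 expr1 mulrA divfK// pnatr_eq0.
move=> z /andP[xz zy]; have z0' : 0 < z := lt_le_trans x0 xz.
have -> : g1 z - k1 - k2 * z = q z - k1 by rewrite /q; ring.
apply: le_trans (q1 z z0' (Pdown _ _ z0' zy Py)) _.
rewrite -!mulrA ler_pM2l// ler_pM ?powR_ge0 ?(ltW z0')//.
by rewrite powle.
Qed.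

End one_sided_taylor.

Section side_taylor.
Context {R : realType}.
Implicit Types (f h : R -> R) (x y c s l : R).

Definition side_derivn f s j c : R :=
  if s == 1 then right_derivn f j c else left_derivn f j c.

Lemma near_right_ex c (P : R -> Prop) : (\forall x \near c^'+, P x) ->
  exists2 d, 0 < d & forall y, 0 < y -> y < d -> P (c + y).
Proof.
move=> /nbhs_ballP[e /= e0 he]; exists e => // y y0 ye; apply: he; last by rewrite ltrDl.
by rewrite /ball/= opprD addrA subrr sub0r normrN gtr0_norm.
Qed.

Lemma near_left_ex c (P : R -> Prop) : (\forall x \near c^'-, P x) ->
  exists2 d, 0 < d & forall y, 0 < y -> y < d -> P (c - y).
Proof.
move=> /nbhs_ballP[e /= e0 he]; exists e => // y y0 ye; apply: he; last by rewrite gtrBl.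
by rewrite /ball/= opprB addrC subrK gtr0_norm.
Qed.

Lemma cvg_right_shift h c l : h x @[x --> c^'+] --> l -> h (c + 1 * y) @[y --> 0^'+] --> l.
Proof.
move=> /cvgrPdist_le hl; apply: cvg_at_right0 => e e0.
have [d d0 hd] := near_right_ex (hl e e0).
by exists d => // x x0 xd; rewrite mul1r distrC; exact: hd.
Qed.

Lemma cvg_left_shift h c l : h x @[x --> c^'-] --> l -> h (c + -1 * y) @[y --> 0^'+] --> l.
Proof.
move=> /cvgrPdist_le hl; apply: cvg_at_right0 => e e0.
have [d d0 hd] := near_left_ex (hl e e0).
by exists d => // x x0 xd; rewrite mulN1r distrC; exact: hd.
Qed.

Lemma right_shift_cvg h c l : h (c + 1 * y) @[y --> 0^'+] --> l -> h x @[x --> c^'+] --> l.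
Proof.
move=> /cvgrPdist_le hl; apply/cvgrPdist_le => e e0.
have [d d0 hd] := near_right_ex (hl e e0).
near=> x; have -> : x = c + 1 * (0 + (x - c)) by ring.
apply: hd; first by rewrite subr_gt0; near: x; exact: nbhs_right_gt.
rewrite ltrBlDl; near: x; apply: nbhs_right_lt; by rewrite ltrDl.
Unshelve. all: by end_near.
Qed.

Lemma left_shift_cvg h c l : h (c + -1 * y) @[y --> 0^'+] --> l -> h x @[x --> c^'-] --> l.
Proof.
move=> /cvgrPdist_le hl; apply/cvgrPdist_le => e e0.
have [d d0 hd] := near_right_ex (hl e e0).
near=> x; have -> : x = c + -1 * (0 + (c - x)) by ring.
apply: hd; first by rewrite subr_gt0; near: x; exact: nbhs_left_lt.
rewrite ltrBlDr -ltrBlDl; near: x; apply: nbhs_left_gt; by rewrite gtrBl.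
Unshelve. all: by end_near.
Qed.

Lemma limit_bound h l a B y : h x @[x --> 0^'+] --> l -> 0 < y ->
  (forall x, 0 < x -> x < y -> `|a - h x| <= B) -> `|a - l| <= B.
Proof.
move=> hk y0 hB; apply/ler_addgt0Pr => e e0.
have /cvgrPdist_le/(_ _ e0) hk' := hk.
have [x [x0 xy gx]] : exists x, [/\ 0 < x, x < y & `|l - h x| <= e].
  have F : ProperFilter (0 : R)^'+ by exact: at_right_proper_filter.
  apply: (@filter_ex _ _ F); near=> x; split.
  - by near: x; exact: nbhs_right_gt.
  - by near: x; exact: nbhs_right_lt.
  - by near: x.
rewrite -(subrKA (h x)); apply: le_trans (ler_normD _ _) _.
by rewrite lerD ?hB// distrC.
Unshelve. all: by end_near.
Qed.

Lemma is_derive_affine h c s y dh : is_derive (c + s * y) 1 h dh ->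
  is_derive y 1 (fun z => h (c + s * z)) (s * dh).
Proof.
move=> hd; rewrite mulrC; apply: (@is_derive_comp _ h (fun z => c + s * z) y _ _ hd).
have := is_derive_add (is_derive_cst c y (1 : R)) (is_derive_scale s (is_derive_id y (1 : R))).
by rewrite add0r mulr1.
Qed.

(** The substitution [z = s (x - c)] reduces both sides to one expansion at the right of 0; the
    first derivative then carries the sign [s] and the second does not. *)
Lemma side_taylor f c : 0 < c -> smooth_off f c ->
  exists L r, [/\ 0 < L, 0 < r, r <= 1,
    (forall s, s = 1 \/ s = -1 -> 0 < side_derivn f s 0 c) &
    forall s y, s = 1 \/ s = -1 -> 0 < y -> (s = -1 -> y < c) ->
    `|f (c + s * y) - (side_derivn f s 0 c + s * side_derivn f s 1 c * y +
        side_derivn f s 2 c / 2 * y ^+ 2)| <= L * y `^ (2 + r)].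
Proof.
move=> c0 [diff [r [L [r0 r1 L0 hl hr]]] [cl cr] [fl fr] [c2l c2r]].
exists L, r; split => //.
  by move=> s [->|->]; rewrite /side_derivn ?eqxx//; case: eqP => // /eqP; rewrite eq_sym -subr_eq0 opprK gt_eqF.
have d2E x : 0 < x -> x != c -> second_deriv f c x = derive1n 2 f x.
  by move=> x0 xc; rewrite /second_deriv (negbTE xc) gt_eqF.
have dom s y : s = 1 \/ s = -1 -> 0 < y -> (s = -1 -> y < c) -> 0 < c + s * y /\ c + s * y != c.
  move=> s1 y0 ys; split; first by case: s1 => s1; [rewrite s1; lra|have := ys s1; rewrite s1; lra].
  have sn0 : s != 0 by case: s1 => ->; rewrite ?oppr_eq0 oner_eq0.
  by rewrite -subr_eq0 addrAC subrr add0r mulf_neq0// gt_eqF.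
have d1 (s y : R) : s = 1 \/ s = -1 -> 0 < y -> (s = -1 -> y < c) ->
    is_derive y 1 (fun z => f (c + s * z)) (s * derive1 f (c + s * y)).
  move=> s1 y0 ys; have [x0 xc] := dom s y s1 y0 ys.
  apply: is_derive_affine; rewrite derive1E; apply: derivableP.
  exact: (proj1 (diff _ x0 xc)).
have d2 (s y : R) : s = 1 \/ s = -1 -> 0 < y -> (s = -1 -> y < c) ->
    is_derive y 1 (fun z => s * derive1 f (c + s * z)) (derive1n 2 f (c + s * y)).
  move=> s1 y0 ys; have [x0 xc] := dom s y s1 y0 ys.
  have ss : s * s = 1 by case: s1 => ->; rewrite ?mulrNN mulr1.
  have := is_derive_scale s (@is_derive_affine (derive1 f) c s y (derive1 (derive1 f) (c + s * y)) _).
  rewrite mulrA ss mul1r; apply.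
  rewrite derive1E; apply: derivableP.
  exact: (proj2 (diff _ x0 xc)).
have f2 s y : s = 1 \/ s = -1 -> 0 < y -> (s = -1 -> y < c) ->
    `|derive1n 2 f (c + s * y) - side_derivn f s 2 c| <= L * y `^ r.
  move=> s1 y0 ys; have [x0 xc] := dom s y s1 y0 ys.
  case: s1 => s1.
    (* On the right [c] lies in the Hölder interval and the value assigned there is the right
       limit. *)
    have := hr (c + s * y) c.
    rewrite d2E// /second_deriv eqxx orbT s1 /side_derivn eqxx mul1r => h.
    apply: le_trans (h _ _) _; rewrite ?/= ?in_itv/= ?andbT ?lexx ?lerDl ?(ltW y0)//.
    by rewrite addrAC subrr add0r gtr0_norm.
  have yc := ys s1.
  rewrite /side_derivn ifN; last by rewrite s1 eq_sym -subr_eq0 opprK gt_eqF.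
  rewrite -/(left_derivn f 2 c) s1.
  (* On the left [c] is outside the interval, so the Hölder bound is passed to the limit from
     inside. *)
  have cv := cvg_left_shift c2l.
  apply: (limit_bound cv y0) => w w0 wy.
  have [x0' xc'] := dom (-1) w (or_intror erefl) w0 (fun _ => lt_trans wy yc).
  rewrite s1 in x0 xc; rewrite -!d2E//.
  have mem z : 0 < z -> z < c -> `[0, c[%classic (c + -1 * z).
    by move=> z0 zc; rewrite /= in_itv/=; apply/andP; split; lra.
  apply: le_trans (hl _ _ (mem _ y0 yc) (mem _ w0 (lt_trans wy yc))) _.
  rewrite ler_pM2l//; apply: ge0_ler_powR; rewrite ?nnegrE ?normr_ge0 ?(ltW y0) ?(ltW r0)//.
  have -> : c + -1 * y - (c + -1 * w) = - (y - w) by ring.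
  by rewrite normrN gtr0_norm ?subr_gt0//; lra.
move=> s y s1 y0 ys.
have [] := @one_sided_taylor R (fun z => f (c + s * z)) (fun z => s * derive1 f (c + s * z))
  (fun z => derive1n 2 f (c + s * z)) (fun y => s = -1 -> y < c)
  (side_derivn f s 0 c) (side_derivn f s 2 c) L r.
- by exists (c / 2); [lra|move=> _; lra].
- by move=> a b a0 ab hb /hb; lra.
- by [].
- by [].
- by move=> z z0 Pz; exact: d1.
- by move=> z z0 Pz; exact: d2.
- by move=> z z0 Pz; exact: f2.
- case: s1 => s1; rewrite s1 /side_derivn ?eqxx.
    by apply: cvg_right_shift; exact: cr.
  rewrite ifN; last by rewrite eq_sym -subr_eq0 opprK gt_eqF.
  by apply: cvg_left_shift; exact: cl.
move=> k1 hk1 tay.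
(* The limit produced by the expansion is identified with the one-sided first derivative of the
   statement. *)
have -> : s * side_derivn f s 1 c = k1.
  have ss : s * s = 1 by case: s1 => ->; rewrite ?mulrNN mulr1.
  have sk : derive1 f (c + s * z) @[z --> 0^'+] --> s * k1.
    have -> : (fun z => derive1 f (c + s * z)) = (fun z => s * (s * derive1 f (c + s * z))).
      by apply/funext => z; rewrite mulrA ss mul1r.
    exact: cvgMr.
  suff -> : side_derivn f s 1 c = s * k1 by rewrite mulrA ss mul1r.
  case: s1 sk => ->; rewrite /side_derivn ?eqxx => sk.
    by apply: cvg_lim => //; exact: right_shift_cvg.
  rewrite ifN; last by rewrite eq_sym -subr_eq0 opprK gt_eqF.
  by apply: cvg_lim => //; exact: left_shift_cvg.
exact: tay.
Qed.

End side_taylor.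

(** * Expansion of the kernel means *)

Section laplace_ratios.
Context {R : realType}.
Implicit Types s a x : R.

Local Notation g0 := (Num.sqrt (pi / 2) : R).

Lemma sqrt_pi2_gt0 : 0 < g0.
Proof. by rewrite sqrtr_gt0 divr_gt0// pi_gt0. Qed.

Lemma sqrt_pi2_sqr : g0 ^+ 2 = pi / 2.
Proof. by rewrite sqr_sqrtr// divr_ge0// pi_ge0. Qed.

Lemma le_sum4 (x y z t : R) : 0 <= x -> 0 <= y -> 0 <= z -> 0 <= t ->
  [/\ x <= x + y + z + t, y <= x + y + z + t, z <= x + y + z + t & t <= x + y + z + t].
Proof. by move=> *; split; lra. Qed.

(** With [x = 1 / sqrt a], the moments of order 0 and 1 are [g0 + (2/3) s x] and [1 + g0 s x] up to
    [O(x^2)]. Their quotient is [1 / g0 + s x (1 - 2 / (3 g0^2))], and [g0^2 = pi / 2] turns the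
    last factor into [1 - 4 / (3 pi)]. *)
Lemma laplace_ratios : exists K a0, [/\ 0 < K, 1 <= a0 &
  forall s a, s = 1 \/ s = -1 -> a0 <= a ->
  [/\ g0 / 2 <= laplace_moment s a 0,
      `|laplace_moment s a 0 - g0| <= K * (Num.sqrt a)^-1,
      `|laplace_moment s a 1 / laplace_moment s a 0 -
        (g0^-1 + s * (Num.sqrt a)^-1 * (1 - 4 / (3 * pi)))| <= K * (Num.sqrt a)^-1 ^+ 2,
      `|laplace_moment s a 2 / laplace_moment s a 0 - 1| <= K * (Num.sqrt a)^-1 &
      (laplace_moment s a 2 + laplace_moment s a 3) / laplace_moment s a 0 <= K]].
Proof.
have gg0 := sqrt_pi2_gt0; have gg2 := sqrt_pi2_sqr.
have p0 : 0 < pi :> R := pi_gt0 R.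
have [C0 C00 h0] := @laplace_moment_approx R 0.
have [C1 C10 h1] := @laplace_moment_approx R 1.
have [C2 C20 h2] := @laplace_moment_approx R 2.
have [D2 D20 d2] := @laplace_moment_bound R 2.
have [D3 D30 d3] := @laplace_moment_bound R 3.
have H0 : half_moment 0 = g0 :> R := half_moment0.
have H1 : half_moment 1 = 1 :> R := half_moment1.
have H2 : half_moment 2 = g0 :> R by rewrite half_momentSS H0 mul1r.
have H3 : half_moment 3 = 2 :> R by rewrite half_momentSS H1 mulr1.
have H4 : half_moment 4 = 3 * g0 :> R by rewrite half_momentSS H2.
have H5 : half_moment 5 = 8 :> R by rewrite half_momentSS H3 -natrM.
pose k := 1 - 4 / (3 * pi) : R.
pose K1 := 2 / g0 * (C1 + `|k| + C0 * (g0^-1 + `|k|)).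
pose K2 := 2 / g0 * (1 + C0 + 3 + C2).
pose K3 := 2 / g0 * (D2 + D3).
pose K0 := 1 + C0.
have K00 : 0 < K0 by rewrite addr_gt0.
have K10 : 0 <= K1.
  by rewrite mulr_ge0 ?divr_ge0 ?(ltW gg0)// !addr_ge0 ?mulr_ge0 ?addr_ge0 ?invr_ge0 ?(ltW gg0) ?(ltW C10) ?(ltW C00).
have K20 : 0 <= K2.
  by rewrite mulr_ge0 ?divr_ge0 ?(ltW gg0)// !addr_ge0 ?(ltW C20) ?(ltW C00).
have K30 : 0 <= K3.
  by rewrite mulr_ge0 ?divr_ge0 ?(ltW gg0)// !addr_ge0 ?(ltW D20) ?(ltW D30).
(* Beyond this threshold the error [K0 / sqrt a] is at most [g0 / 2], which keeps the denominator
   above [g0 / 2]. *)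
pose a0 := Num.max 1 ((2 * K0 / g0) ^+ 2).
exists (K0 + K1 + K2 + K3), a0; split.
- by rewrite -addrA -addrA ltr_pwDl// !addr_ge0.
- by rewrite le_max lexx.
have [KS0 KS1 KS2 KS3] : [/\ K0 <= K0 + K1 + K2 + K3, K1 <= K0 + K1 + K2 + K3,
    K2 <= K0 + K1 + K2 + K3 & K3 <= K0 + K1 + K2 + K3].
  exact: le_sum4 (ltW K00) K10 K20 K30.
move=> s a s1 aa0.
have s2 : s ^+ 2 = 1 by case: s1 => ->; rewrite ?sqrrN expr1n.
have ns : `|s| = 1 by case: s1 => ->; rewrite ?normrN normr1.
have a1 : 1 <= a by apply: le_trans aa0; rewrite le_max lexx.
have ap : 0 < a by lra.
have r1 : 1 <= Num.sqrt a by rewrite -sqrtr1 ler_wsqrtr.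
have r0 : 0 < Num.sqrt a by lra.
set x := (Num.sqrt a)^-1.
have x0 : 0 < x by rewrite invr_gt0.
have x1 : x <= 1 by rewrite invf_le1.
have x2 : x ^+ 2 = a^-1 by rewrite exprVn sqr_sqrtr// ltW.
have xs : K0 * x <= g0 / 2.
  have : 2 * K0 / g0 <= Num.sqrt a.
    have q0 : 0 <= 2 * K0 / g0 by rewrite divr_ge0 ?mulr_ge0 ?(ltW gg0) ?(ltW K00).
    rewrite -[leLHS]ger0_norm// -sqrtr_sqr ler_wsqrtr//.
    by apply: le_trans aa0; rewrite le_max lexx orbT.
  rewrite ler_pdivrMr// => h.
  rewrite /x ler_pdivrMr//; lra.
have xx : x ^+ 2 <= x by rewrite expr2 ler_piMr// ltW.
move: (h0 s a s2 a1) (h1 s a s2 a1) (h2 s a s2 a1) (d2 s a s2 a1) (d3 s a s2 a1).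
rewrite !addSn !add0n H0 H1 H2 H3 H4 H5.
have -> : s / (3 * Num.sqrt a) = s * x / 3 by rewrite /x; field; rewrite gt_eqF.
rewrite -!x2.
have m0p := laplace_moment_ge0 s 0 (ltW ap).
have m2p := laplace_moment_ge0 s 2 (ltW ap).
have m3p := laplace_moment_ge0 s 3 (ltW ap).
move: m0p m2p m3p.
set m0 := laplace_moment s a 0; set m1 := laplace_moment s a 1;
set m2 := laplace_moment s a 2; set m3 := laplace_moment s a 3.
move=> m0p m2p m3p {}h0 {}h1 {}h2 {}d2 {}d3.
have sx : `|s * x| = x by rewrite normrM ns mul1r gtr0_norm.
have [sx1 sx2] : - x <= s * x /\ s * x <= x by move: (lexx `|s * x|); rewrite {2}sx ler_norml => /andP[].
have m0g : `|m0 - g0| <= K0 * x.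
  move: h0; rewrite !ler_norml => /andP[? ?]; rewrite /K0.
  have : C0 * x ^+ 2 <= C0 * x by rewrite ler_pM2l.
  by move=> ?; apply/andP; split; lra.
have m0h : g0 / 2 <= m0 by move: m0g; rewrite ler_norml => /andP[? ?]; lra.
have m00 : 0 < m0 by apply: lt_le_trans m0h; rewrite divr_gt0.
have im0 : m0^-1 <= 2 / g0 by rewrite -[leRHS]invf_div lef_pV2// posrE divr_gt0.
have ratio (n e q B : R) : 0 <= e -> `|n - m0 * q| <= B * e -> `|n / m0 - q| <= 2 / g0 * B * e.
  move=> e0 hB; have -> : n / m0 - q = m0^-1 * (n - m0 * q) by field; rewrite gt_eqF.
  rewrite normrM ger0_norm ?invr_ge0// -mulrA ler_pM ?invr_ge0//.
split => //.
- by apply: le_trans m0g _; rewrite ler_pM2r.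
- apply: (@le_trans _ _ (K1 * x ^+ 2)).
    apply: ratio; first exact: sqr_ge0.
    have k3 : k = 1 - 2 / (3 * g0 ^+ 2).
      by rewrite gg2 /k; clear -p0; move: (pi) p0 => p p0; field; rewrite gt_eqF.
    pose e0 := m0 - (g0 + s * x / 3 * 2).
    pose e1 := m1 - (1 + s * x / 3 * (3 * g0)).
    have -> : m1 - m0 * (g0^-1 + s * x * (1 - 4 / (3 * pi))) =
      e1 - 2 / 3 * x ^+ 2 * k - e0 * (g0^-1 + s * x * k).
      rewrite -/k /e0 /e1 k3.
      have -> : 2 / 3 * x ^+ 2 * (1 - 2 / (3 * g0 ^+ 2)) =
        2 / 3 * (s ^+ 2 * x ^+ 2) * (1 - 2 / (3 * g0 ^+ 2)) by rewrite s2 mul1r.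
      by field; rewrite gt_eqF.
    apply: le_trans (ler_normB _ _) _; apply: le_trans (lerD (ler_normB _ _) (lexx _)) _.
    have q1 : `|2 / 3 * x ^+ 2 * k| <= `|k| * x ^+ 2.
      rewrite normrM mulrC ler_wpM2l// ger0_norm; last by rewrite mulr_ge0 ?sqr_ge0 ?divr_ge0.
      by rewrite ler_piMl ?sqr_ge0// ler_pdivrMr// mul1r ler_nat.
    have ig0 : 0 <= g0^-1 by rewrite invr_ge0 ltW.
    have q2 : `|e0 * (g0^-1 + s * x * k)| <= C0 * (g0^-1 + `|k|) * x ^+ 2.
      rewrite normrM [leRHS]mulrAC; apply: ler_pM => //.
      apply: le_trans (ler_normD _ _) _; rewrite (ger0_norm ig0) lerD2l.
      by rewrite normrM sx ler_piMl.
    by rewrite [leRHS]mulrDl; apply: lerD => //; rewrite [leRHS]mulrDl; apply: lerD.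
  by rewrite ler_wpM2r ?sqr_ge0.
- apply: (@le_trans _ _ (K2 * x)).
    apply: ratio; first exact: ltW.
    rewrite mulr1.
    have -> : m2 - m0 = (m2 - (g0 + s * x / 3 * 8)) + (s * x / 3 * 6) - (m0 - (g0 + s * x / 3 * 2)) by field.
    have c2 : C2 * x ^+ 2 <= C2 * x by rewrite ler_pM2l.
    have c0 : C0 * x ^+ 2 <= C0 * x by rewrite ler_pM2l.
    move: h0 h2; rewrite !ler_norml => /andP[? ?] /andP[? ?].
    by apply/andP; split; lra.
  by rewrite ler_pM2r.
- apply: (@le_trans _ _ K3) => //.
  rewrite mulrC /K3 ler_pM ?invr_ge0 ?addr_ge0//.
  exact: lerD.
Qed.

End laplace_ratios.

Section kernel_means.
Context {R : realType}.
Local Notation mu := (@lebesgue_measure R).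
Local Notation HL := (`[0, +oo[%classic : set R).
Local Notation HLo := (`]0, +oo[%classic : set R).
Local Notation g0 := (Num.sqrt (pi / 2) : R).
Variables (c : R) (f : R -> R) (L r : R) (F0 F1 F2 : R -> R).
Hypothesis c0 : 0 < c.
Hypothesis mf : measurable_fun setT f.
Hypothesis f_ge0 : forall u, 0 <= f u.
Hypothesis L0 : 0 < L.
Hypothesis r0 : 0 < r.
Hypothesis r1 : r <= 1.
Hypothesis tay : forall s y, s = 1 \/ s = -1 -> 0 < y -> (s = -1 -> y < c) ->
  `|f (c + s * y) - (F0 s + s * F1 s * y + F2 s / 2 * y ^+ 2)| <= L * y `^ (2 + r).

Definition kernel_mean s b : R := \int[mu]_u (side_kernel c s b u * f u).

Lemma side_scale_sqrt b : 0 < b -> side_scale c b * Num.sqrt (c / b) = c.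
Proof.
move=> b0; rewrite /side_scale -sqrtrM; last by rewrite mulr_ge0// ltW.
rewrite (_ : b * c * (c / b) = c ^+ 2); last by field; rewrite gt_eqF.
by rewrite sqrtr_sqr gtr0_norm.
Qed.

(** The fractional power in the remainder is traded for integer moments of the weight. *)
Lemma powR_le_cubic y : 0 <= y -> y `^ (2 + r) <= y ^+ 2 + y ^+ 3.
Proof.
move=> y0.
have p2 : y `^ 2 = y ^+ 2 by rewrite -powR_mulrn.
have p3 : y `^ 3 = y ^+ 3 by rewrite -powR_mulrn.
have [y1|y1] := lerP y 1.
  have [->|yn] := eqVneq y 0.
    by rewrite powR0 ?expr0n ?addr0//= gt_eqF// ltr_wpDr// ltW.
  apply: (@le_trans _ _ (y `^ 2)); last by rewrite p2 lerDl exprn_ge0.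
  apply: ger_powR; last by rewrite lerDl ltW.
  by rewrite y1 andbT lt_neqAle eq_sym yn.
apply: (@le_trans _ _ (y `^ 3)); last by rewrite p3 lerDr exprn_ge0.
apply: ler_powR; first exact: ltW.
by have h := r1; lra.
Qed.

Let intHLo (g : R -> R) : mu.-integrable HL (EFin \o g) -> mu.-integrable HLo (EFin \o g).
Proof. by apply: integrableS => // y /=; rewrite !in_itv/= !andbT => /ltW. Qed.

Let RintHLo (g : R -> R) : mu.-integrable HL (EFin \o g) ->
  \int[mu]_(y in HLo) g y = \int[mu]_(y in HL) g y.
Proof. by move=> ig; apply: Rintegral_itv_obnd_cbnd; exact: intHLo. Qed.

Let lap_taylor s b y : s = 1 \/ s = -1 -> 0 < b -> b <= c -> 0 < y ->
  `|laplace_weight s (c / b) y * f (c + s * side_scale c b * y) -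
    (F0 s * (y ^+ 0 * laplace_weight s (c / b) y) +
     s * F1 s * side_scale c b * (y ^+ 1 * laplace_weight s (c / b) y) +
     F2 s / 2 * side_scale c b ^+ 2 * (y ^+ 2 * laplace_weight s (c / b) y))| <=
  L * side_scale c b `^ (2 + r) *
    (y ^+ 2 * laplace_weight s (c / b) y + y ^+ 3 * laplace_weight s (c / b) y).
Proof.
move=> s1 b0 bc y0.
have cb0 : 0 < c / b by rewrite divr_gt0.
have S0 := side_scale_gt0 c0 b0.
set S := side_scale c b in S0 *; set w := laplace_weight _ _ _.
have /andP[w0 w1] : 0 <= w <= 1 := laplace_weight01 s y (ltW cb0).
have -> : w * f (c + s * S * y) - (F0 s * (y ^+ 0 * w) + s * F1 s * S * (y ^+ 1 * w) +
    F2 s / 2 * S ^+ 2 * (y ^+ 2 * w)) =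
   w * (f (c + s * (S * y)) - (F0 s + s * F1 s * (S * y) + F2 s / 2 * (S * y) ^+ 2)).
  by rewrite -(mulrA s S y); ring.
have -> : L * S `^ (2 + r) * (y ^+ 2 * w + y ^+ 3 * w) =
  w * (L * S `^ (2 + r) * (y ^+ 2 + y ^+ 3)) by ring.
rewrite normrM (ger0_norm w0).
have [wE|wn] := eqVneq w 0; first by rewrite wE !mul0r.
(* On the left the Taylor bound stops at the origin; beyond it the weight vanishes, because
   [side_scale] times [sqrt (c / b)] is [c]. *)
have dom : s = -1 -> S * y < c.
  move=> sE; rewrite ltNge; apply/negP => cS; move/eqP: wn; apply.
  apply: laplace_weight_eq0; rewrite sE mulN1r mulNr lerN2.
  by rewrite ler_pdivlMr ?sqrtr_gt0// mul1r -(ler_pM2l S0) side_scale_sqrt.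
have Sy0 : 0 < S * y by rewrite mulr_gt0.
apply: ler_wpM2l => //; apply: le_trans (tay s1 Sy0 dom) _.
rewrite powRM ?(ltW S0) ?(ltW y0)// mulrA; apply: ler_wpM2l.
  by rewrite mulr_ge0 ?powR_ge0// ltW.
exact: powR_le_cubic (ltW y0).
Qed.

Let lap_int s b k : s = 1 \/ s = -1 -> 0 < b -> b <= c ->
  mu.-integrable HL (EFin \o (fun y => y ^+ k * laplace_weight s (c / b) y)).
Proof.
move=> s1 b0 bc; apply: integrable_laplace; first by case: s1 => ->; rewrite ?sqrrN expr1n.
by rewrite ler_pdivlMr// mul1r.
Qed.

Lemma kernel_mean_laplace s b : s = 1 \/ s = -1 -> 0 < b -> b <= c ->
  0 < laplace_moment s (c / b) 0 ->
  `|kernel_mean s b -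
    (F0 s + s * F1 s * side_scale c b * (laplace_moment s (c / b) 1 / laplace_moment s (c / b) 0) +
     F2 s / 2 * (b * c) * (laplace_moment s (c / b) 2 / laplace_moment s (c / b) 0))| <=
  L * side_scale c b `^ (2 + r) *
   ((laplace_moment s (c / b) 2 + laplace_moment s (c / b) 3) / laplace_moment s (c / b) 0).
Proof.
move=> s1 b0 bc m00.
have cb0 : 0 < c / b by rewrite divr_gt0.
have mHLo : @measurable _ (measurableTypeR R) HLo by [].
pose w y := laplace_weight s (c / b) y.
pose S := side_scale c b.
have S0 : 0 < S := side_scale_gt0 c0 b0.
pose A y := w y * f (c + s * S * y).
pose B y := F0 s * (y ^+ 0 * w y) + s * F1 s * S * (y ^+ 1 * w y) + F2 s / 2 * S ^+ 2 * (y ^+ 2 * w y).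
pose D y := L * S `^ (2 + r) * (y ^+ 2 * w y + y ^+ 3 * w y).
have i k := intHLo (lap_int k s1 b0 bc).
have iB : mu.-integrable HLo (EFin \o B).
  apply: (integrable_add mHLo); first apply: (integrable_add mHLo); apply: integrable_scale => //; exact: i.
have iD : mu.-integrable HLo (EFin \o D).
  by apply: integrable_scale => //; apply: (integrable_add mHLo); exact: i.
have AB y : HLo y -> `|A y - B y| <= D y.
  by rewrite /= in_itv/= andbT => y0; exact: lap_taylor.
have mA : measurable_fun HLo A.
  apply: measurable_funTS; apply: measurable_funM; first exact: measurable_laplace_weight.
  exact: (measurableT_comp mf (measurable_affine c (s * S))).
(* Integrability of the weighted density comes from the Taylor bound itself, with [|B| + D] as
   majorant. *)
have iA : mu.-integrable HLo (EFin \o A).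
  have h : mu.-integrable HLo (EFin \o (fun y => `|B y| + D y)).
    apply: (integrable_add mHLo) => //; exact: (integrable_norm iB).
  apply: (integrable_le mHLo mA _ h) => y Hy.
  rewrite -(subrK (B y) (A y)); apply: le_trans (ler_normD _ _) _.
  by rewrite addrC lerD// AB.
have near := Rintegral_near mHLo iA iB iD AB.
rewrite /kernel_mean (Rintegral_side_kernel c0 s1 b0 mf f_ge0 iA) -/S.
set m0 := laplace_moment s (c / b) 0 in m00 *.
have Z k q : \int[mu]_(y in HLo) (q * (y ^+ k * w y)) = q * laplace_moment s (c / b) k.
  by rewrite (RintegralZl _ mHLo (i k)) (RintHLo (lap_int k s1 b0 bc)).
have EB : \int[mu]_(y in HLo) B y = F0 s * m0 + s * F1 s * S * laplace_moment s (c / b) 1 +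
    F2 s / 2 * S ^+ 2 * laplace_moment s (c / b) 2.
  rewrite /B RintegralD//; last by apply: integrable_scale => //; exact: i.
    rewrite RintegralD//; try by apply: integrable_scale => //; exact: i.
    by rewrite !Z.
  by apply: (integrable_add mHLo); apply: integrable_scale => //; exact: i.
have ED : \int[mu]_(y in HLo) D y = L * S `^ (2 + r) *
    (laplace_moment s (c / b) 2 + laplace_moment s (c / b) 3).
  rewrite /D RintegralZl//; last by apply: (integrable_add mHLo); exact: i.
  rewrite RintegralD//; try exact: i.
  by rewrite (RintHLo (lap_int 2 s1 b0 bc)) (RintHLo (lap_int 3 s1 b0 bc)).
move: near; rewrite EB ED -(side_scale_sqr c0 b0) -/S -[\int[mu]_(y in HLo) A y]/(\int[mu]_(y in HLo) A y).
set I := \int[mu]_(y in HLo) A y => near.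
have -> : m0^-1 * I - (F0 s + s * F1 s * S * (laplace_moment s (c / b) 1 / m0) +
   F2 s / 2 * S ^+ 2 * (laplace_moment s (c / b) 2 / m0)) =
   m0^-1 * (I - (F0 s * m0 + s * F1 s * S * laplace_moment s (c / b) 1 +
    F2 s / 2 * S ^+ 2 * laplace_moment s (c / b) 2)).
  by field; rewrite gt_eqF.
rewrite normrM ger0_norm ?invr_ge0 ?(ltW m00)// mulrA [leRHS]mulrC ler_wpM2l// invr_ge0 ltW//.
Qed.

End kernel_means.

Section kernel_mean_expansion.
Context {R : realType}.
Local Notation g0 := (Num.sqrt (pi / 2) : R).
Variables (c : R) (f : R -> R) (L r : R) (F0 F1 F2 : R -> R).
Hypothesis c0 : 0 < c.
Hypothesis mf : measurable_fun setT f.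
Hypothesis f_ge0 : forall u, 0 <= f u.
Hypothesis L0 : 0 < L.
Hypothesis r0 : 0 < r.
Hypothesis r1 : r <= 1.
Hypothesis tay : forall s y, s = 1 \/ s = -1 -> 0 < y -> (s = -1 -> y < c) ->
  `|f (c + s * y) - (F0 s + s * F1 s * y + F2 s / 2 * y ^+ 2)| <= L * y `^ (2 + r).

(** The first-order Taylor term contributes twice: [s F1 S / g0] at order [sqrt b], and, through the
    correction of the moment ratio, a term of order [b] whose sign is lost since [s^2 = 1]. *)
Lemma kernel_mean_expansion : exists K b0, [/\ 0 < K, 0 < b0, b0 <= c &
  forall s b, s = 1 \/ s = -1 -> 0 < b -> b <= b0 ->
  [/\ 0 < laplace_moment s (c / b) 0,
     `|laplace_moment s (c / b) 0 - g0| <= K * (Num.sqrt (c / b))^-1 &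
     `|kernel_mean c f s b - (F0 s + s * F1 s * (side_scale c b / g0) +
       (F1 s * (1 - 4 / (3 * pi)) + F2 s * c / 2) * b)| <=
     K * b * ((Num.sqrt (c / b))^-1 + side_scale c b `^ r)]].
Proof.
have [K [a0 [K0 a01 hK]]] := @laplace_ratios R.
have gg0 := @sqrt_pi2_gt0 R.
pose M := `|F1 1| + `|F1 (-1)| + `|F2 1| + `|F2 (-1)|.
have M0 : 0 <= M by rewrite !addr_ge0.
have FM s : s = 1 \/ s = -1 -> `|F1 s| <= M /\ `|F2 s| <= M.
  have ? := normr_ge0 (F1 1); have ? := normr_ge0 (F1 (-1)).
  have ? := normr_ge0 (F2 1); have ? := normr_ge0 (F2 (-1)).
  by case=> ->; split; rewrite /M; lra.
have ap : 0 < a0 by lra.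
exists (K * (1 + M + M * c + L * c)), (c / a0); split.
- rewrite mulr_gt0//; have : 0 <= M * c by rewrite mulr_ge0// ltW.
  have : 0 <= L * c by rewrite mulr_ge0 ?ltW//.
  lra.
- by rewrite divr_gt0.
- by rewrite ler_pdivrMr// ler_peMr// ltW.
move=> s b s1 b0 bb.
have aa0 : a0 <= c / b.
  by rewrite ler_pdivlMr// mulrC -ler_pdivlMr.
have bc : b <= c.
  by apply: le_trans bb _; rewrite ler_pdivrMr// ler_peMr// ltW.
have [h1 h2 h3 h4 h5] := hK s (c / b) s1 aa0.
have m00 : 0 < laplace_moment s (c / b) 0 by apply: lt_le_trans h1; rewrite divr_gt0.
have [FM1 FM2] := FM s s1.
have h := kernel_mean_laplace c0 mf f_ge0 L0 r0 r1 tay s1 b0 bc m00.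
have cb0 : 0 < c / b by rewrite divr_gt0.
have sr0 : 0 < Num.sqrt (c / b) by rewrite sqrtr_gt0.
have S0 := side_scale_gt0 c0 b0.
have SE := side_scale_sqrt c0 b0.
have S2 := side_scale_sqr c0 b0.
set x := (Num.sqrt (c / b))^-1 in h2 h3 h4 *.
have x0 : 0 < x by rewrite invr_gt0.
set S := side_scale c b in h S0 SE S2 *.
have Sx : S = c * x by rewrite -SE mulfK// gt_eqF.
(* [S = sqrt (b c)] times [x = sqrt (b / c)]: this is how products of the two small quantities
   become multiples of [b]. *)
have bE : b = S * x.
  apply: (@mulIf _ c); first by rewrite gt_eqF.
  by rewrite -S2 expr2 -mulrA [x * c]mulrC -Sx.
have Sr0 : 0 <= S `^ r by rewrite powR_ge0.
have Mc : 0 <= M * c by rewrite mulr_ge0// ltW.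
have Lc : 0 <= L * c by rewrite mulr_ge0 ?ltW.
have KM : K <= K * (1 + M + M * c + L * c) by rewrite ler_peMr ?(ltW K0)// -!addrA lerDl !addr_ge0.
split => //.
  by apply: le_trans h2 _; rewrite ler_pM2r.
move: h h2 h3 h4 h5.
set m1 := laplace_moment s (c / b) 1; set m2 := laplace_moment s (c / b) 2.
set m3 := laplace_moment s (c / b) 3; set m0 := laplace_moment s (c / b) 0 in m00 *.
set km := kernel_mean c f s b; set k := 1 - 4 / (3 * pi).
move=> h h2 h3 h4 h5.
have ns : `|s| = 1 by case: s1 => ->; rewrite ?normrN normr1.
have ss : s * s = 1 by case: s1 => ->; rewrite ?mulrNN mulr1.
have e1 : `|s * F1 s * S * (m1 / m0 - (g0^-1 + s * x * k))| <= K * M * b * x.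
  rewrite normrM normrM normrM ns mul1r (gtr0_norm S0).
  have -> : K * M * b * x = M * S * (K * x ^+ 2) by rewrite bE; ring.
  by rewrite ler_pM// ?mulr_ge0 ?(ltW S0)// ler_pM2r.
have e2 : `|F2 s / 2 * (b * c) * (m2 / m0 - 1)| <= K * (M * c) * b * x.
  have bc0 : 0 <= b * c by rewrite mulr_ge0 ?ltW.
  rewrite normrM normrM normrM (ger0_norm bc0) (ger0_norm (_ : 0 <= 2^-1)) ?invr_ge0//.
  have -> : K * (M * c) * b * x = M * (b * c) * (K * x) by ring.
  have i2 : 0 <= (2 : R)^-1 by rewrite invr_ge0.
  have A0 : 0 <= `|F2 s| * 2^-1 * (b * c) by apply: mulr_ge0 => //; exact: mulr_ge0.
  apply: ler_pM => //.
  by apply: ler_wpM2r => //; apply: le_trans FM2; rewrite ler_piMr// invf_le1// ler1n.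
have e3 : L * S `^ (2 + r) * ((m2 + m3) / m0) <= K * (L * c) * b * S `^ r.
  have -> : S `^ (2 + r) = S ^+ 2 * S `^ r.
    by rewrite powRD ?(gt_eqF S0) ?implybT// -powR_mulrn ?(ltW S0).
  rewrite S2.
  have -> : K * (L * c) * b * S `^ r = L * (b * c * S `^ r) * K by ring.
  by rewrite ler_wpM2l// !mulr_ge0 ?(ltW L0) ?(ltW b0) ?(ltW c0).
have -> : km - (F0 s + s * F1 s * (S / g0) + (F1 s * k + F2 s * c / 2) * b) =
  (km - (F0 s + s * F1 s * S * (m1 / m0) + F2 s / 2 * (b * c) * (m2 / m0))) +
  s * F1 s * S * (m1 / m0 - (g0^-1 + s * x * k)) +
  F2 s / 2 * (b * c) * (m2 / m0 - 1).
  have -> : (F1 s * k + F2 s * c / 2) * b = s * F1 s * S * (s * x * k) + F2 s / 2 * (b * c).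
    have -> : s * F1 s * S * (s * x * k) = s * s * (F1 s * k * (S * x)) by ring.
    by rewrite ss -bE; field.
  by move: (k) => k'; field; rewrite !gt_eqF.
apply: le_trans (ler_normD _ _) _; apply: le_trans (lerD (ler_normD _ _) (lexx _)) _.
apply: (@le_trans _ _ (K * (L * c) * b * S `^ r + K * M * b * x + K * (M * c) * b * x)).
  by rewrite lerD// lerD//; apply: le_trans h e3.
have -> : K * (1 + M + M * c + L * c) * b * (x + S `^ r) =
  (K * (L * c) * b * S `^ r + K * M * b * x + K * (M * c) * b * x) +
  K * b * ((1 + L * c) * x + (1 + M + M * c) * S `^ r) by ring.
have l1 : 0 <= 1 + L * c by rewrite addr_ge0.
have l2 : 0 <= 1 + M + M * c by rewrite !addr_ge0.
rewrite lerDl; apply: mulr_ge0; first by apply: mulr_ge0; apply: ltW.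
by apply: addr_ge0; apply: mulr_ge0 => //; exact: ltW.
Qed.

End kernel_mean_expansion.

(** * Kernel means and masses along a vanishing bandwidth *)

Section kernel_mean_sequences.
Context {R : realType}.
Local Notation g0 := (Num.sqrt (pi / 2) : R).

Lemma cvg_sqrt0 (u : nat -> R) : u n @[n --> \oo] --> (0 : R) ->
  Num.sqrt (u n) @[n --> \oo] --> (0 : R).
Proof.
move=> u0; have := @sqrt_continuous R 0; rewrite /continuous_at sqrtr0; exact: cvg_comp.
Qed.

Lemma cvg_powR0 (u : nat -> R) r : 0 < r -> (forall n, 0 < u n) ->
  u n @[n --> \oo] --> (0 : R) -> u n `^ r @[n --> \oo] --> (0 : R).
Proof.
move=> r0 up u0; apply/cvgrPdist_le => e e0.
have e1 : 0 < e `^ r^-1 by rewrite powR_gt0.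
have /cvgrPdist_le /(_ _ e1) := u0; apply: filterS => n.
rewrite !sub0r !normrN gtr0_norm// ger0_norm ?powR_ge0// => un.
have -> : e = (e `^ r^-1) `^ r by rewrite -powRrM mulVf ?gt_eqF// powRr1 ?ltW.
by apply: ge0_ler_powR un => //; rewrite ?nnegrE ltW.
Qed.

Lemma cvg0_le (u v : nat -> R) : (\forall n \near \oo, `|u n| <= v n) ->
  v n @[n --> \oo] --> (0 : R) -> u n @[n --> \oo] --> (0 : R).
Proof.
move=> uv v0; apply/cvgrPdist_le => e e0.
move/cvgrPdist_le : v0 => /(_ _ e0); apply: filterS2 uv => n h.
rewrite !sub0r !normrN; apply: le_trans; apply: le_trans h _; exact: ler_norm.
Qed.

Variables (c : R) (beta : nat -> R).
Hypothesis c0 : 0 < c.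
Hypothesis beta_gt0 : forall n, 0 < beta n.
Hypothesis beta_cvg : beta n @[n --> \oo] --> (0 : R).

Lemma side_scale_split b : 0 < b -> side_scale c b = Num.sqrt c * Num.sqrt b.
Proof. by move=> b0; rewrite /side_scale mulrC sqrtrM// ltW. Qed.

Lemma side_scale_g0 b : 0 < b -> side_scale c b / g0 = Num.sqrt (2 * c / pi) * Num.sqrt b.
Proof.
move=> b0; have p0 := @pi_gt0 R; rewrite side_scale_split//.
have -> : 2 * c / pi = c * (pi / 2)^-1 by rewrite invf_div; ring.
have p2 : 0 <= (pi : R) / 2 by rewrite divr_ge0// ltW.
by rewrite [in RHS]sqrtrM ?(ltW c0)// [in RHS]sqrtrV//; ring.
Qed.

Lemma side_scale_cvg : side_scale c (beta n) @[n --> \oo] --> (0 : R).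
Proof.
rewrite /side_scale; apply: cvg_sqrt0; rewrite -(mul0r c).
by apply: cvgM beta_cvg _; exact: cvg_cst.
Qed.

Lemma near_beta e : 0 < e -> \forall n \near \oo, beta n <= e.
Proof.
move=> e0; move/cvgrPdist_le : beta_cvg => /(_ _ e0); apply: filterS => n.
by rewrite sub0r normrN; apply: le_trans; exact: ler_norm.
Qed.

Lemma inv_sqrt_cvg : (Num.sqrt (c / beta n))^-1 @[n --> \oo] --> (0 : R).
Proof.
have -> : (fun n => (Num.sqrt (c / beta n))^-1) = (fun n => side_scale c (beta n) / c).
  apply/funext => n; have sr0 : 0 < Num.sqrt (c / beta n) by rewrite sqrtr_gt0 divr_gt0.
  have h := side_scale_sqrt c0 (beta_gt0 n).
  by apply: (mulIf (lt0r_neq0 c0)); rewrite divfK ?gt_eqF// -[X in _ * X]h mulrCA mulVf ?mulr1// gt_eqF.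
rewrite -(mul0r c^-1); apply: cvgM; [exact: side_scale_cvg|exact: cvg_cst].
Qed.

Variables (f : R -> R) (L r : R) (F0 F1 F2 : R -> R).
Hypothesis mf : measurable_fun setT f.
Hypothesis f_ge0 : forall u, 0 <= f u.
Hypothesis L0 : 0 < L.
Hypothesis r0 : 0 < r.
Hypothesis r1 : r <= 1.
Hypothesis tay : forall s y, s = 1 \/ s = -1 -> 0 < y -> (s = -1 -> y < c) ->
  `|f (c + s * y) - (F0 s + s * F1 s * y + F2 s / 2 * y ^+ 2)| <= L * y `^ (2 + r).

(** The mass behaves like [sqrt (pi c b / 2)], so the kernels have height of order [b^(-1/2)]; this
    fixes the rate [n sqrt b]. *)
Lemma side_mass_cvg s : s = 1 \/ s = -1 ->
  (\forall n \near \oo, 0 < side_mass c s (beta n)) /\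
  side_mass c s (beta n) / Num.sqrt (beta n) @[n --> \oo] --> Num.sqrt c * g0.
Proof.
move=> s1; have [K [b0 [K0 bp bc H]]] := kernel_mean_expansion c0 mf f_ge0 L0 r0 r1 tay.
split.
  have := near_beta bp; apply: filterS => n nb.
  have [m0 _ _] := H s (beta n) s1 (beta_gt0 n) nb.
  by rewrite mulr_gt0// side_scale_gt0.
have -> : (fun n => side_mass c s (beta n) / Num.sqrt (beta n)) =
    (fun n => Num.sqrt c * laplace_moment s (c / beta n) 0).
  apply/funext => n; rewrite /side_mass side_scale_split//.
  by field; rewrite gt_eqF// sqrtr_gt0.
apply: cvgM; first exact: cvg_cst.
apply/subr_cvg0; apply: (@cvg0_le _ (fun n => K * (Num.sqrt (c / beta n))^-1)).
  have := near_beta bp; apply: filterS => n nb.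
  by have [_ h _] := H s (beta n) s1 (beta_gt0 n) nb.
rewrite -(mulr0 K); apply: cvgM; [exact: cvg_cst|exact: inv_sqrt_cvg].
Qed.

Lemma kernel_mean_seq s : s = 1 \/ s = -1 ->
  (kernel_mean c f s (beta n) - (F0 s + s * F1 s * Num.sqrt (2 * c / pi) * Num.sqrt (beta n) +
     (F1 s * (1 - 4 / (3 * pi)) + F2 s * c / 2) * beta n)) / beta n @[n --> \oo] --> (0 : R).
Proof.
move=> s1; have [K [b0 [K0 bp bc H]]] := kernel_mean_expansion c0 mf f_ge0 L0 r0 r1 tay.
apply: (@cvg0_le _ (fun n => K * ((Num.sqrt (c / beta n))^-1 + side_scale c (beta n) `^ r))).
  have := near_beta bp; apply: filterS => n nb.
  have [_ _ h] := H s (beta n) s1 (beta_gt0 n) nb.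
  rewrite normrM normfV (gtr0_norm (beta_gt0 n)) ler_pdivrMr//.
  rewrite [leRHS]mulrAC; apply: le_trans h; rewrite side_scale_g0//.
  by rewrite -(mulrA (s * F1 s)).
rewrite -(mulr0 K); apply: cvgM; first exact: cvg_cst.
rewrite -(addr0 0); apply: cvgD; first exact: inv_sqrt_cvg.
apply: cvg_powR0 => //; last exact: side_scale_cvg.
by move=> n; exact: side_scale_gt0.
Qed.

Lemma kernel_mean_cvg s : s = 1 \/ s = -1 -> kernel_mean c f s (beta n) @[n --> \oo] --> F0 s.
Proof.
move=> s1; have := kernel_mean_seq s1.
set A := Num.sqrt (2 * c / pi); set k := F1 s * _ + _ => h.
have -> : (fun n => kernel_mean c f s (beta n)) = (fun n =>
   (kernel_mean c f s (beta n) - (F0 s + s * F1 s * A * Num.sqrt (beta n) + k * beta n)) / beta n * beta n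
   + (F0 s + s * F1 s * A * Num.sqrt (beta n) + k * beta n)).
  by apply/funext => n; rewrite divfK ?gt_eqF// subrK.
rewrite -[X in _ --> X]add0r; apply: cvgD.
  rewrite -(mul0r 0); apply: cvgM h beta_cvg.
rewrite -[X in _ --> X]addr0 -[X in _ --> X + _]addr0; apply: cvgD; first apply: cvgD; first exact: cvg_cst.
  rewrite -(mulr0 (s * F1 s * A)); apply: cvgM; [exact: cvg_cst|exact: cvg_sqrt0].
rewrite -(mulr0 k); apply: cvgM; [exact: cvg_cst|exact: beta_cvg].
Qed.

End kernel_mean_sequences.

(** * Delta method *)

Section delta_method.
Context {R : realType}.
Implicit Types (p q a x y A B e : R).

Lemma cvg_near_le (f : R -> R) a e : {for a, continuous f} -> 0 < e ->
  exists2 k, 0 < k & forall x, `|x - a| <= k -> `|f x - f a| <= e.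
Proof.
move=> ca e0; move/cvgrPdist_le : ca => /(_ _ e0) [k /= k0 H].
exists (k / 2) => [|x xa]; first by rewrite divr_gt0.
by rewrite distrC; apply: H => /=; rewrite distrC; lra.
Qed.

Lemma powR_prodE p q x y : 0 < x -> 0 < y -> x `^ p * y `^ q = expR (p * ln x + q * ln y).
Proof. by move=> x0 y0; rewrite /powR !gt_eqF// expRD. Qed.

(** With [B] frozen, the derivative in the first variable differs from [p] by [p (z^(p-1) B^q - 1)].
    As [p - 1 = - q], the power product is [exp(q (ln B - ln z))], close to 1 when both arguments
    are close to [a]. *)
Lemma powR_prod_strict_left p q a : 0 < a -> p + q = 1 -> forall e, 0 < e ->
  exists2 k, 0 < k < a & forall x y B, `|x - a| <= k -> `|y - a| <= k -> `|B - a| <= k ->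
    `|x `^ p * B `^ q - y `^ p * B `^ q - p * (x - y)| <= e * `|x - y|.
Proof.
move=> a0 pq e e0.
have p1 : 0 < `|p| + 1 by rewrite ltr_wpDl.
have q1 : 0 < `|q| + 1 by rewrite ltr_wpDl.
have [k1 k10 H1] := cvg_near_le (@continuous_expR R 0) (divr_gt0 e0 p1).
(* Each of the two logarithms receives half of the allowance; adding 1 to [|q|] keeps the
   denominator positive. *)
have k2p : 0 < k1 / (2 * (`|q| + 1)) by rewrite divr_gt0// mulr_gt0.
have [k2 k20 H2] := cvg_near_le (continuous_ln a0) k2p.
exists (Num.min k2 (a / 2)).
  by rewrite lt_min k20 divr_gt0//= gt_min; apply/orP; right; lra.
have main x y B : x <= y -> `|x - a| <= Num.min k2 (a / 2) -> `|y - a| <= Num.min k2 (a / 2) ->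
    `|B - a| <= Num.min k2 (a / 2) ->
    `|y `^ p * B `^ q - x `^ p * B `^ q - p * (y - x)| <= e * `|y - x|.
  move=> xy; rewrite !le_min => /andP[xa xa'] /andP[ya ya'] /andP[Ba Ba'].
  have B0 : 0 < B by move: Ba'; rewrite ler_distl => /andP[]; lra.
  pose g z := z `^ p * B `^ q - p * z.
  have -> : y `^ p * B `^ q - x `^ p * B `^ q - p * (y - x) = g y - g x by rewrite /g; ring.
  rewrite (ger0_norm (_ : 0 <= y - x)) ?subr_ge0//.
  apply: (@mvt_bound _ g (fun z => p * z `^ (p - 1) * B `^ q + z `^ p * 0 - p * 1)) => // z /andP[xz zy].
    have z0 : 0 < z by move: xa'; rewrite ler_distl => /andP[]; lra.
    exact: (is_derive_sub (is_derive_mul (is_derive1_powR p z0) (is_derive_cst _ _ _))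
      (is_derive_scale p (is_derive_id _ _))).
  have z0 : 0 < z by move: xa'; rewrite ler_distl => /andP[]; lra.
  have za : `|z - a| <= k2.
    rewrite ler_norml; move: xa ya; rewrite !ler_norml => /andP[? ?] /andP[? ?].
    by apply/andP; split; lra.
  have -> : p * z `^ (p - 1) * B `^ q + z `^ p * 0 - p * 1 = p * (z `^ (p - 1) * B `^ q - 1) by ring.
  rewrite powR_prodE// (_ : (p - 1) * ln z + q * ln B = q * ((ln B - ln a) - (ln z - ln a))); last first.
    have pE : p = 1 - q by lra.
    by rewrite pE; move: (ln _) (ln _) (ln _) => l1 l2 l3; ring.
  rewrite normrM; set h := q * _.
  have hk : `|h - 0| <= k1.
    rewrite subr0 normrM; have := ler_normB (ln B - ln a) (ln z - ln a) => h1.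
    have h2 := H2 _ za; have h3 := H2 _ Ba.
    apply: (@le_trans _ _ (`|q| * (k1 / (`|q| + 1)))).
      apply: ler_wpM2l => //; apply: le_trans h1 _.
      have -> : k1 / (`|q| + 1) = k1 / (2 * (`|q| + 1)) + k1 / (2 * (`|q| + 1)).
        by field; rewrite gt_eqF.
      exact: lerD.
    rewrite mulrCA ger_pMr// ler_pdivrMr// mul1r lerDl//.
  have := H1 _ hk; rewrite expR0 => h4.
  apply: (@le_trans _ _ (`|p| * (e / (`|p| + 1)))); first exact: ler_wpM2l.
  by rewrite mulrCA ger_pMr// ler_pdivrMr// mul1r lerDl.
move=> x y B xa ya Ba; have [xy|xy] := orP (le_total y x); first exact: main.
rewrite -normrN [in leRHS]distrC.
rewrite (_ : - (_ - _ - _) = y `^ p * B `^ q - x `^ p * B `^ q - p * (y - x)); last by ring.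
exact: main.
Qed.

(* The map [(A, B) |-> A^p B^q] is strictly differentiable at [(a, a)] with gradient [(p, q)]. *)
Lemma powR_prod_strict p q a : 0 < a -> p + q = 1 -> forall e, 0 < e ->
  exists2 k, 0 < k < a & forall A B A' B',
    `|A - a| <= k -> `|B - a| <= k -> `|A' - a| <= k -> `|B' - a| <= k ->
    `|A `^ p * B `^ q - A' `^ p * B' `^ q - (p * (A - A') + q * (B - B'))| <=
      e * (`|A - A'| + `|B - B'|).
Proof.
move=> a0 pq e e0.
have [k /andP[k0 ka] H] := powR_prod_strict_left a0 pq e0.
have qp : q + p = 1 by rewrite addrC.
have [k' /andP[k'0 k'a] H'] := powR_prod_strict_left a0 qp e0.
exists (Num.min k k'); first by rewrite lt_min k0 k'0 gt_min ka.
move=> A B A' B'; rewrite !le_min => /andP[h1 h1'] /andP[h2 h2'] /andP[h3 h3'] /andP[h4 h4'].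
have E1 := H A A' B h1 h3 h2; have E2 := H' B B' A' h2' h4' h3'.
rewrite [leRHS]mulrDr; apply: le_trans (lerD E1 E2); apply: le_trans (ler_normD _ _).
by rewrite le_eqVlt; apply/orP; left; apply/eqP; congr (`|_|); ring.
Qed.

(** Second-order expansion of [ln (1 + v)] at [v = M / F0 - 1], which has order [t]; the cubic error
    is negligible against [t^2]. *)
Lemma ln_expansion (t M : nat -> R) (F0 a k : R) : 0 < F0 -> (forall n, 0 < t n) ->
  t n @[n --> \oo] --> (0 : R) ->
  (M n - (F0 + a * t n + k * t n ^+ 2)) / t n ^+ 2 @[n --> \oo] --> (0 : R) ->
  (ln (M n) - (ln F0 + a / F0 * t n + (k / F0 - (a / F0) ^+ 2 / 2) * t n ^+ 2)) / t n ^+ 2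
    @[n --> \oo] --> (0 : R).
Proof.
move=> F00 t0 tc MC.
pose v n := M n / F0 - 1.
have Fn : F0 != 0 by rewrite gt_eqF.
have tn n : t n != 0 by rewrite gt_eqF.
have vt : v n / t n @[n --> \oo] --> a / F0.
  have -> : (fun n => v n / t n) = (fun n => F0^-1 *
     ((M n - (F0 + a * t n + k * t n ^+ 2)) / t n ^+ 2 * t n + a + k * t n)).
    by apply/funext => n; rewrite /v; field; rewrite Fn tn.
  rewrite mulrC; apply: cvgM; first exact: cvg_cst.
  rewrite -[X in _ --> X]addr0; apply: cvgD; last first.
    by rewrite -(mulr0 k); apply: cvgM; [exact: cvg_cst|].
  rewrite -[X in _ --> X]add0r; apply: cvgD; last exact: cvg_cst.
  by rewrite -(mulr0 0); apply: cvgM.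
have vc : v n @[n --> \oo] --> (0 : R).
  have -> : v = (fun n => v n / t n * t n) by apply/funext => n; rewrite divfK.
  by rewrite -(mulr0 (a / F0)); apply: cvgM.
pose r n := ln (M n) - ln F0 - (v n - v n ^+ 2 / 2).
have rc : r n / t n ^+ 2 @[n --> \oo] --> (0 : R).
  apply: (@cvg0_le _ _ (fun n => (v n / t n) ^+ 2 * `|v n|)); last first.
    rewrite -(mulr0 ((a / F0) ^+ 2)); apply: cvgM.
      rewrite expr2; under eq_fun do rewrite expr2; exact: cvgM.
    by rewrite -(@normr0 R R); exact: cvg_norm.
  have q0 : 0 < 1 / 4 :> R by lra.
  move/cvgrPdist_le : vc => /(_ _ q0); apply: filterS => n; rewrite sub0r normrN => vn.
  rewrite normrM normfV (ger0_norm (sqr_ge0 (t n))) expr_div_n mulrAC ler_pM2r ?invr_gt0 ?exprn_gt0//.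
  have v1 : 0 < 1 + v n by move: vn; rewrite ler_norml => /andP[]; lra.
  have -> : r n = (ln (1 + v n) - (v n - v n ^+ 2 / 2 + v n ^+ 3 / 3)) + v n ^+ 3 / 3.
    rewrite /r (_ : M n = F0 * (1 + v n)); last by rewrite /v; field.
    by rewrite lnM ?posrE//; ring.
  apply: le_trans (ler_normD _ _) _.
  apply: le_trans (lerD (ln_taylor vn) (lexx _)) _.
  rewrite normrM normrX (ger0_norm (_ : 0 <= 3^-1)) ?invr_ge0//.
  have w0 := normr_ge0 (v n); set w := `|v n| in w0 vn *.
  have w2 : w ^+ 2 = v n ^+ 2 by rewrite /w real_normK// num_real.
  rewrite (_ : v n ^+ 4 = w ^+ 4); last by rewrite (_ : 4%N = (2 * 2)%N)// !exprM w2.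
  rewrite -w2 (_ : w ^+ 2 * w = w ^+ 3); last by ring.
  rewrite (_ : w ^+ 4 = w ^+ 3 * w); last by ring.
  have w3 : 0 <= w ^+ 3 by rewrite exprn_ge0.
  have : w ^+ 3 * w <= w ^+ 3 * (1 / 4) by rewrite ler_wpM2l.
  lra.
have -> : (fun n => (ln (M n) - (ln F0 + a / F0 * t n + (k / F0 - (a / F0) ^+ 2 / 2) * t n ^+ 2)) / t n ^+ 2)
  = (fun n => F0^-1 * ((M n - (F0 + a * t n + k * t n ^+ 2)) / t n ^+ 2) +
    (- 2^-1) * ((v n / t n) ^+ 2 - (a / F0) ^+ 2) + r n / t n ^+ 2).
  apply/funext => n; rewrite /r /v; move: (ln _) (ln _) => l1 l2; field; by rewrite Fn tn.
rewrite -[X in _ --> X]addr0; apply: cvgD rc.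
rewrite -[X in _ --> X]addr0; apply: cvgD.
  by rewrite -(mulr0 F0^-1); apply: cvgM; [exact: cvg_cst|].
rewrite -(mulr0 (- 2^-1)); apply: cvgM; first exact: cvg_cst.
rewrite -(subrr ((a / F0) ^+ 2)); apply: cvgB; last exact: cvg_cst.
rewrite expr2; under eq_fun do rewrite expr2; exact: cvgM.
Qed.

Lemma expR_expansion (t h : nat -> R) (k : R) : (forall n, 0 < t n) ->
  t n @[n --> \oo] --> (0 : R) ->
  (h n - k * t n) / t n @[n --> \oo] --> (0 : R) ->
  (expR (h n) - 1 - k * t n) / t n @[n --> \oo] --> (0 : R).
Proof.
move=> t0 tc hc.
have tn n : t n != 0 by rewrite gt_eqF.
have ht : h n / t n @[n --> \oo] --> k.
  have -> : (fun n => h n / t n) = (fun n => (h n - k * t n) / t n + k).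
    by apply/funext => n; field.
  by rewrite -[X in _ --> X]add0r; apply: cvgD; [|exact: cvg_cst].
have h0 : h n @[n --> \oo] --> (0 : R).
  have -> : h = (fun n => h n / t n * t n) by apply/funext => n; rewrite divfK.
  by rewrite -(mulr0 k); apply: cvgM.
have -> : (fun n => (expR (h n) - 1 - k * t n) / t n) = (fun n => (expR (h n) - 1 - h n) / t n + (h n - k * t n) / t n).
  by apply/funext => n; rewrite -mulrDl; congr (_ / _); ring.
rewrite -[X in _ --> X]addr0; apply: cvgD hc.
apply: (@cvg0_le _ _ (fun n => expR 1 * (`|h n / t n| * `|h n|))); last first.
  rewrite -(mulr0 (expR 1)); apply: cvgM; first exact: cvg_cst.
  rewrite -(mulr0 `|k|) -[X in _ * X](@normr0 R R); apply: cvgM; exact: cvg_norm.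
have q0 : 0 < 1 :> R by [].
move/cvgrPdist_le : h0 => /(_ _ q0); apply: filterS => n; rewrite sub0r normrN => hn.
have -> : expR 1 * (`|h n / t n| * `|h n|) = h n ^+ 2 * expR 1 * `|(t n)^-1|.
  by rewrite normrM -(real_normK (num_real (h n))); ring.
rewrite normrM ler_wpM2r//; apply: le_trans (expR_taylor1 _) _.
by rewrite ler_wpM2l ?sqr_ge0// ler_expR.
Qed.

End delta_method.

Section bias_corrected_mean.
Context {R : realType}.

Lemma cvg0_near_eq (u v : nat -> R) : (\forall n \near \oo, u n = v n) ->
  v n @[n --> \oo] --> (0 : R) -> u n @[n --> \oo] --> (0 : R).
Proof.
move=> uv v0; apply: (@cvg0_le _ _ (fun n => `|v n|)).
  by apply: filterS uv => n ->.
by rewrite -(@normr0 R R); exact: cvg_norm.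
Qed.

Lemma cvg_of_expansion (t M : nat -> R) (F0 a k : R) : (forall n, 0 < t n) ->
  t n @[n --> \oo] --> (0 : R) ->
  (M n - (F0 + a * t n + k * t n ^+ 2)) / t n ^+ 2 @[n --> \oo] --> (0 : R) ->
  M n @[n --> \oo] --> F0.
Proof.
move=> t0 tc MC.
have -> : M = (fun n => (M n - (F0 + a * t n + k * t n ^+ 2)) / t n ^+ 2 * (t n * t n) +
    (F0 + a * t n + k * (t n * t n))).
  by apply/funext => n; field; rewrite gt_eqF.
have tt : t n * t n @[n --> \oo] --> (0 : R) by rewrite -(mulr0 0); exact: cvgM.
rewrite -[X in _ --> X]add0r; apply: cvgD; first by rewrite -(mulr0 0); exact: cvgM.
rewrite -[X in _ --> X]addr0; apply: cvgD; last first.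
  by rewrite -(mulr0 k); apply: cvgM => //; exact: cvg_cst.
rewrite -[X in _ --> X]addr0; apply: cvgD; first exact: cvg_cst.
by rewrite -(mulr0 a); apply: cvgM => //; exact: cvg_cst.
Qed.

Lemma near_pos (M : nat -> R) (F0 : R) : 0 < F0 -> M n @[n --> \oo] --> F0 ->
  \forall n \near \oo, 0 < M n.
Proof. by move=> F00 MF; exact: (cvgr_gt F0). Qed.

Variables (delta : R).
Hypothesis delta_gt0 : 0 < delta.
Hypothesis delta_lt1 : delta < 1.
Local Notation q := (Num.sqrt delta).

Lemma sqrt_delta01 : 0 < q < 1.
Proof. by rewrite sqrtr_gt0 delta_gt0 -sqrtr1 ltr_sqrt. Qed.

Lemma bias_corrected_exponents : 1 / (1 - q) + - q / (1 - q) = 1.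
Proof. by have /andP[q0 q1] := sqrt_delta01; field; rewrite gt_eqF// subr_gt0. Qed.

(** In logarithms the correction is linear. Its exponents [p], [p'] satisfy [p + p' = 1],
    [p + p' / q = 0] and [p + p' / q^2 = - 1 / q]: the limit is kept, the term in [t] cancels, and
    the coefficient of [t^2] is multiplied by [- 1 / q]. The square of [a] comes from the
    logarithm. *)
Lemma bias_corrected_expansion (t M M' : nat -> R) (F0 a k : R) : 0 < F0 ->
  (forall n, 0 < t n) -> t n @[n --> \oo] --> (0 : R) ->
  (M n - (F0 + a * t n + k * t n ^+ 2)) / t n ^+ 2 @[n --> \oo] --> (0 : R) ->
  (M' n - (F0 + a * (t n / q) + k * (t n / q) ^+ 2)) / (t n / q) ^+ 2 @[n --> \oo] --> (0 : R) ->
  (bias_corrected delta (M n) (M' n) - F0 -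
     q^-1 * (a ^+ 2 / (2 * F0) - k) * t n ^+ 2) / t n ^+ 2 @[n --> \oo] --> (0 : R).
Proof.
move=> F00 t0 tc h h'; have /andP[q0 q1] := sqrt_delta01.
have t'0 n : 0 < t n / q by rewrite divr_gt0.
have t'c : t n / q @[n --> \oo] --> (0 : R).
  by rewrite -(mul0r q^-1); apply: cvgM => //; exact: cvg_cst.
have l := ln_expansion F00 t0 tc h; have l' := ln_expansion F00 t'0 t'c h'.
have pos := near_pos F00 (cvg_of_expansion t0 tc h).
have pos' := near_pos F00 (cvg_of_expansion t'0 t'c h').
have q1' : 1 - q != 0 by rewrite gt_eqF// subr_gt0.
have qn : q != 0 by rewrite gt_eqF.
have tn n : t n != 0 by rewrite gt_eqF.
have Fn : F0 != 0 by rewrite gt_eqF.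
pose kap := k / F0 - (a / F0) ^+ 2 / 2.
pose H n := 1 / (1 - q) * (ln (M n) - ln F0) + - q / (1 - q) * (ln (M' n) - ln F0).
have t2 n : 0 < t n ^+ 2 by rewrite exprn_gt0.
have t2c : t n ^+ 2 @[n --> \oo] --> (0 : R).
  by rewrite -(mulr0 0); under eq_fun do rewrite expr2; exact: cvgM.
have HE : (H n - (- q^-1 * kap) * t n ^+ 2) / t n ^+ 2 @[n --> \oo] --> (0 : R).
  (* The second weight is the exponent [- q / (1 - q)] divided by [q^2], because the remainder of
     [M'] is measured against [(t / q)^2]. *)
  have -> : (fun n => (H n - (- q^-1 * kap) * t n ^+ 2) / t n ^+ 2) = (fun n =>
    1 / (1 - q) * ((ln (M n) - (ln F0 + a / F0 * t n + kap * t n ^+ 2)) / t n ^+ 2) +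
    - q^-1 / (1 - q) * ((ln (M' n) - (ln F0 + a / F0 * (t n / q) + kap * (t n / q) ^+ 2)) / (t n / q) ^+ 2)).
    apply/funext => n; rewrite /H; move: (ln _) (ln _) (ln _) kap => l1 l2 l3 kap.
    by field; rewrite qn Fn tn q1'.
  rewrite -(addr0 0); apply: cvgD.
    by rewrite -(mulr0 (1 / (1 - q))); apply: cvgM => //; exact: cvg_cst.
  by rewrite -(mulr0 (- q^-1 / (1 - q))); apply: cvgM => //; exact: cvg_cst.
have E := expR_expansion t2 t2c HE.
apply: (@cvg0_near_eq _ (fun n => F0 * ((expR (H n) - 1 - - q^-1 * kap * t n ^+ 2) / t n ^+ 2))); last first.
  by rewrite -(mulr0 F0); apply: cvgM => //; exact: cvg_cst.
apply: filterS2 pos pos' => n p p'.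
rewrite /bias_corrected powR_prodE//.
have -> : 1 / (1 - q) * ln (M n) + - q / (1 - q) * ln (M' n) = ln F0 + H n.
  have e : ln F0 = (1 / (1 - q) + - q / (1 - q)) * ln F0.
    by rewrite bias_corrected_exponents mul1r.
  rewrite /H [X in _ = X + _]e; move: (ln _) (ln _) (ln _) => l1 l2 l3; ring.
rewrite expRD lnK ?posrE// /kap; move: (expR _) => e.
by field; rewrite qn Fn tn.
Qed.

End bias_corrected_mean.

(** * Variance of the linearized statistic *)

Section sample_expectations.
Context {d : measure_display} {T : measurableType d} {R : realType}.
Variable P : probability T R.
Variable X : nat -> {RV P >-> R}.
Variable f : R -> R.
Hypothesis densX : forall k, has_density (X k) f.
Local Notation mu := (@lebesgue_measure R).

Lemma density_expectation k (h : R -> R) : measurable_fun setT h -> (forall u, 0 <= h u) ->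
  \int[P]_w h (X k w) = \int[mu]_u (h u * f u).
Proof.
move=> mh h0; have [mf f0 fP] := densX k.
rewrite /Rintegral; congr fine.
have mhE : measurable_fun (setT : set (measurableTypeR R)) (EFin \o h) by exact/measurable_EFinP.
have hE0 u : (0 <= (EFin \o h) u)%E by rewrite lee_fin.
(* [lebesgue_measure] lives on [measurableTypeR R] rather than on the Borel structure of [R]. *)
have mX : measurable_fun setT (X k : T -> measurableTypeR R) := measurable_funP (X k).
pose X' : {mfun T >-> measurableTypeR R} :=
  HB.pack (X k : T -> measurableTypeR R) (isMeasurableFun.Build _ _ _ _ _ mX).
rewrite -[LHS]/(\int[P]_w ((EFin \o h) \o X') w)%E -(ge0_integral_distribution X' mhE hE0).
exact: (@integral_density _ (measurableTypeR R) R mu (distribution P X') f _ mf f0 fP mhE hE0).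
Qed.

Lemma bounded_expectation k (h : R -> R) (M : R) : measurable_fun setT h ->
  (forall u, `|h u| <= M) -> P.-integrable setT (EFin \o (fun w => h (X k w))).
Proof.
move=> mh hM; apply: (@prob_integrable _ _ _ P _ M) => //.
exact: measurableT_comp.
Qed.

(** The common density is reached through nonnegative functions, so [h] is shifted up by [M] and the
    constant removed afterwards. *)
Lemma expectation_same k (h : R -> R) (M : R) : measurable_fun setT h -> (forall u, `|h u| <= M) ->
  \int[P]_w h (X k w) = \int[P]_w h (X 0%N w).
Proof.
move=> mh hM.
have mhM : measurable_fun setT (fun u => h u + M) by exact: measurable_funD.
have hM0 u : 0 <= h u + M by have := hM u; rewrite ler_norml => /andP[? _]; lra.
have e j : \int[P]_w h (X j w) = \int[mu]_u ((h u + M) * f u) - M.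
  have <- := density_expectation j mhM hM0.
  have iM : P.-integrable setT (EFin \o (fun _ : T => M)).
    by apply: (@prob_integrable _ _ _ P _ `|M|).
  by rewrite RintegralD ?Rintegral_prob_cst ?addrK//; exact: bounded_expectation mh hM.
by rewrite !e.
Qed.

Section centered.
Variables (g : R -> R) (M a : R).
Hypothesis mg : measurable_fun setT g.
Hypothesis gM : forall u, `|g u| <= M.
Let m := \int[P]_w g (X 0%N w).

Definition centered u : R := a * (g u - m).

Lemma measurable_centered : measurable_fun setT centered.
Proof. by apply: measurable_funM => //; exact: measurable_funB. Qed.

Lemma expectation_bound : `|m| <= M.
Proof.
rewrite -[m]subr0; apply: Rintegral_prob_near; first exact: bounded_expectation mg gM.
by move=> w; rewrite subr0.
Qed.

Lemma centered_le u : `|centered u| <= `|a| * (M + M).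
Proof.
rewrite normrM ler_wpM2l//; apply: le_trans (ler_normB _ _) _.
by apply: lerD; [exact: gM|exact: expectation_bound].
Qed.

Let icst (r : R) : P.-integrable setT (EFin \o (fun _ : T => r)).
Proof. by apply: (@prob_integrable _ _ _ P _ `|r|). Qed.

Lemma centered_mean k : \int[P]_v centered (X k v) = 0.
Proof.
have ig := bounded_expectation k mg gM.
rewrite /centered RintegralZl//; last exact: (integrable_sub measurableT ig (icst m)).
rewrite RintegralB// Rintegral_prob_cst (expectation_same k mg gM) -/m.
by rewrite subrr mulr0.
Qed.

Lemma centered_second k :
  \int[P]_v (centered (X k v) ^+ 2) = a ^+ 2 * (\int[P]_w (g (X 0%N w) ^+ 2) - m ^+ 2).
Proof.
have ig := bounded_expectation k mg gM.
have mg2 : measurable_fun setT (fun u => g u ^+ 2) by exact: measurable_funX.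
have g2M u : `|g u ^+ 2| <= M ^+ 2.
  by rewrite normrX lerXn2r// nnegrE (le_trans _ (gM u)).
have ig2 := bounded_expectation k mg2 g2M.
have -> : \int[P]_v (centered (X k v) ^+ 2) =
    \int[P]_v (a ^+ 2 * g (X k v) ^+ 2 + (- (2 * a ^+ 2 * m)) * g (X k v) + a ^+ 2 * m ^+ 2).
  by apply: eq_Rintegral => w _; rewrite /centered; ring.
have i1 := integrable_scale measurableT (a ^+ 2) ig2.
have i2 := integrable_scale measurableT (- (2 * a ^+ 2 * m)) ig.
rewrite RintegralD//; last exact: integrable_add.
rewrite RintegralD// !RintegralZl// Rintegral_prob_cst.
rewrite (expectation_same k mg gM) -/m (expectation_same k mg2 g2M); ring.
Qed.

End centered.

Section kernel_expectations.
Variable c : R.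
Hypothesis c0 : 0 < c.

Lemma side_kernel_norm_le s b u : s = 1 \/ s = -1 -> 0 < b ->
  `|side_kernel c s b u| <= (side_mass c s b)^-1.
Proof. by move=> s1 b0; rewrite ger0_norm ?side_kernel_ge0//; exact: side_kernel_le. Qed.

Lemma side_kernel_expectation s b k : 0 < b ->
  \int[P]_w side_kernel c s b (X k w) = kernel_mean c f s b.
Proof.
move=> b0; apply: density_expectation; first exact: measurable_side_kernel.
by move=> u; exact: side_kernel_ge0.
Qed.

Lemma side_kernelM_expectation s b b' k : s = 1 \/ s = -1 -> 0 < b -> 0 < b' ->
  side_mass c s b != 0 -> side_mass c s b' != 0 -> side_mass c s (b * b' / (b + b')) != 0 ->
  \int[P]_w (side_kernel c s b (X k w) * side_kernel c s b' (X k w)) =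
  side_mass c s (b * b' / (b + b')) / (side_mass c s b * side_mass c s b') *
    kernel_mean c f s (b * b' / (b + b')).
Proof.
move=> s1 b0 b0' m m' m''.
have b''0 : 0 < b * b' / (b + b') by rewrite divr_gt0 ?mulr_gt0// addr_gt0.
under eq_Rintegral do rewrite side_kernelM//.
rewrite RintegralZl ?side_kernel_expectation//.
apply: (@bounded_expectation k _ ((side_mass c s (b * b' / (b + b')))^-1)).
  exact: measurable_side_kernel.
by move=> u; exact: side_kernel_norm_le.
Qed.

Lemma side_set_disjoint u : \1_(side_set c 1) u * \1_(side_set c (-1)) u = 0 :> R.
Proof.
have -> : side_set c 1 = `[c, +oo[%classic by rewrite /side_set eqxx.
have -> : side_set c (-1) = `[0, c[%classic by rewrite /side_set ifF//; apply/negbTE/eqP => h; lra.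
rewrite !indicE; have [cu|uc] := lerP c u.
  by rewrite (@memNset _ `[0, c[%classic) ?mulr0//= in_itv/= => /andP[_]; rewrite ltNge cu.
by rewrite (@memNset _ `[c, +oo[%classic) ?mul0r//= in_itv/= andbT leNgt uc.
Qed.

Lemma side_kernel_disjoint b b' u : side_kernel c 1 b u * side_kernel c (-1) b' u = 0.
Proof. by rewrite /side_kernel mulrACA side_set_disjoint mulr0. Qed.

End kernel_expectations.

End sample_expectations.

Section kernel_covariances.
Context {d : measure_display} {T : measurableType d} {R : realType}.
Variable P : probability T R.
Variable X : nat -> {RV P >-> R}.
Local Notation g0 := (Num.sqrt (pi / 2) : R).
Variables (c : R) (f : R -> R) (L r : R) (F0 F1 F2 : R -> R).
Hypothesis densX : forall k, has_density (X k) f.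
Hypothesis c0 : 0 < c.
Hypothesis mf : measurable_fun setT f.
Hypothesis f_ge0 : forall u, 0 <= f u.
Hypothesis L0 : 0 < L.
Hypothesis r0 : 0 < r.
Hypothesis r1 : r <= 1.
Hypothesis tay : forall s y, s = 1 \/ s = -1 -> 0 < y -> (s = -1 -> y < c) ->
  `|f (c + s * y) - (F0 s + s * F1 s * y + F2 s / 2 * y ^+ 2)| <= L * y `^ (2 + r).
Variable b : nat -> R.
Hypothesis b_gt0 : forall n, 0 < b n.
Hypothesis b_cvg : b n @[n --> \oo] --> (0 : R).

Lemma cvg_near_eq (u v : nat -> R) (l : R) : (\forall n \near \oo, u n = v n) ->
  v n @[n --> \oo] --> l -> u n @[n --> \oo] --> l.
Proof.
move=> uv vl; apply/subr_cvg0; apply: (@cvg0_near_eq _ _ (fun n => v n - l)).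
  by apply: filterS uv => n ->.
exact/subr_cvg0.
Qed.

Lemma cvg_scale0 (x : R) : x * b n @[n --> \oo] --> (0 : R).
Proof. by rewrite -(mulr0 x); apply: cvgM => //; exact: cvg_cst. Qed.

(** The product kernel has bandwidth [z b] with [z = x y / (x + y)]. The mass ratio is asymptotic to
    [sqrt (z b)] over [sqrt c g0 sqrt (x b) sqrt (y b)], and [z (x + y) = x y] reduces the roots to
    [1 / sqrt ((x + y) b)]. *)
Lemma kernel_covariance_cvg s x y (beta beta' : nat -> R) : s = 1 \/ s = -1 -> 0 < x -> 0 < y ->
  (forall n, beta n = x * b n) -> (forall n, beta' n = y * b n) ->
  Num.sqrt (b n) *
    \int[P]_w (side_kernel c s (beta n) (X 0%N w) * side_kernel c s (beta' n) (X 0%N w))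
    @[n --> \oo] --> F0 s / (Num.sqrt c * g0 * Num.sqrt (x + y)).
Proof.
move=> s1 x0 y0 bx by'.
have xy0 : 0 < x + y by rewrite addr_gt0.
pose z := x * y / (x + y); have z0 : 0 < z by rewrite divr_gt0// mulr_gt0.
pose m t n := side_mass c s (t * b n).
have tb t n : 0 < t -> 0 < t * b n by move=> t0; rewrite mulr_gt0.
have mcvg t : 0 < t -> (\forall n \near \oo, 0 < m t n) /\
    m t n / Num.sqrt (t * b n) @[n --> \oo] --> Num.sqrt c * g0.
  move=> t0; apply: (side_mass_cvg c0 _ (cvg_scale0 t) mf f_ge0 L0 r0 r1 tay s1) => n.
  exact: tb.
have [mx mxc] := mcvg _ x0; have [my myc] := mcvg _ y0; have [mz mzc] := mcvg _ z0.
have zc : kernel_mean c f s (z * b n) @[n --> \oo] --> F0 s.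
  by apply: (kernel_mean_cvg c0 _ (cvg_scale0 z) mf f_ge0 L0 r0 r1 tay s1) => n; exact: tb.
have A0 : 0 < Num.sqrt c * g0 by apply: mulr_gt0; [rewrite sqrtr_gt0|exact: sqrt_pi2_gt0].
apply: (@cvg_near_eq _ (fun n => (m z n / Num.sqrt (z * b n)) /
   ((m x n / Num.sqrt (x * b n)) * (m y n / Num.sqrt (y * b n))) *
   kernel_mean c f s (z * b n) * (Num.sqrt (x + y))^-1)); last first.
  have -> : F0 s / (Num.sqrt c * g0 * Num.sqrt (x + y)) =
      Num.sqrt c * g0 / (Num.sqrt c * g0 * (Num.sqrt c * g0)) * F0 s * (Num.sqrt (x + y))^-1.
    by move: (Num.sqrt c * g0) A0 => A A0; field; rewrite !gt_eqF// sqrtr_gt0.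
  apply: cvgM; last exact: cvg_cst.
  apply: cvgM zc; apply: cvgM mzc _; apply: cvgV; first by rewrite gt_eqF// mulr_gt0.
  exact: cvgM.
apply: filterS3 mx my mz => n mx my mz.
have zE : beta n * beta' n / (beta n + beta' n) = z * b n.
  rewrite bx by' /z -mulrDl; have := b_gt0 n; move: (b n) => B B0; field.
  by rewrite !gt_eqF.
have B0 : 0 < beta n by rewrite bx tb.
have B0' : 0 < beta' n by rewrite by' tb.
have mnx : side_mass c s (beta n) != 0 by rewrite bx; exact: (lt0r_neq0 mx).
have mny : side_mass c s (beta' n) != 0 by rewrite by'; exact: (lt0r_neq0 my).
have mnz : side_mass c s (beta n * beta' n / (beta n + beta' n)) != 0 by rewrite zE; exact: (lt0r_neq0 mz).
rewrite (@side_kernelM_expectation _ _ _ P X f densX c c0 s _ _ 0%N s1 B0 B0' mnx mny mnz).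
rewrite zE bx by' -/(m x n) -/(m y n) -/(m z n).
have sz : Num.sqrt (z * b n) * Num.sqrt (x + y) = Num.sqrt x * Num.sqrt y * Num.sqrt (b n).
  have zb0 : 0 <= z * b n by rewrite ltW// tb.
  have x0' := ltW x0; have xy0' : 0 <= x * y by rewrite mulr_ge0// ltW.
  rewrite -(sqrtrM _ zb0) -(sqrtrM _ x0') -(sqrtrM _ xy0'); congr (Num.sqrt _).
  by rewrite /z; field; rewrite gt_eqF.
have -> : Num.sqrt (z * b n) = Num.sqrt x * Num.sqrt y * Num.sqrt (b n) / Num.sqrt (x + y).
  by rewrite -sz mulfK// gt_eqF// sqrtr_gt0.
rewrite (@sqrtrM _ x) ?ltW// (@sqrtrM _ y) ?ltW//.
have sb0 : 0 < Num.sqrt (b n) by rewrite sqrtr_gt0.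
have sx0 : 0 < Num.sqrt x by rewrite sqrtr_gt0.
have sy0 : 0 < Num.sqrt y by rewrite sqrtr_gt0.
have sxy0 : 0 < Num.sqrt (x + y) by rewrite sqrtr_gt0.
move: (Num.sqrt (b n)) (Num.sqrt x) (Num.sqrt y) (Num.sqrt (x + y)) sb0 sx0 sy0 sxy0 => B A A' A''.
move: (m x n) (m y n) (m z n) (kernel_mean c f s (z * b n)) mx my mz => m1 m2 m3 km *.
by field; rewrite !gt_eqF.
Qed.

End kernel_covariances.

(** * Algebra of the limiting variance *)

Section asymptotic_variance.
Context {R : realType}.
Variables (c delta : R).
Hypothesis c0 : 0 < c.
Hypothesis delta_gt0 : 0 < delta.
Hypothesis delta_lt1 : delta < 1.
Local Notation g0 := (Num.sqrt (pi / 2) : R).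
Local Notation q := (Num.sqrt delta).

Lemma powR_three_halves : delta `^ (3 / 2) = q ^+ 3.
Proof.
rewrite (_ : 3 / 2 = 1 + 2^-1); last by field.
rewrite powRD ?(gt_eqF delta_gt0) ?implybT// powRr1 ?ltW// powR12_sqrt ?ltW//.
by rewrite -{1}(sqr_sqrtr (ltW delta_gt0)) -exprSr.
Qed.

(** The central limit theorem needs a positive variance. After squaring, with [q = sqrt delta], the
    numerator is positive because [(1 + q^3)^2 >= 4 q^3] and [1 + q^2 > 2 q], the latter strictly
    since [q < 1]. *)
Lemma lambda_coef_gt0 : 0 < lambda_coef delta.
Proof.
have /andP[q0 q1] := sqrt_delta01 delta_gt0 delta_lt1.
have q2 : delta = q ^+ 2 by rewrite sqr_sqrtr// ltW.
have d1 : 0 < 1 + delta by rewrite addr_gt0.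
have s1 : 0 < Num.sqrt (1 + delta) by rewrite sqrtr_gt0.
rewrite /lambda_coef divr_gt0//; last by rewrite mulr_gt0// exprn_gt0// subr_gt0.
rewrite subr_gt0 powR_three_halves.
have h0 : 0 <= 2 * Num.sqrt 2 * delta by rewrite !mulr_ge0// ltW.
have h1 : 0 <= (1 + q ^+ 3) * Num.sqrt (1 + delta).
  by rewrite mulr_ge0 ?ltW// addr_gt0// exprn_gt0.
rewrite -(@ltr_pXn2r _ 2) ?nnegrE//.
have -> : (2 * Num.sqrt 2 * delta) ^+ 2 = 2 ^+ 2 * 2 * (q ^+ 2) ^+ 2.
  by rewrite -q2 !exprMn sqr_sqrtr.
have -> : ((1 + q ^+ 3) * Num.sqrt (1 + delta)) ^+ 2 = (1 + q ^+ 3) ^+ 2 * (1 + q ^+ 2).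
  by rewrite -q2 exprMn (sqr_sqrtr (ltW d1)).
have q3 : 0 < q ^+ 3 by rewrite exprn_gt0.
have e1 : 4 * q ^+ 3 <= (1 + q ^+ 3) ^+ 2.
  rewrite -subr_ge0 (_ : _ - _ = (1 - q ^+ 3) ^+ 2) ?sqr_ge0//; ring.
have e2 : 2 * q < 1 + q ^+ 2.
  rewrite -subr_gt0 (_ : _ - _ = (1 - q) ^+ 2); last ring.
  by rewrite exprn_gt0// subr_gt0.
apply: (@lt_le_trans _ _ (4 * q ^+ 3 * (1 + q ^+ 2))).
  rewrite (_ : 2 ^+ 2 * 2 * (q ^+ 2) ^+ 2 = 4 * q ^+ 3 * (2 * q)); last ring.
  by rewrite ltr_pM2l// mulr_gt0.
by rewrite ler_wpM2r// addr_ge0// sqr_ge0.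
Qed.

(** The left side is the quadratic form of the exponents in the limiting covariances of the two
    estimates, whose bandwidths are [1] and [1 / delta] in units of [b]. *)
Lemma side_variance (F : R) :
  (1 / (1 - q)) ^+ 2 * (F / (Num.sqrt c * g0 * Num.sqrt (1 + 1))) +
  2 * (1 / (1 - q)) * (- q / (1 - q)) * (F / (Num.sqrt c * g0 * Num.sqrt (1 + delta^-1))) +
  (- q / (1 - q)) ^+ 2 * (F / (Num.sqrt c * g0 * Num.sqrt (delta^-1 + delta^-1))) =
  lambda_coef delta * (F / (Num.sqrt pi * Num.sqrt c)).
Proof.
have /andP[q0 q1] := sqrt_delta01 delta_gt0 delta_lt1.
have q2 : delta = q ^+ 2 by rewrite sqr_sqrtr// ltW.
have d1 : 0 < 1 + delta by rewrite addr_gt0.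
have p0 := @pi_gt0 R.
have e1 : Num.sqrt pi = g0 * Num.sqrt 2.
  by rewrite -sqrtrM ?divr_ge0 ?ltW//; congr (Num.sqrt _); move: (pi) => p; field.
have e2 : Num.sqrt (1 + delta^-1) = Num.sqrt (1 + delta) / q.
  rewrite -sqrtrV ?ltW// -sqrtrM ?ltW//; congr (Num.sqrt _); field; by rewrite gt_eqF.
have e3 : Num.sqrt (delta^-1 + delta^-1) = Num.sqrt 2 / q.
  rewrite -sqrtrV ?ltW// -sqrtrM//; congr (Num.sqrt _); ring.
rewrite e1 e2 e3 /lambda_coef powR_three_halves.
have := q1; rewrite -subr_gt0 => q1'.
have gg := @sqrt_pi2_gt0 R; have sc : 0 < Num.sqrt c by rewrite sqrtr_gt0.
have s2 : 0 < Num.sqrt 2 :> R by rewrite sqrtr_gt0.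
have s22 : Num.sqrt 2 ^+ 2 = 2 :> R by rewrite sqr_sqrtr.
have s1 : 0 < Num.sqrt (1 + delta) by rewrite sqrtr_gt0.
have -> : 2 * Num.sqrt 2 * delta = 2 * Num.sqrt 2 * q ^+ 2 by rewrite -q2.
rewrite (_ : 1 + 1 = 2 :> R)//.
move: (g0) (Num.sqrt c) (Num.sqrt (2 : R)) (Num.sqrt (1 + delta)) (q) gg sc s2 s22 s1 q0 q1' => G C S W Q G0 C0 S0 S2 W0 Q0 Q1.
(* Writing 2 as the square of [S] turns the identity into one between rational functions with [S] as
   a free variable. *)
have -> : 2 * S * Q ^+ 2 = S ^+ 3 * Q ^+ 2 by rewrite -S2; ring.
have -> : 2 * (1 / (1 - Q)) = S ^+ 2 * (1 / (1 - Q)) by rewrite S2.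
by field; rewrite !gt_eqF.
Qed.

End asymptotic_variance.

(** * Rates derived from the bandwidth condition *)

Section bandwidth.
Context {R : realType}.
Variable b : nat -> R.
Hypothesis b_gt0 : forall n, 0 < b n.
Hypothesis b_rate : b n + (n%:R * b n)^-1 @[n --> \oo] --> (0 : R).

Definition rate n : R := n%:R * Num.sqrt (b n).

Lemma rate_ge0 n : 0 <= rate n.
Proof. by rewrite mulr_ge0 ?sqrtr_ge0. Qed.

Let nb_ge0 n : 0 <= (n%:R * b n)^-1.
Proof. by rewrite invr_ge0 mulr_ge0// ltW. Qed.

Lemma bandwidth_cvg : b n @[n --> \oo] --> (0 : R).
Proof.
apply: cvg0_le b_rate; apply: nearW => n.
by rewrite gtr0_norm// lerDl.
Qed.

(** The inverse rate [1 / (n sqrt b)] is [(n b)^-1 sqrt b], a product of two vanishing factors. *)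
Lemma inv_sqrt_rate_cvg : (Num.sqrt (rate n))^-1 @[n --> \oo] --> (0 : R).
Proof.
have -> : (fun n => (Num.sqrt (rate n))^-1) = (fun n => Num.sqrt ((n%:R * b n)^-1 * Num.sqrt (b n))).
  apply/funext => n; rewrite -sqrtrV ?rate_ge0//; congr (Num.sqrt _).
  have sb : 0 < Num.sqrt (b n) by rewrite sqrtr_gt0.
  have sE := sqr_sqrtr (ltW (b_gt0 n)).
  rewrite /rate -[X in (_ * X)^-1 * _]sE; move: (Num.sqrt (b n)) sb => B B0.
  by rewrite expr2 [in RHS]invfM [in LHS]invfM -mulrA; congr (_ * _); field; rewrite gt_eqF.
apply: cvg_sqrt0; rewrite -(mul0r 0); apply: cvgM; last exact: cvg_sqrt0 bandwidth_cvg.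
apply: cvg0_le b_rate; apply: nearW => n.
by rewrite ger0_norm// lerDr ltW.
Qed.

Lemma rate_gt0 n : (0 < n)%N -> 0 < rate n.
Proof. by move=> n0; rewrite mulr_gt0 ?ltr0n// sqrtr_gt0. Qed.

Lemma rate_weight n : (0 < n)%N -> n%:R * (Num.sqrt (rate n) / n%:R) ^+ 2 = Num.sqrt (b n).
Proof.
move=> n0; rewrite expr_div_n sqr_sqrtr ?rate_ge0// /rate; field.
by rewrite pnatr_eq0 -lt0n.
Qed.

Lemma near_gt0 : \forall n \near \oo, (0 < n)%N.
Proof. by exists 1%N. Qed.

(** The largest possible normalized summand: with a mass [m] of order [sqrt b] it is of order
    [1 / sqrt (n sqrt b)]. *)
Lemma rate_weight_cvg (m : nat -> R) (l : R) : 0 < l ->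
  m n / Num.sqrt (b n) @[n --> \oo] --> l ->
  Num.sqrt (rate n) / n%:R * (m n)^-1 @[n --> \oo] --> (0 : R).
Proof.
move=> l0 ml.
have pos : \forall n \near \oo, 0 < m n / Num.sqrt (b n) by exact: near_pos ml.
apply: (@cvg0_near_eq _ _ (fun n => (Num.sqrt (rate n))^-1 * (m n / Num.sqrt (b n))^-1)).
  apply: filterS2 near_gt0 pos => n n0 p.
  have sb : 0 < Num.sqrt (b n) by rewrite sqrtr_gt0.
  have mn : 0 < m n by move: p; rewrite pmulr_lgt0// invr_gt0.
  have h : Num.sqrt (rate n) ^+ 2 = n%:R * Num.sqrt (b n) by rewrite sqr_sqrtr// rate_ge0.
  have sr : 0 < Num.sqrt (rate n) by rewrite sqrtr_gt0 rate_gt0.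
  have n0' : 0 < n%:R :> R by rewrite ltr0n.
  have -> : n%:R = Num.sqrt (rate n) ^+ 2 / Num.sqrt (b n) by rewrite h mulfK// gt_eqF.
  by field; rewrite !gt_eqF.
rewrite -(mul0r l^-1); apply: cvgM; first exact: inv_sqrt_rate_cvg.
by apply: cvgV => //; rewrite gt_eqF.
Qed.

End bandwidth.

Section sample_means.
Context {d : measure_display} {T : measurableType d} {R : realType}.
Variable P : probability T R.
Variable X : nat -> {RV P >-> R}.

Definition sample_mean (g : R -> R) n w : R := n%:R^-1 * \sum_(i < n) g (X i w).

Lemma measurable_sample_mean g n : measurable_fun setT g -> measurable_fun setT (sample_mean g n).
Proof.
move=> mg; apply: measurable_funM => //; apply: measurable_sum => i.
exact: measurableT_comp.
Qed.

Lemma partial_sum_centered (g : R -> R) (a : R) n w : (0 < n)%N ->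
  partial_sum X (centered X g (a / n%:R)) n w =
  a * (sample_mean g n w - \int[P]_v g (X 0%N v)).
Proof.
move=> n0; have n0' : n%:R != 0 :> R by rewrite pnatr_eq0 -lt0n.
rewrite /partial_sum /centered -big_distrr/= big_split/= sumr_const card_ord.
rewrite /sample_mean; set S := \sum_(i < n) _; set m := \int[P]_v _.
by rewrite mulNrn -mulr_natl; field.
Qed.

Lemma expectation_lin (g h : R -> R) (Mg Mh x y : R) :
  measurable_fun setT g -> measurable_fun setT h ->
  (forall u, `|g u| <= Mg) -> (forall u, `|h u| <= Mh) ->
  \int[P]_w (x * g (X 0%N w) + y * h (X 0%N w)) =
  x * \int[P]_w g (X 0%N w) + y * \int[P]_w h (X 0%N w).
Proof.
move=> mg mh gM hM.
have ig := @bounded_expectation _ _ _ P X 0%N g Mg mg gM.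
have ih := @bounded_expectation _ _ _ P X 0%N h Mh mh hM.
rewrite RintegralD// ?RintegralZl//; exact: integrable_scale.
Qed.

End sample_means.

Lemma norm_lin_le {R : realType} (a b x y M N : R) : `|x| <= M -> `|y| <= N ->
  `|a * x + b * y| <= `|a| * M + `|b| * N.
Proof.
move=> xM yN; apply: le_trans (ler_normD _ _) _; rewrite !normrM.
by apply: lerD; apply: ler_wpM2l.
Qed.

Lemma lin_mul_eq0 {R : realType} (a b x y x' y' : R) :
  x * x' = 0 -> x * y' = 0 -> y * x' = 0 -> y * y' = 0 -> (a * x + b * y) * (a * x' + b * y') = 0.
Proof.
move=> h1 h2 h3 h4.
have -> : (a * x + b * y) * (a * x' + b * y') =
  a * a * (x * x') + a * b * (x * y') + b * a * (y * x') + b * b * (y * y') by ring.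
by rewrite h1 h2 h3 h4 !mulr0 !addr0.
Qed.

(** * The linearized statistic and tightness of the estimates *)

Section linear_statistic.
Context {d : measure_display} {T : measurableType d} {R : realType}.
Variable P : probability T R.
Variable X : nat -> {RV P >-> R}.
Local Notation g0 := (Num.sqrt (pi / 2) : R).
Variables (c delta : R) (f : R -> R) (L r : R) (F0 F1 F2 : R -> R).
Hypothesis densX : forall k, has_density (X k) f.
Hypothesis c0 : 0 < c.
Hypothesis delta_gt0 : 0 < delta.
Hypothesis delta_lt1 : delta < 1.
Hypothesis mf : measurable_fun setT f.
Hypothesis f_ge0 : forall u, 0 <= f u.
Hypothesis L0 : 0 < L.
Hypothesis r0 : 0 < r.
Hypothesis r1 : r <= 1.
Hypothesis tay : forall s y, s = 1 \/ s = -1 -> 0 < y -> (s = -1 -> y < c) ->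
  `|f (c + s * y) - (F0 s + s * F1 s * y + F2 s / 2 * y ^+ 2)| <= L * y `^ (2 + r).
Variable b : nat -> R.
Hypothesis b_gt0 : forall n, 0 < b n.
Hypothesis b_rate : b n + (n%:R * b n)^-1 @[n --> \oo] --> (0 : R).
Let b_cvg := bandwidth_cvg b_gt0 b_rate.
Local Notation q := (Num.sqrt delta).

Definition weight1 : R := 1 / (1 - q).
Definition weight2 : R := - q / (1 - q).

(** The linearization of the bias correction: at a point of the diagonal its gradient consists of
    the two exponents. *)
Definition side_combination s n u : R :=
  weight1 * side_kernel c s (b n) u + weight2 * side_kernel c s (b n / delta) u.

Definition jump_kernel n u : R := side_combination 1 n u - side_combination (-1) n u.

Let bd_gt0 n : 0 < b n / delta. Proof. by rewrite divr_gt0. Qed.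

Let side1 : (1 : R) = 1 \/ (1 : R) = -1. Proof. by left. Qed.
Let sideN1 : (-1 : R) = 1 \/ (-1 : R) = -1. Proof. by right. Qed.

Let mk s n : measurable_fun setT (side_kernel c s n). Proof. exact: measurable_side_kernel. Qed.

Lemma measurable_side_combination s n : measurable_fun setT (side_combination s n).
Proof. by apply: measurable_funD; exact: measurable_funM. Qed.

Lemma measurable_jump_kernel n : measurable_fun setT (jump_kernel n).
Proof. by apply: measurable_funB; exact: measurable_side_combination. Qed.

Let side_bound s n : R :=
  `|weight1| * (side_mass c s (b n))^-1 + `|weight2| * (side_mass c s (b n / delta))^-1.

Let side_combination_le s n u : s = 1 \/ s = -1 -> `|side_combination s n u| <= side_bound s n.
Proof.
move=> s1; rewrite /side_combination /side_bound.
by apply: norm_lin_le; exact: side_kernel_norm_le.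
Qed.

Definition jump_bound n : R := side_bound 1 n + side_bound (-1) n.

Lemma jump_kernel_le n u : `|jump_kernel n u| <= jump_bound n.
Proof.
rewrite /jump_kernel /jump_bound; apply: le_trans (ler_normB _ _) _.
by apply: lerD; [exact: side_combination_le side1|exact: side_combination_le sideN1].
Qed.

Let E (g : R -> R) := \int[P]_w g (X 0%N w).

Let bounded_mul (g h : R -> R) Mg Mh : (forall u : R, `|g u| <= Mg) -> (forall u : R, `|h u| <= Mh) ->
  forall u : R, `|g u * h u| <= Mg * Mh.
Proof. by move=> gM hM u; rewrite normrM ler_pM. Qed.

Lemma side_combination_mean s n : s = 1 \/ s = -1 ->
  E (side_combination s n) =
  weight1 * kernel_mean c f s (b n) + weight2 * kernel_mean c f s (b n / delta).
Proof.
move=> s1; rewrite /E /side_combination.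
rewrite (@expectation_lin _ _ _ P X (side_kernel c s (b n)) (side_kernel c s (b n / delta))
  ((side_mass c s (b n))^-1) ((side_mass c s (b n / delta))^-1))//; last 2 first.
- by move=> u; exact: side_kernel_norm_le.
- by move=> u; exact: side_kernel_norm_le.
by congr (_ * _ + _ * _); apply: side_kernel_expectation.
Qed.

Let bd_cvg : b n / delta @[n --> \oo] --> (0 : R).
Proof. by rewrite -(mul0r delta^-1); apply: cvgM => //; exact: cvg_cst. Qed.

Lemma side_combination_mean_cvg s : s = 1 \/ s = -1 ->
  E (side_combination s n) @[n --> \oo] --> F0 s.
Proof.
move=> s1; under eq_fun do rewrite side_combination_mean//.
rewrite -[F0 s]mul1r -(bias_corrected_exponents delta_gt0 delta_lt1) mulrDl.
have h1 := kernel_mean_cvg c0 b_gt0 b_cvg mf f_ge0 L0 r0 r1 tay s1.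
have h2 := kernel_mean_cvg c0 bd_gt0 bd_cvg mf f_ge0 L0 r0 r1 tay s1.
exact: (cvgD (cvgM (cvg_cst weight1) h1) (cvgM (cvg_cst weight2) h2)).
Qed.

Lemma side_combination_second s : s = 1 \/ s = -1 ->
  Num.sqrt (b n) * E (fun u => side_combination s n u ^+ 2) @[n --> \oo] -->
  lambda_coef delta * (F0 s / (Num.sqrt pi * Num.sqrt c)).
Proof.
move=> s1.
pose k1 n := side_kernel c s (b n); pose k2 n := side_kernel c s (b n / delta).
have k1M n u : `|k1 n u| <= (side_mass c s (b n))^-1 by exact: side_kernel_norm_le.
have k2M n u : `|k2 n u| <= (side_mass c s (b n / delta))^-1 by exact: side_kernel_norm_le.
have expand n : Num.sqrt (b n) * E (fun u => side_combination s n u ^+ 2) =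
    weight1 ^+ 2 * (Num.sqrt (b n) * E (fun u => k1 n u * k1 n u)) +
    2 * weight1 * weight2 * (Num.sqrt (b n) * E (fun u => k1 n u * k2 n u)) +
    weight2 ^+ 2 * (Num.sqrt (b n) * E (fun u => k2 n u * k2 n u)).
  (* The factor 1 and the grouping shape the three-term sum for two uses of the two-term linearity
     lemma. *)
  have e1 : E (fun u => side_combination s n u ^+ 2) =
      E (fun u => 1 * (weight1 ^+ 2 * (k1 n u * k1 n u) + 2 * weight1 * weight2 * (k1 n u * k2 n u)) +
        weight2 ^+ 2 * (k2 n u * k2 n u)).
    apply: eq_Rintegral => w _; rewrite /side_combination -/(k1 n _) -/(k2 n _); ring.
  have mk1 : measurable_fun setT (k1 n) := mk s (b n).
  have mk2 : measurable_fun setT (k2 n) := mk s (b n / delta).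
  have m11 := measurable_funM mk1 mk1; have m12 := measurable_funM mk1 mk2.
  have m22 := measurable_funM mk2 mk2.
  have b11 := bounded_mul (k1M n) (k1M n); have b12 := bounded_mul (k1M n) (k2M n).
  have b22 := bounded_mul (k2M n) (k2M n).
  have bs u := norm_lin_le (weight1 ^+ 2) (2 * weight1 * weight2) (b11 u) (b12 u).
  have msum := measurable_funD (measurable_funM (measurable_cst (weight1 ^+ 2)) m11)
    (measurable_funM (measurable_cst (2 * weight1 * weight2)) m12).
  have e2 := expectation_lin X 1 (weight2 ^+ 2) msum m22 bs b22.
  have e3 := expectation_lin X (weight1 ^+ 2) (2 * weight1 * weight2) m11 m12 b11 b12.
  have e4 : E (fun u => side_combination s n u ^+ 2) = weight1 ^+ 2 * E (fun u => k1 n u * k1 n u) +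
      2 * weight1 * weight2 * E (fun u => k1 n u * k2 n u) + weight2 ^+ 2 * E (fun u => k2 n u * k2 n u).
    by apply: (etrans e1); apply: (etrans e2); rewrite mul1r; congr (_ + _); exact: e3.
  by rewrite e4 mulrDr mulrDr; congr (_ + _ + _); exact: mulrCA.
under eq_fun do rewrite expand.
rewrite -(side_variance c0 delta_gt0 delta_lt1).
have bE n : b n = 1 * b n by rewrite mul1r.
have bdE n : b n / delta = delta^-1 * b n by rewrite mulrC.
have di : 0 < delta^-1 by rewrite invr_gt0.
have cov x y beta beta' x0 y0 be be' :=
  @kernel_covariance_cvg _ _ _ P X c f L r F0 F1 F2 densX c0 mf f_ge0 L0 r0 r1 tay b b_gt0 b_cvg
   s x y beta beta' s1 x0 y0 be be'.
apply: cvgD; first apply: cvgD; apply: cvgM; try exact: cvg_cst.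
- exact: (cov _ _ _ _ ltr01 ltr01 bE bE).
- exact: (cov _ _ _ _ ltr01 di bE bdE).
- exact: (cov _ _ _ _ di di bdE bdE).
Qed.

Lemma jump_kernel_mean n : E (jump_kernel n) = E (side_combination 1 n) - E (side_combination (-1) n).
Proof.
have h s : s = 1 \/ s = -1 -> forall u, `|side_combination s n u| <= side_bound s n.
  by move=> s1 u; exact: side_combination_le.
have := expectation_lin X 1 (-1) (measurable_side_combination 1 n)
  (measurable_side_combination (-1) n) (h 1 side1) (h (-1) sideN1).
rewrite mul1r mulN1r => <-; apply: eq_Rintegral => w _.
by rewrite mul1r mulN1r.
Qed.

(** The kernels of the two sides have disjoint supports, so the cross term is identically zero and
    the variances of the two sides add up. *)
Lemma jump_kernel_second n : E (fun u => jump_kernel n u ^+ 2) =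
  E (fun u => side_combination 1 n u ^+ 2) + E (fun u => side_combination (-1) n u ^+ 2).
Proof.
have h s : s = 1 \/ s = -1 -> forall u, `|side_combination s n u ^+ 2| <= side_bound s n ^+ 2.
  by move=> s1 u; rewrite !expr2; apply: bounded_mul => v; exact: side_combination_le.
have m s : measurable_fun setT (fun u => side_combination s n u ^+ 2).
  by apply: measurable_funX; exact: measurable_side_combination.
have := expectation_lin X 1 1 (m 1) (m (-1)) (h 1 side1) (h (-1) sideN1).
rewrite !mul1r => <-; apply: eq_Rintegral => w _; rewrite !mul1r.
have D b1 b2 := side_kernel_disjoint c b1 b2 (X 0%N w).
have cross : side_combination 1 n (X 0%N w) * side_combination (-1) n (X 0%N w) = 0.
  exact: lin_mul_eq0 (D _ _) (D _ _) (D _ _) (D _ _).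
rewrite /jump_kernel sqrrB cross mul0rn subr0 //.
Qed.

(** The second moments are of order [b^(-1/2)] while the mean stays bounded, so after multiplication
    by [sqrt b] the squared mean disappears. *)
Lemma linear_variance_cvg :
  n%:R * ((Num.sqrt (rate b n) / n%:R) ^+ 2 *
    (E (fun u => jump_kernel n u ^+ 2) - E (jump_kernel n) ^+ 2)) @[n --> \oo] -->
  lambda_coef delta * ((F0 1 + F0 (-1)) / (Num.sqrt pi * Num.sqrt c)).
Proof.
apply: (@cvg_near_eq _ _ (fun n =>
    (Num.sqrt (b n) * E (fun u => side_combination 1 n u ^+ 2) +
     Num.sqrt (b n) * E (fun u => side_combination (-1) n u ^+ 2)) -
    Num.sqrt (b n) * (E (jump_kernel n) * E (jump_kernel n)))).
  apply: filterS near_gt0 => n n0.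
  by rewrite mulrA rate_weight// jump_kernel_second; ring.
rewrite -[X in _ --> X]subr0; apply: cvgB.
  rewrite mulrDl mulrDr; apply: cvgD; exact: side_combination_second.
pose m := F0 1 - F0 (-1).
have mc : E (jump_kernel n) @[n --> \oo] --> m.
  under eq_fun do rewrite jump_kernel_mean.
  by apply: cvgB; exact: side_combination_mean_cvg.
rewrite -(mul0r (m * m)); apply: cvgM; first exact: cvg_sqrt0.
exact: cvgM.
Qed.

Lemma linear_bound_cvg :
  `|Num.sqrt (rate b n) / n%:R| * (jump_bound n + jump_bound n) @[n --> \oo] --> (0 : R).
Proof.
have A0 : 0 < Num.sqrt c * g0 by apply: mulr_gt0; [rewrite sqrtr_gt0|exact: sqrt_pi2_gt0].
have mass s : s = 1 \/ s = -1 ->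
    Num.sqrt (rate b n) / n%:R * (side_mass c s (b n))^-1 @[n --> \oo] --> (0 : R).
  move=> s1; apply: (rate_weight_cvg b_gt0 b_rate A0).
  by have [] := side_mass_cvg c0 b_gt0 b_cvg mf f_ge0 L0 r0 r1 tay s1.
have mass' s : s = 1 \/ s = -1 ->
    Num.sqrt (rate b n) / n%:R * (side_mass c s (b n / delta))^-1 @[n --> \oo] --> (0 : R).
  move=> s1; have q0 : 0 < q by rewrite sqrtr_gt0.
  apply: (rate_weight_cvg b_gt0 b_rate (divr_gt0 A0 q0)).
  have -> : (fun n => side_mass c s (b n / delta) / Num.sqrt (b n)) =
      (fun n => side_mass c s (b n / delta) / Num.sqrt (b n / delta) / q).
    apply/funext => n; rewrite -(mulrA _ _ q^-1); congr (_ * _).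
    by rewrite -invfM -sqrtrM ?ltW// divfK// gt_eqF.
  apply: cvgM; last exact: cvg_cst.
  by have [] := side_mass_cvg c0 bd_gt0 bd_cvg mf f_ge0 L0 r0 r1 tay s1.
have bound s : s = 1 \/ s = -1 ->
    Num.sqrt (rate b n) / n%:R * side_bound s n @[n --> \oo] --> (0 : R).
  move=> s1.
  have -> : (fun n => Num.sqrt (rate b n) / n%:R * side_bound s n) = (fun n =>
     `|weight1| * (Num.sqrt (rate b n) / n%:R * (side_mass c s (b n))^-1) +
     `|weight2| * (Num.sqrt (rate b n) / n%:R * (side_mass c s (b n / delta))^-1)).
    apply/funext => n; rewrite /side_bound.
    move: (side_mass c s (b n)) (side_mass c s (b n / delta)) `|weight1| `|weight2| => m m' w w'.
    by ring.
  rewrite -(addr0 0); apply: cvgD.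
    by rewrite -(mulr0 `|weight1|); apply: cvgM; [exact: cvg_cst|exact: mass].
  by rewrite -(mulr0 `|weight2|); apply: cvgM; [exact: cvg_cst|exact: mass'].
have -> : (fun n => `|Num.sqrt (rate b n) / n%:R| * (jump_bound n + jump_bound n)) = (fun n =>
   2 * (Num.sqrt (rate b n) / n%:R * side_bound 1 n + Num.sqrt (rate b n) / n%:R * side_bound (-1) n)).
  apply/funext => n; rewrite ger0_norm ?divr_ge0 ?sqrtr_ge0// /jump_bound.
  by move: (side_bound 1 n) (side_bound (-1) n) => m m'; ring.
rewrite -(mulr0 2); apply: cvgM; first exact: cvg_cst.
by rewrite -(addr0 0); apply: cvgD; exact: bound.
Qed.

(** Chebyshev's inequality with a constant uniform in [n] and [e]; the delta method uses it to
    confine the rescaled errors to a bounded range. *)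
Lemma estimator_tight s x (beta : nat -> R) : s = 1 \/ s = -1 -> 0 < x ->
  (forall n, beta n = x * b n) -> mutually_independent X ->
  exists2 C, 0 < C & \forall n \near \oo, forall e, 0 < e ->
    fine (P [set w | e < `|Num.sqrt (rate b n) * (sample_mean X (side_kernel c s (beta n)) n w -
      kernel_mean c f s (beta n))|]) <= C / e ^+ 2.
Proof.
move=> s1 x0 bx indepX.
have beta0 n : 0 < beta n by rewrite bx mulr_gt0.
pose k n := side_kernel c s (beta n).
have kM n u : `|k n u| <= (side_mass c s (beta n))^-1 by exact: side_kernel_norm_le.
have cov := @kernel_covariance_cvg _ _ _ P X c f L r F0 F1 F2 densX c0 mf f_ge0 L0 r0 r1 tay b b_gt0 b_cvg
   s x x beta beta s1 x0 x0 bx bx.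
set l := F0 s / _ in cov.
(* Any constant above the limit [l] of the scaled second moment eventually bounds the variance; the
   absolute value makes it positive. *)
exists (`|l| + 1); first by rewrite ltr_wpDl.
have l1 : l < `|l| + 1 by apply: le_lt_trans (ler_norm l) _; rewrite ltrDl.
apply: filterS2 near_gt0 (cvgr_lt l cov _ l1) => n n0 vn e e0.
pose a := Num.sqrt (rate b n) / n%:R.
have mkn : measurable_fun setT (k n) := mk s (beta n).
have := @partial_sum_chebyshev _ _ _ P X indepX (centered X (k n) a) _ _
  (measurable_centered X a mkn) (centered_le X a mkn (kM n)) (centered_mean densX a mkn (kM n))
  (centered_second densX a mkn (kM n)) n e e0.
have kme : \int[P]_w k n (X 0%N w) = kernel_mean c f s (beta n) by exact: side_kernel_expectation.
have -> : [set w | e < `|partial_sum X (centered X (k n) a) n w|] =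
    [set w | e < `|Num.sqrt (rate b n) * (sample_mean X (k n) n w - kernel_mean c f s (beta n))|].
  by apply/seteqP; split => w /=; rewrite partial_sum_centered// kme.
move=> h; apply: le_trans h _; rewrite ler_pM2r ?invr_gt0 ?exprn_gt0//.
rewrite mulrA rate_weight//; apply: le_trans (ltW vn).
rewrite ler_wpM2l ?sqrtr_ge0//.
under eq_Rintegral do rewrite expr2.
by rewrite gerBl sqr_ge0.
Qed.

End linear_statistic.

(** * The jump estimator *)

Lemma chebyshev_budget {R : realType} (C1 C2 k : R) : 0 < C1 -> 0 < C2 -> 0 < k ->
  exists2 t, 0 < t & C1 / t ^+ 2 + C2 / t ^+ 2 <= k.
Proof.
move=> C10 C20 k0; have C0 : 0 < C1 + C2 by rewrite addr_gt0.
exists (Num.sqrt ((C1 + C2) / k)); first by rewrite sqrtr_gt0 divr_gt0.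
have s0 : 0 <= (C1 + C2) / k by rewrite divr_ge0 ?ltW.
rewrite (sqr_sqrtr s0) -mulrDl (_ : (C1 + C2) / ((C1 + C2) / k) = k)//.
by field; rewrite !gt_eqF.
Qed.

Lemma measurable_norm_gt {d} {T : measurableType d} {R : realType} (g : T -> R) z :
  measurable_fun setT g -> measurable [set w | z < `|g w|].
Proof.
move=> mg; have -> : [set w | z < `|g w|] = (fun w => `|g w|) @^-1` `]z, +oo[.
  by apply/seteqP; split => w /=; rewrite in_itv/= andbT.
by apply: measurable_preimage => //; exact: measurableT_comp.
Qed.

Section delta_event.
Context {d : measure_display} {T : measurableType d} {R : realType}.
Variable P : probability T R.

(* Off the events where a rescaled error exceeds [t], both estimates are within [rho] of the
   common limit, where the map is linear up to the factor [e / (2 * t)]. *)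
Lemma delta_event (A B : T -> R) (a a' N t e rho F p p' : R) :
  measurable_fun setT A -> measurable_fun setT B -> 0 < N -> 0 < t -> 0 < e ->
  (forall x y x' y', `|x - F| <= rho -> `|y - F| <= rho -> `|x' - F| <= rho -> `|y' - F| <= rho ->
    `|x `^ p * y `^ p' - x' `^ p * y' `^ p' - (p * (x - x') + p' * (y - y'))| <=
      e / (2 * t) * (`|x - x'| + `|y - y'|)) ->
  `|F - a| <= rho / 2 -> `|F - a'| <= rho / 2 -> N^-1 <= rho / 2 / t ->
  fine (P [set w | e < `|N * (A w `^ p * B w `^ p' - a `^ p * a' `^ p' -
    (p * (A w - a) + p' * (B w - a')))|]) <=
  fine (P [set w | t < `|N * (A w - a)|]) + fine (P [set w | t < `|N * (B w - a')|]).
Proof.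
move=> mA mB N0 t0 e0 H k1 k2 k3.
apply: fine_prob_le_add.
- apply: measurable_norm_gt; apply: measurable_funM => //; apply: measurable_funB.
    apply: measurable_funB => //.
    by apply: measurable_funM; exact: (measurableT_comp (measurable_powR _)).
  by apply: measurable_funD; apply: measurable_funM => //; exact: measurable_funB.
- by apply: measurable_norm_gt; apply: measurable_funM => //; exact: measurable_funB.
- by apply: measurable_norm_gt; apply: measurable_funM => //; exact: measurable_funB.
move=> w /= he.
have [hA|hA] := lerP `|N * (A w - a)| t; last by left.
have [hB|hB] := lerP `|N * (B w - a')| t; last by right.
exfalso; move: he; apply/negP; rewrite -leNgt.
have Nt : t / N <= rho / 2 by rewrite mulrC -ler_pdivlMr.
have close z z' : `|N * (z - z')| <= t -> `|F - z'| <= rho / 2 -> `|z - F| <= rho.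
  rewrite normrM (gtr0_norm N0) mulrC -ler_pdivlMr// => h h'.
  have -> : z - F = (z - z') - (F - z') by ring.
  by apply: le_trans (ler_normB _ _) _; lra.
have near' z' : `|F - z'| <= rho / 2 -> `|z' - F| <= rho.
  by rewrite distrC => h; have := normr_ge0 (z' - F); lra.
have h := H (A w) (B w) a a' (close _ _ hA k1) (close _ _ hB k2) (near' _ k1) (near' _ k2).
rewrite normrM (gtr0_norm N0); apply: le_trans (ler_wpM2l (ltW N0) h) _.
move: hA hB; rewrite !normrM (gtr0_norm N0) => hA hB.
have et : 0 <= e / (2 * t) by rewrite divr_ge0 ?mulr_ge0 ?ltW.
have -> : N * (e / (2 * t) * (`|A w - a| + `|B w - a'|)) =
  e / (2 * t) * (N * `|A w - a| + N * `|B w - a'|) by ring.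
apply: le_trans (ler_wpM2l et (lerD hA hB)) _.
by rewrite le_eqVlt; apply/orP; left; apply/eqP; field; rewrite gt_eqF.
Qed.

End delta_event.

(** * Bias and linearization on each side *)

Section bias_corrected_estimators.
Context {d : measure_display} {T : measurableType d} {R : realType}.
Variable P : probability T R.
Variable X : nat -> {RV P >-> R}.
Variables (c delta : R) (f : R -> R) (L r : R) (F0 F1 F2 : R -> R).
Hypothesis indepX : mutually_independent X.
Hypothesis densX : forall k, has_density (X k) f.
Hypothesis c0 : 0 < c.
Hypothesis delta_gt0 : 0 < delta.
Hypothesis delta_lt1 : delta < 1.
Hypothesis mf : measurable_fun setT f.
Hypothesis f_ge0 : forall u, 0 <= f u.
Hypothesis L0 : 0 < L.
Hypothesis r0 : 0 < r.
Hypothesis r1 : r <= 1.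
Hypothesis F0_gt0 : forall s, s = 1 \/ s = -1 -> 0 < F0 s.
Hypothesis tay : forall s y, s = 1 \/ s = -1 -> 0 < y -> (s = -1 -> y < c) ->
  `|f (c + s * y) - (F0 s + s * F1 s * y + F2 s / 2 * y ^+ 2)| <= L * y `^ (2 + r).
Variable b : nat -> R.
Hypothesis b_gt0 : forall n, 0 < b n.
Hypothesis b_rate : b n + (n%:R * b n)^-1 @[n --> \oo] --> (0 : R).
Local Notation q := (Num.sqrt delta).

Let b_cvg := bandwidth_cvg b_gt0 b_rate.
Let bd_gt0 n : 0 < b n / delta. Proof. by rewrite divr_gt0. Qed.
Let bd_cvg : b n / delta @[n --> \oo] --> (0 : R).
Proof. by rewrite -(mul0r delta^-1); apply: cvgM => //; exact: cvg_cst. Qed.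

Let side1 : (1 : R) = 1 \/ (1 : R) = -1. Proof. by left. Qed.
Let sideN1 : (-1 : R) = 1 \/ (-1 : R) = -1. Proof. by right. Qed.

(** The correction of the means, not the mean of the corrected estimator; the latter is never
    formed. *)
Definition mean_bc s n : R :=
  bias_corrected delta (kernel_mean c f s (b n)) (kernel_mean c f s (b n / delta)).

(** The [sqrt b] coefficient of the kernel mean is [s F1 sqrt (2 c / pi)]; half its square over [F0]
    gives [(c / pi) F1^2 / F0], free of the sign. *)
Lemma mean_bc_expansion s : s = 1 \/ s = -1 ->
  (mean_bc s n - F0 s - q^-1 * (c / pi * (F1 s ^+ 2 / F0 s) -
    (F1 s * (1 - 4 / (3 * pi)) + F2 s * c / 2)) * b n) / b n @[n --> \oo] --> (0 : R).
Proof.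
move=> s1.
have s2 : s ^+ 2 = 1 by case: s1 => ->; rewrite ?sqrrN expr1n.
have t0 n : 0 < Num.sqrt (b n) by rewrite sqrtr_gt0.
have tc := cvg_sqrt0 b_cvg.
have t2 n : Num.sqrt (b n) ^+ 2 = b n by rewrite sqr_sqrtr// ltW.
have tdE n : Num.sqrt (b n) / q = Num.sqrt (b n / delta).
  by rewrite -sqrtrV ?ltW// -sqrtrM ?ltW.
have td2 n : Num.sqrt (b n / delta) ^+ 2 = b n / delta by rewrite sqr_sqrtr// ltW.
have h := kernel_mean_seq c0 b_gt0 b_cvg mf f_ge0 L0 r0 r1 tay s1.
have h' := kernel_mean_seq c0 bd_gt0 bd_cvg mf f_ge0 L0 r0 r1 tay s1.
have := @bias_corrected_expansion R delta delta_gt0 delta_lt1 (fun n => Num.sqrt (b n))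
  (fun n => kernel_mean c f s (b n)) (fun n => kernel_mean c f s (b n / delta)) (F0 s)
  (s * F1 s * Num.sqrt (2 * c / pi)) (F1 s * (1 - 4 / (3 * pi)) + F2 s * c / 2) (F0_gt0 s1) t0 tc.
have p0 := @pi_gt0 R.
have a2 : (s * F1 s * Num.sqrt (2 * c / pi)) ^+ 2 / (2 * F0 s) = c / pi * (F1 s ^+ 2 / F0 s).
  rewrite !exprMn s2 sqr_sqrtr; last by rewrite divr_ge0 ?mulr_ge0 ?ltW.
  by have := F0_gt0 s1; move: (pi) p0 (F0 s) => p p0 z z0; field; rewrite !gt_eqF.
rewrite a2; move=> H.
under eq_fun do rewrite -t2; apply: H.
  by under eq_fun do rewrite t2.
by under eq_fun do rewrite tdE td2.
Qed.

(** The order of the choices matters: the range [t] of the rescaled errors depends on [k] alone, the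
    linearization accuracy [e / (2 t)] depends on [t], and the neighbourhood [rho] on that accuracy.
    Only then is [n] taken large. *)
Lemma side_delta_method s e k : s = 1 \/ s = -1 -> 0 < e -> 0 < k ->
  \forall n \near \oo, fine (P [set w | e < `|Num.sqrt (rate b n) *
    (bias_corrected delta (sample_mean X (side_kernel c s (b n)) n w)
       (sample_mean X (side_kernel c s (b n / delta)) n w) - mean_bc s n -
     (weight1 delta * (sample_mean X (side_kernel c s (b n)) n w - kernel_mean c f s (b n)) +
      weight2 delta * (sample_mean X (side_kernel c s (b n / delta)) n w -
        kernel_mean c f s (b n / delta))))|]) <= k.
Proof.
move=> s1 e0 k0.
have bE n : b n = 1 * b n by rewrite mul1r.
have bdE n : b n / delta = delta^-1 * b n by rewrite mulrC.
have di : 0 < delta^-1 by rewrite invr_gt0.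
have [C1 C10 H1] := estimator_tight densX c0 mf f_ge0 L0 r0 r1 tay b_gt0 b_rate s1 ltr01 bE indepX.
have [C2 C20 H2] := estimator_tight densX c0 mf f_ge0 L0 r0 r1 tay b_gt0 b_rate s1 di bdE indepX.
have [t t0 C12] := chebyshev_budget C10 C20 k0.
have et0 : 0 < e / (2 * t) by rewrite divr_gt0// mulr_gt0.
have [rho /andP[rho0 _] Hs] := powR_prod_strict (F0_gt0 s1)
  (bias_corrected_exponents delta_gt0 delta_lt1) et0.
have rho2 : 0 < rho / 2 by rewrite divr_gt0.
have rt : 0 < rho / 2 / t by rewrite divr_gt0.
have m1 := kernel_mean_cvg c0 b_gt0 b_cvg mf f_ge0 L0 r0 r1 tay s1.
have m2 := kernel_mean_cvg c0 bd_gt0 bd_cvg mf f_ge0 L0 r0 r1 tay s1.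
move/cvgrPdist_le : m1 => /(_ _ rho2) m1; move/cvgrPdist_le : m2 => /(_ _ rho2) m2.
have := inv_sqrt_rate_cvg b_gt0 b_rate; move/cvgrPdist_le => /(_ _ rt) m3.
apply: filterS2 (filterI near_gt0 (filterI H1 H2)) (filterI m1 (filterI m2 m3)).
move=> n [n0 [h1 h2]] [k1 [k2 k3]].
have {h1} h1 := h1 t t0; have {h2} h2 := h2 t t0.
have mA x : measurable_fun setT (sample_mean X (side_kernel c s x) n).
  by apply: measurable_sample_mean; exact: measurable_side_kernel.
have N0 : 0 < Num.sqrt (rate b n) by rewrite sqrtr_gt0 rate_gt0.
apply: le_trans C12; apply: le_trans (lerD h1 h2).
rewrite /mean_bc /bias_corrected /weight1 /weight2.
have k4 : (Num.sqrt (rate b n))^-1 <= rho / 2 / t.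
  by move: k3; rewrite sub0r normrN ger0_norm ?invr_ge0 ?(ltW N0).
exact: (delta_event P (mA _) (mA _) N0 t0 e0 Hs k1 k2 k4).
Qed.

End bias_corrected_estimators.

Section jump_estimator.
Context {d : measure_display} {T : measurableType d} {R : realType}.
Variable P : probability T R.
Variable X : nat -> {RV P >-> R}.

Lemma sample_mean_lin (g h : R -> R) x y n w :
  sample_mean X (fun u => x * g u + y * h u) n w = x * sample_mean X g n w + y * sample_mean X h n w.
Proof. by rewrite /sample_mean big_split/= -!big_distrr/=; ring. Qed.

Lemma sample_mean_sub (g h : R -> R) n w :
  sample_mean X (fun u => g u - h u) n w = sample_mean X g n w - sample_mean X h n w.
Proof. by rewrite /sample_mean sumrB mulrBr. Qed.

Lemma measurable_kernel_plus b c : measurable_fun setT (kernel_plus c b c : R -> R).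
Proof.
apply: measurable_funM; last exact: measurable_indic.
apply: measurable_funM => //; apply: measurable_funM; first exact: measurable_powR.
by apply: measurableT_comp => //; apply: measurable_funM => //; exact: measurableT_comp.
Qed.

Lemma measurable_kernel_minus b c : measurable_fun setT (kernel_minus c b c : R -> R).
Proof.
apply: measurable_funM; last exact: measurable_indic.
apply: measurable_funM => //; apply: measurable_funM; first exact: measurable_powR.
by apply: measurableT_comp => //; apply: measurable_funM => //; exact: measurableT_comp.
Qed.

Lemma measurable_bias_corrected delta (A B : T -> R) : measurable_fun setT A ->
  measurable_fun setT B -> measurable_fun setT (fun w => bias_corrected delta (A w) (B w)).
Proof. by move=> mA mB; apply: measurable_funM; exact: (measurableT_comp (measurable_powR _)). Qed.

Lemma measurable_Jtilde delta b c n :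
  measurable_fun setT (fun w => Jtilde delta b c n (fun i => X i w)).
Proof.
have mp x : measurable_fun setT (fun w => fhat_plus x c n (fun i => X i w)).
  by apply: (@measurable_sample_mean _ _ _ P X (kernel_plus c x c) n); exact: measurable_kernel_plus.
have mm x : measurable_fun setT (fun w => fhat_minus x c n (fun i => X i w)).
  by apply: (@measurable_sample_mean _ _ _ P X (kernel_minus c x c) n); exact: measurable_kernel_minus.
by apply: measurable_funB; exact: measurable_bias_corrected.
Qed.

Definition side_estimate c delta s b n w : R :=
  bias_corrected delta (sample_mean X (side_kernel c s b) n w)
    (sample_mean X (side_kernel c s (b / delta)) n w).

Lemma measurable_side_estimate c delta s b n : measurable_fun setT (side_estimate c delta s b n).
Proof.
apply: measurable_bias_corrected; apply: measurable_sample_mean; exact: measurable_side_kernel.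
Qed.

(** Both bandwidths must be at most [c] for the incomplete gamma functions to be expressed by the
    Laplace weight; this holds eventually. *)
Lemma JtildeE c delta b n w : 0 < c -> 0 < b -> 0 < b / delta -> b <= c -> b / delta <= c ->
  Jtilde delta b c n (fun i => X i w) =
  side_estimate c delta 1 b n w - side_estimate c delta (-1) b n w.
Proof.
move=> c0 b0 bd0 bc bdc; rewrite /Jtilde /ftilde_plus /ftilde_minus.
have p x : 0 < x -> x <= c -> fhat_plus x c n (fun i => X i w) = sample_mean X (side_kernel c 1 x) n w.
  by move=> x0 xc; congr (_ * _); apply: eq_bigr => i _; exact: kernel_plusE.
have m x : 0 < x -> x <= c -> fhat_minus x c n (fun i => X i w) = sample_mean X (side_kernel c (-1) x) n w.
  by move=> x0 xc; congr (_ * _); apply: eq_bigr => i _; exact: kernel_minusE.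
by rewrite (p _ b0 bc) (p _ bd0 bdc) (m _ b0 bc) (m _ bd0 bdc).
Qed.

Variables (c delta : R) (f : R -> R) (L r : R) (F0 F1 F2 : R -> R).
Hypothesis indepX : mutually_independent X.
Hypothesis densX : forall k, has_density (X k) f.
Hypothesis c0 : 0 < c.
Hypothesis delta_gt0 : 0 < delta.
Hypothesis delta_lt1 : delta < 1.
Hypothesis mf : measurable_fun setT f.
Hypothesis f_ge0 : forall u, 0 <= f u.
Hypothesis L0 : 0 < L.
Hypothesis r0 : 0 < r.
Hypothesis r1 : r <= 1.
Hypothesis F0_gt0 : forall s, s = 1 \/ s = -1 -> 0 < F0 s.
Hypothesis tay : forall s y, s = 1 \/ s = -1 -> 0 < y -> (s = -1 -> y < c) ->
  `|f (c + s * y) - (F0 s + s * F1 s * y + F2 s / 2 * y ^+ 2)| <= L * y `^ (2 + r).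
Variable b : nat -> R.
Hypothesis b_gt0 : forall n, 0 < b n.
Hypothesis b_rate : b n + (n%:R * b n)^-1 @[n --> \oo] --> (0 : R).
Local Notation q := (Num.sqrt delta).

Let b_cvg := bandwidth_cvg b_gt0 b_rate.
Let bd_gt0 n : 0 < b n / delta. Proof. by rewrite divr_gt0. Qed.
Let bd_cvg : b n / delta @[n --> \oo] --> (0 : R).
Proof. by rewrite -(mul0r delta^-1); apply: cvgM => //; exact: cvg_cst. Qed.

Let side1 : (1 : R) = 1 \/ (1 : R) = -1. Proof. by left. Qed.
Let sideN1 : (-1 : R) = 1 \/ (-1 : R) = -1. Proof. by right. Qed.

Definition mean_jump n : R := mean_bc c delta f b 1 n - mean_bc c delta f b (-1) n.

Lemma mean_jump_expansion :
  (mean_jump n - (F0 1 - F0 (-1)) -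
   q^-1 * (c / pi * (F1 1 ^+ 2 / F0 1 - F1 (-1) ^+ 2 / F0 (-1)) -
     ((1 - 4 / (3 * pi)) * (F1 1 - F1 (-1)) + c / 2 * (F2 1 - F2 (-1)))) * b n) / b n
  @[n --> \oo] --> (0 : R).
Proof.
pose D s n := (mean_bc c delta f b s n - F0 s - q^-1 * (c / pi * (F1 s ^+ 2 / F0 s) -
    (F1 s * (1 - 4 / (3 * pi)) + F2 s * c / 2)) * b n) / b n.
have h s (s1 : s = 1 \/ s = -1) : D s n @[n --> \oo] --> (0 : R) :=
  mean_bc_expansion c0 delta_gt0 delta_lt1 mf f_ge0 L0 r0 r1 F0_gt0 tay b_gt0 b_rate s1.
have H : D 1 n - D (-1) n @[n --> \oo] --> (0 : R).
  by rewrite -(subrr 0); apply: cvgB; exact: h.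
apply: (cvg0_near_eq _ H); apply: nearW => n; rewrite /mean_jump /D.
move: (mean_bc c delta f b 1 n) (mean_bc c delta f b (-1) n) => m1 m2.
rewrite -[RHS]mulrBl; congr (_ * _).
move: (4 / (3 * pi)) (c / pi) (q^-1) (F0 1) (F0 (-1)) (F1 1) (F1 (-1)) (F2 1) (F2 (-1)).
move=> K Cp Q a1 a2 a3 a4 a5 a6; ring.
Qed.

Let S n := partial_sum X (centered X (jump_kernel c delta b n) (Num.sqrt (rate b n) / n%:R)) n.

Let deviation s n w := weight1 delta *
    (sample_mean X (side_kernel c s (b n)) n w - kernel_mean c f s (b n)) +
  weight2 delta *
    (sample_mean X (side_kernel c s (b n / delta)) n w - kernel_mean c f s (b n / delta)).

Let S_deviation n w : (0 < n)%N ->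
  S n w = Num.sqrt (rate b n) * (deviation 1 n w - deviation (-1) n w).
Proof.
move=> n0; rewrite /S partial_sum_centered//; congr (_ * _).
have lin_sub (x y A B A' B' : R) :
  x * A + y * B - (x * A' + y * B') = x * (A - A') + y * (B - B') by ring.
have subACA (A B A' B' : R) : A - B - (A' - B') = A - A' - (B - B') by ring.
have E s : s = 1 \/ s = -1 -> sample_mean X (side_combination c delta b s n) n w -
    \int[P]_v side_combination c delta b s n (X 0%N v) = deviation s n w.
  move=> s1; rewrite (side_combination_mean densX c0 delta_gt0 b_gt0 n s1).
  rewrite [sample_mean _ _ _ _]sample_mean_lin; exact: lin_sub.
rewrite -(E _ side1) -(E _ sideN1) [sample_mean _ _ _ _]sample_mean_sub.
rewrite (jump_kernel_mean X c0 delta_gt0 b_gt0 n); exact: subACA.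
Qed.

Lemma jump_estimator_near e k : 0 < e -> 0 < k ->
  \forall n \near \oo, fine (P [set w | e <
    `|Num.sqrt (rate b n) * (Jtilde delta (b n) c n (fun i => X i w) - mean_jump n) - S n w|]) <= k.
Proof.
move=> e0 k0; have e2 : 0 < e / 2 by rewrite divr_gt0.
have k2 : 0 < k / 2 by rewrite divr_gt0.
have H s (s1 : s = 1 \/ s = -1) := side_delta_method indepX densX c0 delta_gt0 delta_lt1 mf f_ge0
  L0 r0 r1 F0_gt0 tay b_gt0 b_rate s1 e2 k2.
apply: filterS2 (filterI near_gt0 (filterI (H 1 side1) (H (-1) sideN1)))
  (filterI (near_beta b_cvg c0) (near_beta bd_cvg c0)).
move=> n [n0 [h1 h2]] [bc bdc].
rewrite [leRHS](splitr k).
apply: le_trans (lerD h1 h2).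
have mdev s : measurable_fun setT (deviation s n).
  by apply: measurable_funD; apply: measurable_funM => //; apply: measurable_funB => //;
    apply: measurable_sample_mean; exact: measurable_side_kernel.
have mS : measurable_fun setT (S n).
  by apply: measurable_partial_sum; apply: measurable_centered; exact: measurable_jump_kernel.
have mterm s : measurable_fun setT (fun w => Num.sqrt (rate b n) *
    (side_estimate c delta s (b n) n w - mean_bc c delta f b s n - deviation s n w)).
  apply: measurable_funM => //; apply: measurable_funB => //; apply: measurable_funB => //.
  exact: measurable_side_estimate.
apply: fine_prob_le_add.
- apply: measurable_norm_gt; apply: measurable_funB => //; apply: measurable_funM => //.
  by apply: measurable_funB => //; exact: measurable_Jtilde.
- exact: (measurable_norm_gt _ (mterm 1)).
- exact: (measurable_norm_gt _ (mterm (-1))).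
move=> w /= he.
pose D s := Num.sqrt (rate b n) *
  (side_estimate c delta s (b n) n w - mean_bc c delta f b s n - deviation s n w).
have {}he : e < `|D 1 - D (-1)|.
  apply: (lt_le_trans he); rewrite (JtildeE n w c0 (b_gt0 n) (bd_gt0 n) bc bdc) S_deviation//.
  rewrite /D /mean_jump.
  move: (side_estimate _ _ _ _ _ _) (side_estimate _ _ _ _ _ _) (mean_bc _ _ _ _ _ _) (mean_bc _ _ _ _ _ _)
     (deviation _ _ _) (deviation _ _ _) (Num.sqrt _) => a1 a2 a3 a4 a5 a6 a7.
  rewrite le_eqVlt; apply/orP; left; apply/eqP; congr (`|_|); ring.
have [h|h] := lerP `|D 1| (e / 2); last by left.
right; rewrite -/(D (-1)) ltNge; apply/negP => h'; move: he; rewrite ltNge => /negP; apply.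
by apply: le_trans (ler_normB _ _) _; rewrite (splitr e) lerD.
Qed.

(** The sequence [Y] is left free because the two conclusions of the theorem centre the estimator
    differently while sharing the same linear sum. *)
Lemma jump_estimator_clt (Y : nat -> T -> R) : (forall n, measurable_fun setT (Y n)) ->
  (forall e k, 0 < e -> 0 < k ->
    \forall n \near \oo, fine (P [set w | e < `|Y n w - S n w|]) <= k) ->
  cvg_in_distribution P Y (normal_prob 0 (Num.sqrt
    (lambda_coef delta * ((F0 1 + F0 (-1)) / (Num.sqrt pi * Num.sqrt c))))).
Proof.
move=> mY Ynear.
pose a n := Num.sqrt (rate b n) / n%:R.
have V0 : 0 < lambda_coef delta * ((F0 1 + F0 (-1)) / (Num.sqrt pi * Num.sqrt c)).
  rewrite mulr_gt0 ?lambda_coef_gt0// divr_gt0 ?addr_gt0 ?F0_gt0//.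
  by rewrite mulr_gt0// sqrtr_gt0// pi_gt0.
have mjk n := measurable_jump_kernel c delta b n.
have jkM n u := jump_kernel_le c0 delta_gt0 b_gt0 n u.
apply: (@clt_perturbed _ _ _ P X indepX (fun n => centered X (jump_kernel c delta b n) (a n))
  _ _ _ _ _ _ _ _ _ V0 Y mY Ynear).
- by move=> n; exact: measurable_centered.
- by move=> n u; exact: (centered_le X (a n) (mjk n) (jkM n) u).
- by move=> n k; exact: (centered_mean densX (a n) (mjk n) (jkM n) k).
- by move=> n k; exact: (centered_second densX (a n) (mjk n) (jkM n) k).
- exact: (linear_bound_cvg c0 delta_gt0 mf f_ge0 L0 r0 r1 tay b_gt0 b_rate).
- exact: (linear_variance_cvg densX c0 delta_gt0 delta_lt1 mf f_ge0 L0 r0 r1 tay b_gt0 b_rate).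
Qed.

End jump_estimator.

Theorem theorem1 (R : realType) (d : measure_display) (T : measurableType d)
  (P : probability T R) (X : nat -> {RV P >-> R}) (f : R -> R)
  (c delta : R) (b : nat -> R)
  (c_gt0 : 0 < c) (delta_gt0 : 0 < delta) (delta_lt1 : delta < 1)
  (assumption1 : iid_sample X f)
  (assumption2 : smooth_off f c)
  (b_gt0 : forall n, 0 < b n)
  (assumption3 : b n + (n%:R * b n)^-1 @[n --> \oo] --> (0 : R)) :
  (exists r : nat -> R,
     (r n / b n @[n --> \oo] --> (0 : R)) /\
     cvg_in_distribution P
       (fun n w =>
          Num.sqrt (n%:R * Num.sqrt (b n)) *
          (Jtilde delta (b n) c n (fun i => X i w) - jump f c
           - bias_coef f c delta * b n + r n))
       (normal_prob 0 (Num.sqrt (var_coef f c delta)))) /\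
  (n%:R * b n `^ (5 / 2) @[n --> \oo] --> (0 : R) ->
   cvg_in_distribution P
     (fun n w =>
        Num.sqrt (n%:R * Num.sqrt (b n)) *
        (Jtilde delta (b n) c n (fun i => X i w) - jump f c))
     (normal_prob 0 (Num.sqrt (var_coef f c delta)))).
Proof.
have [indepX densX _] := assumption1.
have [mf f_ge0 _] := densX 0%N.
have [L [r [L0 r0 r1 F0_gt0 tay]]] := side_taylor c_gt0 assumption2.
have right j : side_derivn f 1 j c = right_derivn f j c by rewrite /side_derivn eqxx.
have left j : side_derivn f (-1) j c = left_derivn f j c.
  by rewrite /side_derivn ifF//; apply/negbTE/eqP => h; lra.
have near_clt := jump_estimator_near indepX densX c_gt0 delta_gt0 delta_lt1 mf f_ge0 L0 r0 r1
  F0_gt0 tay b_gt0 assumption3.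
have clt := jump_estimator_clt indepX densX c_gt0 delta_gt0 delta_lt1 mf f_ge0 L0 r0 r1
  F0_gt0 tay b_gt0 assumption3.
have bias := mean_jump_expansion c_gt0 delta_gt0 delta_lt1 mf f_ge0 L0 r0 r1 F0_gt0 tay b_gt0
  assumption3.
rewrite !right !left -/(jump f c) -/(bias_coef f c delta) in bias.
rewrite right left -/(var_coef f c delta) in clt.
pose m n := mean_jump c delta f b n.
have bias' : (m n - jump f c - bias_coef f c delta * b n) / b n @[n --> \oo] --> (0 : R) by exact: bias.
have mJ n (y : R) : measurable_fun setT (fun w =>
    Num.sqrt (n%:R * Num.sqrt (b n)) * (Jtilde delta (b n) c n (fun i => X i w) - y)).
  by apply: measurable_funM => //; apply: measurable_funB => //; exact: measurable_Jtilde.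
split.
  (* The remainder is the exact non-random error of the bias formula, so the statistic becomes the
     estimator centred at [m n]. *)
  exists (fun n => - (m n - jump f c - bias_coef f c delta * b n)); split.
    under eq_fun do rewrite mulNr.
    by rewrite -oppr0; apply: cvgN.
  have -> : (fun n w => Num.sqrt (n%:R * Num.sqrt (b n)) *
      (Jtilde delta (b n) c n (fun i => X i w) - jump f c - bias_coef f c delta * b n -
       (m n - jump f c - bias_coef f c delta * b n))) =
      (fun n w => Num.sqrt (rate b n) * (Jtilde delta (b n) c n (fun i => X i w) - m n)).
    by apply/funext => n; apply/funext => w; congr (_ * _); ring.
  by apply: clt => [n|e k]; [exact: mJ|exact: near_clt].
move=> nb.
have vanish : Num.sqrt (rate b n) * (m n - jump f c) @[n --> \oo] --> (0 : R).
  (* This product is the square root of [n b^(5/2)], which is where the additional bandwidth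
     condition enters. *)
  have rb : Num.sqrt (rate b n) * b n @[n --> \oo] --> (0 : R).
    have -> : (fun n => Num.sqrt (rate b n) * b n) = (fun n => Num.sqrt (n%:R * b n `^ (5 / 2))).
      apply/funext => n; have b0 := ltW (b_gt0 n).
      rewrite -[X in _ * X = _](ger0_norm b0) -sqrtr_sqr -sqrtrM ?rate_ge0//; congr (Num.sqrt _).
      rewrite (_ : 5 / 2 = 2^-1 + 2); last by field.
      rewrite powRD ?(gt_eqF (b_gt0 n)) ?implybT// powR12_sqrt// powR_mulrn//.
      by rewrite /rate mulrA.
    exact: cvg_sqrt0.
  have -> : (fun n => Num.sqrt (rate b n) * (m n - jump f c)) = (fun n =>
     Num.sqrt (rate b n) * b n * ((m n - jump f c - bias_coef f c delta * b n) / b n + bias_coef f c delta)).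
    by apply/funext => n; field; rewrite gt_eqF.
  rewrite -(mul0r (0 + bias_coef f c delta)); apply: cvgM => //.
  by apply: cvgD => //; exact: cvg_cst.
apply: clt => [n|e k e0 k0]; first exact: mJ.
have e2 : 0 < e / 2 by rewrite divr_gt0.
move/cvgrPdist_le : vanish => /(_ _ e2) vanish.
(* Half of [e] covers the random approximation error, the other half the vanishing deterministic
   bias. *)
apply: filterS2 (near_clt (e / 2) k e2 k0) vanish => n h; rewrite sub0r normrN => v.
apply: le_trans h; apply: fine_prob_le.
- apply: measurable_norm_gt; apply: measurable_funB; first exact: mJ.
  by apply: measurable_partial_sum; apply: measurable_centered; exact: measurable_jump_kernel.
- apply: measurable_norm_gt; apply: measurable_funB; first exact: mJ.
  by apply: measurable_partial_sum; apply: measurable_centered; exact: measurable_jump_kernel.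
move=> w /=; rewrite -/(rate b n) -/(m n).
move: (partial_sum _ _ _ _) (Jtilde _ _ _ _ _) v => S J v h.
have -> : Num.sqrt (rate b n) * (J - m n) - S =
  (Num.sqrt (rate b n) * (J - jump f c) - S) - Num.sqrt (rate b n) * (m n - jump f c) by ring.
have := lerB_dist (Num.sqrt (rate b n) * (J - jump f c) - S) (Num.sqrt (rate b n) * (m n - jump f c)).
lra.
Qed.
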